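(* Let $M\subset\mathbb{C}^n$ be a $\mathcal{C}^1$ hypersurface or, more generally, suppose that $M$ can be represented locally as a Lipschitz graph. Let $p\in M$, and let $M$ divide a neighbourhood $\Omega$ of $p$ in $\mathbb{C}^n$ into two components $\Omega^{+}$ and $\Omega^-$. Suppose that $M$ has two-sided support at $p$, so that there are germs at $p$ of complex hypersurfaces $A^{+}$ and $A^-$ with $A^{+}\subset\overline{\Omega^{+}}$ and $A^-\subset\overline{\Omega^-}$. Then $A^+=A^-\subset M$.
   Context: ''Hypersurface'' here means real hypersurface (real codimension one); ''represented locally as a Lipschitz graph'' means that near each point, after a suitable (affine complex) choice of coordinates $(z',z_n)\in\mathbb{C}^{n-1}\times\mathbb{C}$ with $z_n=x_n+iy_n$, $M$ is given by $y_n=g(z',x_n)$ with $g$ a real-valued Lipschitz function. A complex hypersurface (germ) is a complex analytic set of pure complex dimension $n-1$, possibly singular, passing through $p$. Inclusions and equalities are between germs at $p$. *)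

(* Defs.v *)
From HB Require Import structures.
From mathcomp Require Import all_boot all_order all_algebra.
From mathcomp Require Import all_classical all_reals all_analysis.
From mathcomp.real_closed Require Import complex.
Set Implicit Arguments.
Unset Strict Implicit.
Unset Printing Implicit Defensive.
Import Order.TTheory GRing.Theory Num.Theory.
Import numFieldNormedType.Exports.
Local Open Scope classical_set_scope.
Local Open Scope ring_scope.

(* The complex numbers, typed as a numClosedFieldType so that they carry the
   topology given by their norm. C^N is ['rV[Cx R]_N], a normed space over Cx R:
   on it [differentiable] and ['d F a] are Frechet differentiability and the
   differential over the complex numbers. *)
Definition Cx (R : realType) : numClosedFieldType := R[i].

Section ComplexAnalyticSets.
Variables (R : realType) (N : nat).
Implicit Types (A U V : set 'rV[Cx R]_N) (a : 'rV[Cx R]_N).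

Definition holomorphic_on d V (F : 'rV[Cx R]_N -> 'rV[Cx R]_d) :=
  forall z, V z -> differentiable F z.

Definition analytic_subset U A :=
  A `<=` U /\
  forall a, U a -> exists V m (F : 'rV[Cx R]_N -> 'rV[Cx R]_m),
    [/\ open V, V a, V `<=` U, holomorphic_on V F
      & A `&` V = V `&` F @^-1` [set 0]].

(* The points near which A is a complex submanifold of dimension k, i.e. the
   zero set of a holomorphic submersion to C^(N - k). *)
Definition regular_locus A k : set 'rV[Cx R]_N := [set a |
  A a /\ exists d V (F : 'rV[Cx R]_N -> 'rV[Cx R]_d),
    [/\ (k + d = N)%N, open V /\ V a, holomorphic_on V F,
        (forall w, exists v, 'd F a v = w)
      & A `&` V = V `&` F @^-1` [set 0]]].

(* dim_a A = k, the dimension at a being the limsup of the dimensions of A at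
   its regular points z as z tends to a. *)
Definition dim_at A a k :=
  (\forall z \near a, forall l, regular_locus A l z -> (l <= k)%N) /\
  closure (regular_locus A k) a.

Definition pure_dim A k := forall a, A a -> dim_at A a k.

(* The set A represents, through its intersection with a neighbourhood of p,
   a germ at p of analytic sets of pure dimension k passing through p. *)
Definition pure_dim_germ a k A :=
  A a /\ exists U,
    [/\ open U, U a, analytic_subset U (A `&` U) & pure_dim (A `&` U) k].

Definition germ_subset a A U := \forall z \near a, A z -> U z.

Definition germ_eq a A U := \forall z \near a, A z <-> U z.

End ComplexAnalyticSets.

Definition complex_hypersurface_germ (R : realType) (n : nat)
    (p : 'rV[Cx R]_n.+1) (A : set 'rV[Cx R]_n.+1) :=
  pure_dim_germ p n A.

Section RealHypersurfaces.
Variables (R : realType) (n : nat).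
Implicit Types (M D : set 'rV[Cx R]_n.+1).

Definition real_coords m (z : 'rV[Cx R]_m) : 'rV[R]_m * 'rV[R]_m :=
  (map_mx (@complex.Re R) z, map_mx (@complex.Im R) z).

Definition C1_hypersurface M :=
  forall q, M q -> exists (W : set ('rV[R]_n.+1 * 'rV[R]_n.+1))
                          (rho : 'rV[R]_n.+1 * 'rV[R]_n.+1 -> R),
    [/\ open W /\ W (real_coords q),
        forall x, W x -> differentiable rho x,
        forall x v, W x -> {for x, continuous (fun y => 'd rho y v)},
        forall x, W x -> rho x = 0 -> exists v, 'd rho x v != 0
      & forall z, W (real_coords z) -> (M z <-> rho (real_coords z) = 0)].

(* The point (z', x_n) attached to w = (z', x_n + i y_n). *)
Definition graph_base (w : 'rV[Cx R]_n.+1) : 'rV[R]_n * 'rV[R]_n * R :=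
  (real_coords (col' ord_max w), complex.Re (w 0 ord_max)).

(* Near each point q of M, in the affine complex coordinates w = z T + b, M is
   given by y_n = g(z', x_n). *)
Definition locally_lipschitz_graph M :=
  forall q, M q -> exists (U : set 'rV[Cx R]_n.+1) (T : 'M[Cx R]_n.+1)
      (b : 'rV[Cx R]_n.+1) (g : 'rV[R]_n * 'rV[R]_n * R -> R),
    [/\ open U /\ U q, T \in unitmx,
        [lipschitz g x | x in [set graph_base (z *m T + b) | z in U]]
      & forall z, U z ->
          (M z <-> complex.Im ((z *m T + b) 0 ord_max)
                     = g (graph_base (z *m T + b)))].

Definition is_component D (C : set 'rV[Cx R]_n.+1) :=
  exists2 x, D x & C = connected_component D x.

Definition divides_into M (Omega Op Om : set 'rV[Cx R]_n.+1) :=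
  [/\ is_component (Omega `\` M) Op, is_component (Omega `\` M) Om,
      Op <> Om & Omega `\` M = Op `|` Om].

End RealHypersurfaces.

(* Main.v *)
Require Import Defs.
From HB Require Import structures.
From mathcomp Require Import all_boot all_order all_algebra.
From mathcomp Require Import all_classical all_reals all_analysis.
From mathcomp.real_closed Require Import complex.
From mathcomp Require Import ring lra.
Set Implicit Arguments.
Unset Strict Implicit.
Unset Printing Implicit Defensive.
Import Order.TTheory GRing.Theory Num.Theory.
Import numFieldNormedType.Exports.
Local Open Scope classical_set_scope.
Local Open Scope ring_scope.

(** Near p the hypersurface M is the zero set of a continuous real function sg that increases
    strictly in a fixed direction v ([height]). For a hypersurface of class C1, sg is a defining
    function and v a vector on which its differential is positive ([C1_height]); for a Lipschitz
    graph, sg is y_n - g and v points along the y_n axis ([lipschitz_height]). Moving along v and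
    then parallel to M, one sees that the points near p with sg > 0 belong to one component of
    the complement of M, and so do those with sg < 0. As p is adherent to both components, one of
    them is {sg > 0} near p and the other {sg < 0} ([divided_sides]), so that, up to exchanging
    the two germs, A is contained in {sg >= 0} and B in {sg <= 0}. In particular b - a is never a
    positive multiple of v for a in A and b in B, and this separation alone makes the germs of A
    and B coincide ([two_sided_coincide]). Then A is contained in {sg = 0} = M.

    To prove that A = B, let f be the product of an equation of A and an equation of B near p,
    neither of which vanishes identically on the line p + C v. The fiber over y is the finite set
    of the small zeros of z -> f (y + z v). Call y good when its fiber has the maximal number k
    of points. Over the good locus the points of the fibers depend holomorphically on y
    ([good_sheets]), and A and B are unions of such sheets ([A_sheet]). The product of the
    differences of the points of a fiber, extended by 0 to the bad points, is continuous, and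
    holomorphic where it is not 0 ([sheet_disc_barrier]). By Rado's form of the maximum principle
    such functions obey the identity theorem, so the good locus is dense near p ([good_dense])
    and, restricting the product to the fibers that avoid A, every good fiber near p meets A
    ([fiber_nonempty]); likewise for B.

    For y good, let root_sum y be the sum of the square roots of b - a over all points a of A and
    b of B in the fiber, with the branch of the square root that is cut along the positive
    reals and has values in the upper half plane. By the separation of A and B the differences
    b - a never cross the cut, so root_sum is holomorphic on the good locus, and its imaginary
    part is nonnegative. It tends to 0 at p, since the fiber over p is {0}. The lemma of
    Schwarz and Pick, which extends across the bad locus by Rado's method once more, bounds
    root_sum y + i e by twice its value at good points tending to p ([harnack]); hence
    root_sum vanishes, and all the imaginary parts with it, so that b - a is a nonnegative real, and
    then is 0 by separation. Thus A and B have the same points on every good fiber near p, and by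
    density they agree near p ([coincide]).

    The complex analysis starts from Goursat's theorem for rectangles. The maximum principle
    follows without Cauchy's formula: from the mere fact that the integral of 1 / (z - a) around
    a is not 0 one gets a bound with a constant, and the constant disappears when the bound is
    applied to powers ([maxmod_rect]). Removable singularities and Cauchy's inequalities then come from
    the maximum principle applied to difference quotients. In several variables a holomorphic
    function is handled as a continuous function that is holomorphic on complex lines
    ([mhol]); this class is stable under directional derivatives ([mholb_D]), which reduce
    a zero of constant multiplicity to a simple zero, where the implicit function theorem
    applies ([sheet_hol]). *)

(** * Real-valued norms on complex normed spaces *)

Section RealNorm.
Variable R : realType.
Local Notation C := (Cx R).

Definition ofR (x : R) : C := (x%:C)%C.

(** The norm of a normed space over the complex numbers is itself a complex number; nm
    is the same norm with values in the totally ordered field R. *)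
Definition nm (V : normedModType C) (x : V) : R := complex.Re (`|x| : R[i]).

Lemma ofRD x y : ofR (x + y) = ofR x + ofR y. Proof. exact: rmorphD. Qed.
Lemma ofRB x y : ofR (x - y) = ofR x - ofR y. Proof. exact: rmorphB. Qed.
Lemma ofRM x y : ofR (x * y) = ofR x * ofR y. Proof. exact: rmorphM. Qed.
Lemma ofR0 : ofR 0 = 0. Proof. by []. Qed.
Lemma ofR1 : ofR 1 = 1. Proof. by []. Qed.
Lemma ofR_inj : injective ofR. Proof. exact: complexI. Qed.
Lemma le_ofR x y : (ofR x <= ofR y) = (x <= y). Proof. exact: lecR. Qed.
Lemma lt_ofR x y : (ofR x < ofR y) = (x < y). Proof. exact: ltcR. Qed.
Lemma gt0_ofR (e : C) : 0 < e -> exists2 d : R, 0 < d & e = ofR d.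
Proof.
move=> e0; exists (complex.Re e).
  by move: (e0); rewrite ltcE => /andP[].
by rewrite /ofR -[LHS]RRe_real// gtr0_real.
Qed.

Section Vec.
Variable V : normedModType C.
Implicit Types x y : V.

Lemma nmE x : `|x| = ofR (nm x).
Proof. by rewrite /nm /ofR RRe_real// normr_real. Qed.
Lemma nm_ge0 x : 0 <= nm x.
Proof. by rewrite -le_ofR ofR0 -nmE. Qed.
Lemma nmN x : nm (- x) = nm x. Proof. by rewrite /nm normrN. Qed.
Lemma nm0 : nm (0 : V) = 0. Proof. by rewrite /nm normr0. Qed.
Lemma nm_eq0 x : nm x = 0 -> x = 0.
Proof. by move=> h; apply/eqP; rewrite -normr_eq0 nmE h ofR0. Qed.
Lemma nm_gt0 x : (0 < nm x) = (x != 0).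
Proof. by rewrite -lt_ofR ofR0 -nmE normr_gt0. Qed.
Lemma nmD x y : nm (x + y) <= nm x + nm y.
Proof. rewrite -le_ofR ofRD -!nmE; exact: ler_normD. Qed.
Lemma nmB x y : nm (x - y) <= nm x + nm y.
Proof. by rewrite -(nmN y) nmD. Qed.
Lemma nmC x y : nm (x - y) = nm (y - x). Proof. by rewrite -nmN opprB. Qed.
Lemma nm_tri x y z : nm (x - z) <= nm (x - y) + nm (y - z).
Proof. by rewrite (le_trans _ (nmD _ _))// subrKA. Qed.
Lemma nmBge x y : nm x - nm y <= nm (x - y).
Proof. by rewrite lerBlDr (le_trans _ (nmD _ _))// subrK. Qed.

Lemma nbhs_nm x (P : set V) :
  nbhs x P <-> exists2 e : R, 0 < e & forall y, nm (y - x) < e -> P y.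
Proof.
split => [|[e e0 h]].
  move=> /nbhs_normP[e /= e0 h]; have [d d0 de] := gt0_ofR e0.
  exists d => // y hy; apply: h; rewrite /= distrC nmE de lt_ofR//.
apply/nbhs_normP; exists (ofR e) => /=; first by rewrite -(ofR0) lt_ofR.
by move=> y /=; rewrite distrC nmE lt_ofR; exact: h.
Qed.

Lemma near_nm x (e : R) : 0 < e -> \forall y \near x, nm (y - x) < e.
Proof. by move=> e0; apply/nbhs_nm; exists e. Qed.

Lemma ball_near x y (r : R) : nm (x - y) < r -> \forall z \near x, nm (z - y) < r.
Proof.
move=> h; apply/nbhs_nm; exists (r - nm (x - y)); first by rewrite subr_gt0.
by move=> z hz; apply: le_lt_trans (nm_tri _ x _) _; rewrite -ltrBrDr.
Qed.

End Vec.

Lemma nmZ (V : normedModType C) (a : C) (x : V) : nm (a *: x) = nm a * nm x.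
Proof. by apply: ofR_inj; rewrite -nmE normrZ !nmE -ofRM. Qed.
Lemma nmM (a b : C) : nm (a * b) = nm a * nm b.
Proof. by apply: ofR_inj; rewrite -nmE normrM !nmE -ofRM. Qed.
Lemma nm1 : nm (1 : C) = 1.
Proof. by apply: ofR_inj; rewrite -nmE normr1. Qed.
Lemma nmX (a : C) n : nm (a ^+ n) = nm a ^+ n.
Proof. by elim: n => [|n IH]; rewrite ?expr0 ?nm1// !exprS nmM IH. Qed.
Lemma nmV (a : C) : nm (a^-1) = (nm a)^-1.
Proof.
have [->|a0] := eqVneq a 0; first by rewrite invr0 nm0 invr0.
by apply: (mulfI (_ : nm a != 0)); rewrite -?nmM ?divff ?nm1// gt_eqF ?nm_gt0.
Qed.
Lemma nm_ofR x : nm (ofR x) = `|x|.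
Proof. by rewrite /nm /ofR normc_def /= expr0n addr0 sqrtr_sqr. Qed.
Lemma nm_Re (a : C) : `|complex.Re a| <= nm a.
Proof. by rewrite /nm -lecR RRe_real ?normr_real//; exact: normc_ge_Re. Qed.
Lemma nm_i : nm (('i)%C : C) = 1.
Proof. by rewrite /nm normc_def/= expr0n add0r expr1n sqrtr1. Qed.
Lemma nm_Im (a : C) : `|complex.Im a| <= nm a.
Proof.
have := nm_Re (a * ('i)%C); rewrite nmM nm_i mulr1.
by rewrite [complex.Re _](ReiNIm a) normrN.
Qed.
Lemma nm_ReIm (a : C) : nm a <= `|complex.Re a| + `|complex.Im a|.
Proof.
rewrite [X in nm X](complexE a) (le_trans (nmD _ _))// nm_ofR nmM nm_i mul1r.
by rewrite lerD2l nm_ofR.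
Qed.

End RealNorm.

(** * Holomorphic functions of one variable *)

Section Hol.
Variable R : realType.
Local Notation C := (Cx R).
Implicit Types (f g h : C -> C) (z w : C).

Lemma contP (U V : normedModType C) (f : U -> V) x :
  {for x, continuous f} <->
  forall e : R, 0 < e -> exists2 d : R, 0 < d & forall y, nm (y - x) < d -> nm (f y - f x) < e.
Proof.
split => [fx e e0|h].
  have /nbhs_nm[d d0 hd] := fx _ (near_nm (f x) e0).
  by exists d.
by move=> P /= /nbhs_nm[e e0 he]; have [d d0 hd] := h e e0; apply/nbhs_nm; exists d => // y /hd/he.
Qed.

Lemma cont_near (U V : topologicalType) (f g : U -> V) x :
  (\forall y \near x, g y = f y) -> {for x, continuous f} -> {for x, continuous g}.
Proof.
move=> fg fx; have gx := nbhs_singleton fg.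
rewrite /prop_for /continuous_at gx; apply: cvg_trans fx.
by apply: near_eq_cvg; near=> y; rewrite (near fg y).
Unshelve. all: end_near. Qed.

Section Cont.
Variable U : topologicalType.
Implicit Types (u v : U -> C) (x : U).
Lemma cont_cst (V : topologicalType) (c : V) x : {for x, continuous (fun _ : U => c)}.
Proof. exact: cst_continuous. Qed.
Lemma contD u v x : {for x, continuous u} -> {for x, continuous v} ->
  {for x, continuous (fun y => u y + v y)}.
Proof. by move=> hu hv; exact: (@continuousD C C U u v x hu hv). Qed.
Lemma contN u x : {for x, continuous u} -> {for x, continuous (fun y => - u y)}.
Proof. by move=> hu; exact: (@continuousN C C U u x hu). Qed.
Lemma contB u v x : {for x, continuous u} -> {for x, continuous v} ->
  {for x, continuous (fun y => u y - v y)}.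
Proof. by move=> hu hv; exact: (@continuousB C C U u v x hu hv). Qed.
Lemma contM u v x : {for x, continuous u} -> {for x, continuous v} ->
  {for x, continuous (fun y => u y * v y)}.
Proof. by move=> hu hv; exact: (@continuousM C U u v x hu hv). Qed.
Lemma contV u x : {for x, continuous u} -> u x != 0 -> {for x, continuous (fun y => (u y)^-1)}.
Proof. by move=> hu hv; exact: (@continuousV C U u x hv hu). Qed.
Lemma contX u n x : {for x, continuous u} -> {for x, continuous (fun y => u y ^+ n)}.
Proof.
move=> hu; elim: n => [|n IH]; first exact: cont_cst.
by apply: cont_near (contM hu IH); apply: filterE => y; rewrite exprS.
Qed.
Lemma cont_neq0 u x : {for x, continuous u} -> u x != 0 -> \forall y \near x, u y != 0.
Proof.
move=> fz f0; apply: (fz [set y | y != 0]); apply/nbhs_nm; exists (nm (u x)); rewrite ?nm_gt0//.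
by move=> y; apply: contraTneq => ->; rewrite sub0r nmN ltxx.
Qed.
End Cont.
Lemma cont_id (U : topologicalType) (x : U) : {for x, continuous (fun y : U => y)}.
Proof. exact: cvg_id. Qed.

Arguments cont_id {U} x.
Arguments cont_cst {U V} c x.
Arguments contD {U u v x}.
Arguments contB {U u v x}.
Arguments contN {U u x}.
Arguments contM {U u v x}.
Arguments contV {U u x}.
Arguments contX {U u} n {x}.
Arguments cont_near {U V f g x}.

(** Complex differentiability in Caratheodory's form: the factor g is the difference
    quotient at z, and it is continuous at z. In this form products, composites and
    inverses are computed without limits. *)
Definition hol f z := exists2 g : C -> C, {for z, continuous g} &
  forall w, f w = f z + (w - z) * g w.

Lemma hol_near_ex f z g : {for z, continuous g} ->
  (\forall w \near z, f w = f z + (w - z) * g w) -> hol f z.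
Proof.
move=> gz fz; exists (fun w => if w == z then g z else (f w - f z) / (w - z)); last first.
  move=> w; case: eqVneq => [->|wz]; first by rewrite subrr mul0r addr0.
  by rewrite mulrCA divff ?subr_eq0// mulr1 addrC subrK.
apply: cont_near gz; near=> w; case: eqVneq => [->//|wz].
have -> : f w = f z + (w - z) * g w by near: w.
by rewrite [f z + _]addrC addrK mulrAC divff ?subr_eq0// mul1r.
Unshelve. all: end_near. Qed.

Lemma hol_cont f z : hol f z -> {for z, continuous f}.
Proof.
move=> [g gz fE]; rewrite (_ : f = fun w => f z + (w - z) * g w); last exact/funext.
apply: contD; first exact: cont_cst.
exact: (contM (contB (cont_id z) (cont_cst z z)) gz).
Qed.

Lemma hol_near f g z : (\forall w \near z, g w = f w) -> hol f z -> hol g z.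
Proof.
move=> fg [k kz fE]; apply: (hol_near_ex kz).
have gz := nbhs_singleton fg.
by near=> w; rewrite gz -fE; near: w.
Unshelve. all: end_near. Qed.

Lemma hol_cst (c : C) z : hol (fun=> c) z.
Proof. by exists (fun=> 0); [exact: cont_cst|move=> w; rewrite mulr0 addr0]. Qed.

Lemma hol_id z : hol id z.
Proof. by exists (fun=> 1); [exact: cont_cst|move=> w; rewrite mulr1 addrC subrK]. Qed.

Lemma holD f g z : hol f z -> hol g z -> hol (fun w => f w + g w) z.
Proof.
move=> [f' cf fE] [g' cg gE]; exists (fun w => f' w + g' w); first exact: (contD cf cg).
by move=> w; rewrite {1}fE {1}gE mulrDr addrACA.
Qed.

Lemma holM f g z : hol f z -> hol g z -> hol (fun w => f w * g w) z.
Proof.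
move=> hf hg; have cont := hol_cont hf.
move: hf hg => [f' cf fE] [g' cg gE]; exists (fun w => f' w * g z + f w * g' w).
  exact: (contD (contM cf (cont_cst _ _)) (contM cont cg)).
by move=> w; rewrite (gE w) mulrDr {1}(fE w); ring.
Qed.

Lemma holN f z : hol f z -> hol (fun w => - f w) z.
Proof.
move=> hf; apply: (hol_near _ (holM (hol_cst (-1) z) hf)); apply: filterE => w.
by rewrite mulN1r.
Qed.

Lemma holB f g z : hol f z -> hol g z -> hol (fun w => f w - g w) z.
Proof. by move=> hf hg; exact: (holD hf (holN hg)). Qed.

Lemma holX f n z : hol f z -> hol (fun w => f w ^+ n) z.
Proof.
move=> hf; elim: n => [|n IH]; first exact: (hol_cst 1).
by apply: (hol_near _ (holM hf IH)); apply: filterE => w; rewrite exprS.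
Qed.

Lemma hol_comp f g z : hol f z -> hol g (f z) -> hol (fun w => g (f w)) z.
Proof.
move=> hf [g' cg gE]; have cf := hol_cont hf; move: hf => [f' cf' fE].
exists (fun w => f' w * g' (f w)); first exact: (contM cf' (continuous_comp cf cg)).
by move=> w; rewrite (gE (f w)) mulrA; congr (_ + _ * _); rewrite (fE w) addrAC subrr add0r.
Qed.

Lemma holV f z : hol f z -> f z != 0 -> hol (fun w => (f w)^-1) z.
Proof.
move=> hf f0; have cf := hol_cont hf; move: hf => [f' cf' fE].
have fz0 : f z * f z != 0 by rewrite mulf_neq0.
apply: (@hol_near_ex _ _ (fun w => - f' w * (f w * f z)^-1)).
  exact: (contM (contN cf') (contV (contM cf (cont_cst (f z) z)) fz0)).
apply: filterS (cont_neq0 cf f0) => w fw.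
have -> : (w - z) * (- f' w * (f w * f z)^-1) = - ((w-z) * f' w) * (f w * f z)^-1 by ring.
have -> : (w - z) * f' w = f w - f z by rewrite (fE w) addrAC subrr add0r.
by field; rewrite fw f0.
Qed.

Lemma hol_sum (I : Type) (s : seq I) (F : I -> C -> C) z :
  (forall i, hol (F i) z) -> hol (fun w => \sum_(i <- s) F i w) z.
Proof.
move=> h; elim: s => [|i s IH].
  by apply: (hol_near _ (hol_cst 0 z)); apply: filterE => w; rewrite big_nil.
by apply: (hol_near _ (holD (h i) IH)); apply: filterE => w; rewrite big_cons.
Qed.

Lemma hol_prod (I : eqType) (s : seq I) (F : I -> C -> C) z :
  (forall i, i \in s -> hol (F i) z) -> hol (fun w => \prod_(i <- s) F i w) z.
Proof.
elim: s => [|i s IH] h.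
  by apply: (hol_near _ (hol_cst 1 z)); apply: filterE => w; rewrite big_nil.
have hi : hol (F i) z by apply: h; rewrite mem_head.
have hs : hol (fun w => \prod_(j <- s) F j w) z.
  by apply: IH => j js; apply: h; rewrite inE js orbT.
by apply: (hol_near _ (holM hi hs)); apply: filterE => w; rewrite big_cons.
Qed.

Lemma hol_subc (c z : C) : hol (fun w => w - c) z.
Proof. exact: (holB (hol_id z) (hol_cst c z)). Qed.

Definition der f z : C := xget 0 [set l | {for z, continuous
  (fun w => if w == z then l else (f w - f z) / (w - z))}].
(** The value at the center makes the quotient continuous whenever f is differentiable,
    so that taking difference quotients amounts to dividing f - f z by w - z, and can be
    repeated. *)
Definition dq f z w : C := if w == z then der f z else (f w - f z) / (w - z).

Lemma dqE f z w : f w = f z + (w - z) * dq f z w.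
Proof.
rewrite /dq; case: eqVneq => [->|wz]; first by rewrite subrr mul0r addr0.
by rewrite mulrCA divff ?subr_eq0// mulr1 addrC subrK.
Qed.

Lemma dq_neq f z w : w != z -> dq f z w = (f w - f z) / (w - z).
Proof. by rewrite /dq => /negbTE ->. Qed.

Lemma dqC f z w : w != z -> dq f z w = dq f w z.
Proof. by move=> wz; rewrite !dq_neq// 1?eq_sym// -[w - z]opprB invrN mulrN -mulNr opprB. Qed.

Lemma hol_dq_cont f z : hol f z -> {for z, continuous (dq f z)}.
Proof.
move=> [g gz fE]; apply: (@xgetPex _ 0 [set l | {for z, continuous
  (fun w => if w == z then l else (f w - f z) / (w - z))}]); exists (g z) => /=.
apply: (cont_near _ gz); apply: filterE => w; case: eqVneq => [->//|wz].
by rewrite (fE w) addrAC subrr add0r mulrAC divff ?subr_eq0// mul1r.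
Qed.

Lemma neq_near z w : w != z -> \forall u \near w, u != z.
Proof.
move=> wz; apply/nbhs_nm; exists (nm (w - z)); first by rewrite nm_gt0 subr_eq0.
by move=> y; apply: contraTneq => ->; rewrite nmC ltxx.
Qed.

Lemma hol_dq_off f z w : hol f w -> w != z -> hol (dq f z) w.
Proof.
move=> fw wz; have wz0 : w - z != 0 by rewrite subr_eq0.
apply: (hol_near _ (holM (holB fw (hol_cst (f z) w)) (holV (hol_subc z w) wz0))).
by apply: filterS (neq_near wz) => u uz; rewrite dq_neq.
Qed.

Lemma hol_dq_contw f z w : hol f z -> hol f w -> {for w, continuous (dq f z)}.
Proof.
by move=> fz fw; have [->|wz] := eqVneq w z; [exact: hol_dq_cont|apply/hol_cont/hol_dq_off].
Qed.

End Hol.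

Arguments cont_id {U} x.
Arguments cont_cst {U V} c x.
Arguments contD {R U u v x}.
Arguments contB {R U u v x}.
Arguments contN {R U u x}.
Arguments contM {R U u v x}.
Arguments contV {R U u x}.
Arguments contX {R U u} n {x}.
Arguments cont_near {U V f g x}.
Arguments hol_subc {R} c z.

(** * Integrals of continuous real functions *)

Section RealIntegral.
Variable R : realType.
Implicit Types (f g : R -> R) (a b c : R).

Definition rint f a b : R := \int[lebesgue_measure]_(x in `[a, b]) f x.
Definition cont_itv f a b := forall x, a <= x <= b -> {for x, continuous f}.

Lemma cont_itv_within f a b : cont_itv f a b -> {within `[a, b], continuous f}.
Proof.
move=> h; apply: continuous_in_subspaceT => x /set_mem /=.
by rewrite in_itv/= => /h.
Qed.

Lemma cont_itv_integrable f a b : cont_itv f a b -> (@lebesgue_measure R).-integrable `[a, b] (EFin \o f).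
Proof.
by move=> /cont_itv_within h; apply: continuous_compact_integrable => //; exact: segment_compact.
Qed.

Lemma cont_itvS f a b c d : a <= c -> d <= b -> cont_itv f a b -> cont_itv f c d.
Proof.
move=> ac db h x /andP[cx xd]; apply: h.
by rewrite (le_trans ac cx) (le_trans xd db).
Qed.

Lemma rintD f g a b : cont_itv f a b -> cont_itv g a b ->
  rint (fun x => f x + g x) a b = rint f a b + rint g a b.
Proof. by move=> hf hg; rewrite /rint RintegralD//; exact: cont_itv_integrable. Qed.

Lemma rint_ext f g a b : (forall x, a <= x <= b -> f x = g x) -> rint f a b = rint g a b.
Proof.
by move=> h; apply: eq_Rintegral => x; rewrite inE/= in_itv/= => /h.
Qed.

Lemma rint_split f a b c : a <= b -> b <= c -> cont_itv f a c -> rint f a c = rint f a b + rint f b c.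
Proof.
move=> ab bc h.
have := @Rintegral_itvB R f (BLeft a) (BRight c) b (cont_itv_integrable h).
rewrite !bnd_simp => /(_ ab bc) => e.
have hb : (@lebesgue_measure R).-integrable `]b, c] (EFin \o f).
  apply: integrableS (cont_itv_integrable (cont_itvS ab (lexx c) h)) => //.
  by apply: subset_itvr; rewrite bnd_simp.
rewrite (Rintegral_itv_obnd_cbnd hb) in e.
by rewrite /rint -e addrC subrK.
Qed.

Lemma rint_cst (k a b : R) : a <= b -> rint (fun=> k) a b = k * (b - a).
Proof.
rewrite le_eqVlt => /predU1P[->|ab]; rewrite /rint Rintegral_cst//= lebesgue_measure_itv/=.
  by rewrite lte_fin ltxx/= subrr.
by rewrite lte_fin ab.
Qed.

Lemma cont_itv_cst (k a b : R) : cont_itv (fun=> k) a b.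
Proof. by move=> x _; exact: cst_continuous. Qed.

Lemma rint_le f g a b : cont_itv f a b -> cont_itv g a b ->
  (forall x, a <= x <= b -> f x <= g x) -> rint f a b <= rint g a b.
Proof.
move=> hf hg h; apply: le_Rintegral  => //; [exact: cont_itv_integrable|exact: cont_itv_integrable].
Qed.

Lemma rint_ge (k : R) f a b : a <= b -> cont_itv f a b ->
  (forall x, a <= x <= b -> k <= f x) -> k * (b - a) <= rint f a b.
Proof. by move=> ab hf h; rewrite -rint_cst//; apply: rint_le => //; exact: cont_itv_cst. Qed.

Lemma rint_bound (k : R) f a b : a <= b -> cont_itv f a b ->
  (forall x, a <= x <= b -> `|f x| <= k) -> `|rint f a b| <= k * (b - a).
Proof.
move=> ab hf h; rewrite ler_norml -mulNr; apply/andP; split.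
  by apply: rint_ge => // x /h; rewrite ler_norml => /andP[].
rewrite -rint_cst//; apply: rint_le => //; first exact: cont_itv_cst.
by move=> x /h; rewrite ler_norml => /andP[].
Qed.

Lemma rint_affine (u v a b : R) : a <= b ->
  rint (fun x => u + v * x) a b = (u + v * ((a + b) / 2)) * (b - a).
Proof.
rewrite le_eqVlt => /predU1P[->|ab].
  by rewrite subrr mulr0 /rint set_itv1 Rintegral_set1.
pose F (x : R) := u * x + v / 2 * (x * x).
have dF (x : R) : is_derive x 1 F (u + v * x).
  have hd : is_derive x 1 (fun y : R => y) 1 by exact: is_derive_id.
  apply: is_derive_eq.
  by rewrite /GRing.scale/=; field.
have cF (x : R) : {for x, continuous F}.
  by apply: differentiable_continuous; apply/derivable1_diffP; have [] := dF x.
rewrite /rint /Rintegral (@continuous_FTC2 _ _ F)//.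
- by rewrite /=/F; field.
- by apply: cont_itv_within => x _; apply: cvgD; [exact: cvg_cst|apply: cvgM; [exact: cvg_cst|exact: cvg_id]].
- split.
  + by move=> x _; have [] := dF x.
  + by apply: cvg_at_right_filter; exact: cF.
  + by apply: cvg_at_left_filter; exact: cF.
- by move=> x _; rewrite derive1E; have [] := dF x.
Qed.

End RealIntegral.

(** * Integrals over the boundary of a rectangle *)

Section RectIntegral.
Variable R : realType.
Local Notation C := (Cx R).
Implicit Types (f g : C -> C).

Definition pt (x y : R) : C := (x +i* y)%C.

Lemma ptE x y : pt x y = ofR x + ('i)%C * ofR y.
Proof. by rewrite /pt [LHS]complexE. Qed.
Lemma pt_ReIm (z : C) : pt (complex.Re z) (complex.Im z) = z. Proof. by case: z. Qed.
Lemma nm_pt (x y : R) : nm (pt x y) <= `|x| + `|y|. Proof. exact: nm_ReIm. Qed.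
Lemma ptB (a b c d : R) : pt a b - pt c d = pt (a - c) (b - d). Proof. by []. Qed.

Lemma cont_of_lip (U V : normedModType C) (f : R -> V) (x : R) :
  (forall y, nm (f y - f x) <= `|y - x|) -> {for x, continuous f}.
Proof.
move=> h P /= /nbhs_nm[e e0 he]; apply/nbhs_normP; exists e => //= y.
by move=> hy; apply: he; rewrite (le_lt_trans (h y))// distrC.
Qed.

Lemma ptx_cont (x y : R) : {for x, continuous (fun x => pt x y)}.
Proof.
apply: (@cont_of_lip C) => x'; rewrite ptB subrr (le_trans (nm_pt _ _))//.
by rewrite normr0 addr0.
Qed.
Lemma pty_cont (x y : R) : {for y, continuous (fun y => pt x y)}.
Proof.
apply: (@cont_of_lip C) => x'; rewrite ptB subrr (le_trans (nm_pt _ _))//.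
by rewrite normr0 add0r.
Qed.

Lemma ReB (w z : C) : complex.Re (w - z) = complex.Re w - complex.Re z.
Proof. by case: w; case: z. Qed.
Lemma ImB (w z : C) : complex.Im (w - z) = complex.Im w - complex.Im z.
Proof. by case: w; case: z. Qed.

Lemma Re_cont (z : C) : {for z, continuous (@complex.Re R : C -> R)}.
Proof.
move=> P /= /nbhs_normP[e /= e0 he]; apply/(@nbhs_nm R C z); exists e => // w hw.
apply: he => /=; rewrite distrC; apply: le_lt_trans hw.
by rewrite -ReB nm_Re.
Qed.
Lemma Im_cont (z : C) : {for z, continuous (@complex.Im R : C -> R)}.
Proof.
move=> P /= /nbhs_normP[e /= e0 he]; apply/(@nbhs_nm R C z); exists e => // w hw.
apply: he => /=; rewrite distrC; apply: le_lt_trans hw.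
by rewrite -ImB nm_Im.
Qed.

Definition ccont_itv (p : R -> C) a b := forall x, a <= x <= b -> {for x, continuous p}.
Definition cint (p : R -> C) a b : C :=
  pt (rint (fun x => complex.Re (p x)) a b) (rint (fun x => complex.Im (p x)) a b).

Lemma ccont_itv_Re p a b : ccont_itv p a b -> cont_itv (fun x => complex.Re (p x)) a b.
Proof. by move=> h x /h hx; exact: (continuous_comp hx (@Re_cont _)). Qed.
Lemma ccont_itv_Im p a b : ccont_itv p a b -> cont_itv (fun x => complex.Im (p x)) a b.
Proof. by move=> h x /h hx; exact: (continuous_comp hx (@Im_cont _)). Qed.

Lemma cint_D p q a b : ccont_itv p a b -> ccont_itv q a b ->
  cint (fun x => p x + q x) a b = cint p a b + cint q a b.
Proof.
move=> hp hq; rewrite /cint.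
rewrite -[RHS]/(pt (_ + _) (_ + _)) -rintD; [|exact: ccont_itv_Re|exact: ccont_itv_Re].
rewrite -rintD; [|exact: ccont_itv_Im|exact: ccont_itv_Im].
by congr pt; apply: rint_ext => x _; case: (p x) => ? ?; case: (q x).
Qed.

Lemma cint_ext p q a b : (forall x, a <= x <= b -> p x = q x) -> cint p a b = cint q a b.
Proof. by move=> h; rewrite /cint; congr pt; apply: rint_ext => x /h ->. Qed.

Lemma cint_split p a b c : a <= b -> b <= c -> ccont_itv p a c -> cint p a c = cint p a b + cint p b c.
Proof.
move=> ab bc h; rewrite /cint -[RHS]/(pt (_ + _) (_ + _)).
by congr pt; apply: rint_split => //; [exact: ccont_itv_Re|exact: ccont_itv_Im].
Qed.

Lemma cint_bound (k : R) p a b : a <= b -> ccont_itv p a b ->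
  (forall x, a <= x <= b -> nm (p x) <= k) -> nm (cint p a b) <= 2 * k * (b - a).
Proof.
move=> ab hp h; apply: (le_trans (nm_pt _ _)); rewrite mulrAC mulr2n mulrDl mul1r mulrDl.
rewrite -[(b - a) * k]mulrC.
apply: lerD; apply: rint_bound => //; try exact: ccont_itv_Re; try exact: ccont_itv_Im.
  by move=> x /h; apply: le_trans; exact: nm_Re.
by move=> x /h; apply: le_trans; exact: nm_Im.
Qed.

Lemma cint_affine (u v : C) p a b : a <= b -> (forall x, p x = u + v * ofR x) ->
  cint p a b = (u + v * ofR ((a + b) / 2)) * ofR (b - a).
Proof.
move=> ab h; case: u v h => [u1 u2] [v1 v2] h.
rewrite /cint (@rint_ext _ _ (fun x => u1 + v1 * x)); last first.
  by move=> x _; rewrite h/= mulr0 subr0.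
rewrite [X in pt _ X](@rint_ext _ _ (fun x => u2 + v2 * x)); last first.
  by move=> x _; rewrite h/= mulr0 add0r.
by rewrite !rint_affine// /ofR /=; apply/eqP; rewrite eq_complex/=; apply/andP; split;
  apply/eqP; ring.
Qed.

Definition cont_rect f x1 x2 y1 y2 :=
  forall x y, x1 <= x <= x2 -> y1 <= y <= y2 -> {for pt x y, continuous f}.

(** The integral of f z dz along the boundary of the rectangle, counterclockwise. *)
Definition rectI f x1 x2 y1 y2 : C :=
  cint (fun x => f (pt x y1)) x1 x2 - cint (fun x => f (pt x y2)) x1 x2 +
  ('i)%C * (cint (fun y => f (pt x2 y)) y1 y2 - cint (fun y => f (pt x1 y)) y1 y2).

Section Rect.
Variables (x1 x2 y1 y2 : R).
Hypotheses (hx : x1 <= x2) (hy : y1 <= y2).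

Lemma cont_rect_h f y : y1 <= y <= y2 -> cont_rect f x1 x2 y1 y2 -> ccont_itv (fun x => f (pt x y)) x1 x2.
Proof. by move=> yy h x xx; exact: (continuous_comp (@ptx_cont x y) (h _ _ xx yy)). Qed.
Lemma cont_rect_v f x : x1 <= x <= x2 -> cont_rect f x1 x2 y1 y2 -> ccont_itv (fun y => f (pt x y)) y1 y2.
Proof. by move=> xx h y yy; exact: (continuous_comp (@pty_cont x y) (h _ _ xx yy)). Qed.

Let x1in : x1 <= x1 <= x2. Proof. by rewrite lexx. Qed.
Let x2in : x1 <= x2 <= x2. Proof. by rewrite lexx andbT. Qed.
Let y1in : y1 <= y1 <= y2. Proof. by rewrite lexx. Qed.
Let y2in : y1 <= y2 <= y2. Proof. by rewrite lexx andbT. Qed.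

Definition on_bd (x y : R) := (x1 <= x <= x2 /\ (y = y1 \/ y = y2)) \/
  (y1 <= y <= y2 /\ (x = x1 \/ x = x2)).
Definition cont_bd f := forall x y, on_bd x y -> {for pt x y, continuous f}.

Lemma on_bd_in x y : on_bd x y -> x1 <= x <= x2 /\ y1 <= y <= y2.
Proof. by move=> [[? [|] ->]|[? [|] ->]]. Qed.
Lemma cont_rect_bd f : cont_rect f x1 x2 y1 y2 -> cont_bd f.
Proof. by move=> h x y /on_bd_in[]; exact: h. Qed.

Lemma cont_bd_edges f : cont_bd f -> [/\ ccont_itv (fun x => f (pt x y1)) x1 x2,
  ccont_itv (fun x => f (pt x y2)) x1 x2, ccont_itv (fun y => f (pt x1 y)) y1 y2
  & ccont_itv (fun y => f (pt x2 y)) y1 y2].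
Proof.
move=> h; split => t tt.
- by apply: (continuous_comp (@ptx_cont t _) (h _ _ _)); left; split => //; left.
- by apply: (continuous_comp (@ptx_cont t _) (h _ _ _)); left; split => //; right.
- by apply: (continuous_comp (@pty_cont _ t) (h _ _ _)); right; split => //; left.
- by apply: (continuous_comp (@pty_cont _ t) (h _ _ _)); right; split => //; right.
Qed.

Lemma rectI_D f g : cont_bd f -> cont_bd g ->
  rectI (fun z => f z + g z) x1 x2 y1 y2 = rectI f x1 x2 y1 y2 + rectI g x1 x2 y1 y2.
Proof.
by move=> /cont_bd_edges[? ? ? ?] /cont_bd_edges[? ? ? ?]; rewrite /rectI !cint_D//; ring.
Qed.

Lemma rectI_ext f g : (forall x y, on_bd x y -> f (pt x y) = g (pt x y)) ->
  rectI f x1 x2 y1 y2 = rectI g x1 x2 y1 y2.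
Proof.
move=> h; rewrite /rectI; congr (_ - _ + _ * (_ - _)); apply: cint_ext => t tt; apply: h.
- by left; split => //; left.
- by left; split => //; right.
- by right; split => //; right.
- by right; split => //; left.
Qed.

Lemma rectI_splitx f x : x1 <= x <= x2 -> cont_rect f x1 x2 y1 y2 ->
  rectI f x1 x2 y1 y2 = rectI f x1 x y1 y2 + rectI f x x2 y1 y2.
Proof.
move=> /andP[xa xb] h; rewrite /rectI (cint_split xa xb (cont_rect_h y1in h)).
by rewrite (cint_split xa xb (cont_rect_h y2in h)); ring.
Qed.

Lemma rectI_splity f y : y1 <= y <= y2 -> cont_rect f x1 x2 y1 y2 ->
  rectI f x1 x2 y1 y2 = rectI f x1 x2 y1 y + rectI f x1 x2 y y2.
Proof.
move=> /andP[xa xb] h; rewrite /rectI (cint_split xa xb (cont_rect_v x1in h)).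
by rewrite (cint_split xa xb (cont_rect_v x2in h)); ring.
Qed.

Lemma rectI_bound (k : R) f : cont_bd f ->
  (forall x y, on_bd x y -> nm (f (pt x y)) <= k) ->
  nm (rectI f x1 x2 y1 y2) <= 4 * k * ((x2 - x1) + (y2 - y1)).
Proof.
move=> /cont_bd_edges[c1 c2 c3 c4] hb.
have h x : x1 <= x <= x2 -> nm (f (pt x y1)) <= k /\ nm (f (pt x y2)) <= k.
  by move=> xx; split; apply: hb; left; split => //; [left|right].
have v y : y1 <= y <= y2 -> nm (f (pt x1 y)) <= k /\ nm (f (pt x2 y)) <= k.
  by move=> xx; split; apply: hb; right; split => //; [left|right].
have h1 := cint_bound hx c1 (fun x hx => proj1 (h x hx)).
have h2 := cint_bound hx c2 (fun x hx => proj2 (h x hx)).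
have h3 := cint_bound hy c3 (fun x hx => proj1 (v x hx)).
have h4 := cint_bound hy c4 (fun x hx => proj2 (v x hx)).
apply: (le_trans (nmD _ _)); rewrite nmM nm_i mul1r.
have := nmB (cint (fun x => f (pt x y1)) x1 x2) (cint (fun x => f (pt x y2)) x1 x2).
have := nmB (cint (fun y => f (pt x2 y)) y1 y2) (cint (fun y => f (pt x1 y)) y1 y2).
lra.
Qed.

Lemma rectI_affine (u v : C) f : (forall z, f z = u + v * z) -> rectI f x1 x2 y1 y2 = 0.
Proof.
move=> h; rewrite /rectI.
rewrite (@cint_affine (u + v * ('i)%C * ofR y1) v)//; last first.
  by move=> x; rewrite h ptE; ring.
rewrite (@cint_affine (u + v * ('i)%C * ofR y2) v)//; last first.
  by move=> x; rewrite h ptE; ring.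
rewrite (@cint_affine (u + v * ofR x2) (v * ('i)%C))//; last first.
  by move=> x; rewrite h ptE; ring.
rewrite (@cint_affine (u + v * ofR x1) (v * ('i)%C))//; last first.
  by move=> x; rewrite h ptE; ring.
by rewrite !ofRB; ring.
Qed.

End Rect.
End RectIntegral.

(** * Goursat's theorem *)

Lemma cont_affine (R : realType) (c1 c2 x : Cx R) :
  {for x, continuous (fun w : Cx R => c1 + c2 * w)}.
Proof.
apply: (@contD _ _ (fun=> c1) (fun w => c2 * w)); first exact: cont_cst.
by apply: (@contM _ _ (fun=> c2) (fun w => w)); [exact: cont_cst|exact: cont_id].
Qed.

Section Goursat.
Variable R : realType.
Local Notation C := (Cx R).
Implicit Types (f g : C -> C).

Lemma ex_pow2 (L d : R) : 0 < d -> exists k, L / 2 ^+ k < d.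
Proof.
move=> d0; have [k hk] : exists k : nat, L / d < k%:R.
  exists (Num.bound `|L / d|); apply: (le_lt_trans (ler_norm _)).
  by apply: archi_boundP; exact: normr_ge0.
exists k; rewrite ltr_pdivrMr ?exprn_gt0// -ltr_pdivrMl// mulrC (lt_le_trans hk)//.
by rewrite -natrX ler_nat ltnW// ltn_expl.
Qed.

Lemma nested_point (X W : nat -> R) :
  (forall k, X k <= X k.+1) -> (forall k, X k.+1 + W k.+1 <= X k + W k) -> (forall k, 0 <= W k) ->
  exists x, forall k, X k <= x <= X k + W k.
Proof.
move=> h1 h2 W0.
have up j k : X j <= X (j + k)%N by elim: k => [|k IH]; rewrite ?addn0// addnS (le_trans IH).
have dn j k : X (j + k)%N + W (j + k)%N <= X j + W j.
  by elim: k => [|k IH]; rewrite ?addn0// addnS (le_trans _ IH).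
have ub k j : X j <= X k + W k.
  have [jk|kj] := leqP j k.
    by have := up j (k - j)%N; rewrite subnKC// => /le_trans; apply; rewrite lerDl.
  have := dn k (j - k)%N; rewrite subnKC 1?ltnW// => h.
  by apply: le_trans h; rewrite lerDl.
exists (sup (range X)) => k; apply/andP; split.
  by apply: ub_le_sup; [exists (X 0%N + W 0%N) => _ [j _ <-]|exists k].
by apply: ge_sup; [exists (X 0%N), 0%N|move=> _ [j _ <-]].
Qed.

Section Proof.
Variables (f : C -> C) (x1 x2 y1 y2 : R).
Hypotheses (hx : x1 <= x2) (hy : y1 <= y2).
Hypothesis hf : forall x y, x1 <= x <= x2 -> y1 <= y <= y2 -> hol f (pt x y).

Let W k : R := (x2 - x1) / 2 ^+ k.
Let H k : R := (y2 - y1) / 2 ^+ k.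
Let J k (p : R * R) : C := rectI f p.1 (p.1 + W k) p.2 (p.2 + H k).
Let sub k (p : R * R) := [/\ x1 <= p.1, p.1 + W k <= x2, y1 <= p.2 & p.2 + H k <= y2].
Let nxt k (p q : R * R) := [/\ sub k.+1 q, p.1 <= q.1 /\ q.1 + W k.+1 <= p.1 + W k,
   p.2 <= q.2 /\ q.2 + H k.+1 <= p.2 + H k & nm (J k p) <= 4 * nm (J k.+1 q)].

Let W0 k : 0 <= W k. Proof. by rewrite divr_ge0 ?subr_ge0// exprn_ge0. Qed.
Let H0 k : 0 <= H k. Proof. by rewrite divr_ge0 ?subr_ge0// exprn_ge0. Qed.
Let WS k : W k = W k.+1 + W k.+1.
Proof. by rewrite /W exprS; field; rewrite expf_neq0. Qed.
Let HS k : H k = H k.+1 + H k.+1.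
Proof. by rewrite /H exprS; field; rewrite expf_neq0. Qed.

Let sub_crect k p : sub k p -> cont_rect f p.1 (p.1 + W k) p.2 (p.2 + H k).
Proof.
move=> [a b c d] x y /andP[xa xb] /andP[ya yb]; apply: hol_cont; apply: hf.
  by rewrite (le_trans a xa) (le_trans xb b).
by rewrite (le_trans c ya) (le_trans yb d).
Qed.

Let quarter k p : sub k p -> exists q, nxt k p q.
Proof.
move=> sp; have cr := sub_crect sp; case: sp => a b c d.
have w := W0 k.+1; have h := H0 k.+1; have ws := WS k; have hs := HS k.
set xm := p.1 + W k.+1; set ym := p.2 + H k.+1.
have xmi : p.1 <= xm <= p.1 + W k by rewrite /xm; apply/andP; split; lra.
have ymi : p.2 <= ym <= p.2 + H k by rewrite /ym; apply/andP; split; lra.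
have wk := W0 k; have hk := H0 k.
have lx : p.1 <= p.1 + W k by rewrite lerDl.
have ly : p.2 <= p.2 + H k by rewrite lerDl.
(* the corners of the quarters are (p.1 or xm, p.2 or ym) *)
have mk q1 q2 : q1 = p.1 \/ q1 = xm -> q2 = p.2 \/ q2 = ym ->
    nm (J k p) <= 4 * nm (J k.+1 (q1, q2)) -> nxt k p (q1, q2).
  clear cr => h1 h2 hJ; rewrite /xm in h1; rewrite /ym in h2.
  have [z1 z2] : p.1 <= q1 /\ q1 + W k.+1 <= p.1 + W k.
    by clear hJ h2; split; case: h1 => ->; lra.
  have [z3 z4] : p.2 <= q2 /\ q2 + H k.+1 <= p.2 + H k.
    by clear hJ h1; split; case: h2 => ->; lra.
  split => //=; split => //=.
  - exact: le_trans z1. - exact: le_trans b. - exact: le_trans z3. - exact: le_trans d.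
have e1 : J k p = (J k.+1 (p.1, p.2) + J k.+1 (p.1, ym)) + (J k.+1 (xm, p.2) + J k.+1 (xm, ym)).
  rewrite /J/= (rectI_splitx ly xmi cr) [xm + _](_ : _ = p.1 + W k); last by rewrite /xm; lra.
  rewrite [ym + _](_ : _ = p.2 + H k); last by rewrite /ym; lra.
  rewrite (@rectI_splity _ p.1 xm _ _ _ f ym)//; first last.
  - by move=> x y xx yy; apply: cr => //; move: xx xmi => /andP[-> /=]; lra.
  - by case/andP: xmi.
  rewrite (@rectI_splity _ xm (p.1 + W k) _ _ _ f ym)//.
  - by case/andP: xmi.
  - by move=> x y xx yy; apply: cr => //; move: xx xmi => /andP[? ->] /=; lra.
have le4 := nmD (J k.+1 (p.1, p.2) + J k.+1 (p.1, ym)) (J k.+1 (xm, p.2) + J k.+1 (xm, ym)).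
rewrite -e1 in le4.
have le2 := nmD (J k.+1 (p.1, p.2)) (J k.+1 (p.1, ym)).
have le3 := nmD (J k.+1 (xm, p.2)) (J k.+1 (xm, ym)).
have [i1|i1] := leP (nm (J k p)) (4 * nm (J k.+1 (p.1, p.2))).
  by exists (p.1, p.2); apply: mk => //; left.
have [i2|i2] := leP (nm (J k p)) (4 * nm (J k.+1 (p.1, ym))).
  by exists (p.1, ym); apply: mk => //; [left|right].
have [i3|i3] := leP (nm (J k p)) (4 * nm (J k.+1 (xm, p.2))).
  by exists (xm, p.2); apply: mk => //; [right|left].
have [i4|i4] := leP (nm (J k p)) (4 * nm (J k.+1 (xm, ym))).
  by exists (xm, ym); apply: mk => //; right.
have := le_trans le4 (lerD le2 le3).
rewrite -(ler_pM2l (_ : 0 < 4 :> R)) ?ltr0n// leNgt => /negP; case.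
have -> : 4 * nm (J k p) = nm (J k p) + nm (J k p) + (nm (J k p) + nm (J k p)) by ring.
rewrite !mulrDr; exact: (ltrD (ltrD i1 i2) (ltrD i3 i4)).
Qed.

(** Bisection: one of the quarters of a rectangle carries at least a quarter of the
    integral. Near the point common to the nested rectangles f is affine up to an error
    o(|w - z|), affine functions integrate to 0, and the length of the boundary times
    this error is o(1 / 4 ^ k). *)
Lemma goursat : rectI f x1 x2 y1 y2 = 0.
Proof.
pose fix p k : R * R := if k is k'.+1 then xget (0, 0) (nxt k' (p k')) else (x1, y1).
have subp k : sub k (p k).
  elim: k => [|k IH]; first by split => //=; rewrite /W/H expr0; lra.
  by have [q hq] := quarter IH; have [] := @xgetPex _ (0, 0) (nxt k (p k)) (ex_intro _ q hq).
have nxtp k : nxt k (p k) (p k.+1).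
  by have [q hq] := quarter (subp k); exact: (@xgetPex _ (0, 0) (nxt k (p k)) (ex_intro _ q hq)).
have Jp k : nm (rectI f x1 x2 y1 y2) <= 4 ^+ k * nm (J k (p k)).
  elim: k => [|k IH].
    rewrite expr0 mul1r /J /= /W /H expr0 !divr1 ![_ + (_ - _)]addrC !subrK//.
  by apply: (le_trans IH); rewrite exprSr -mulrA ler_pM2l ?exprn_gt0//; case: (nxtp k).
have [x hxp] := @nested_point (fun k => (p k).1) W (fun k => let: And4 _ (conj a _) _ _ := nxtp k in a)
  (fun k => let: And4 _ (conj _ a) _ _ := nxtp k in a) W0.
have [y hyp] := @nested_point (fun k => (p k).2) H (fun k => let: And4 _ _ (conj a _) _ := nxtp k in a)
  (fun k => let: And4 _ _ (conj _ a) _ := nxtp k in a) H0.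
have [g cg fE] : hol f (pt x y).
  apply: hf.
    by have := hxp 0%N; rewrite /= /W expr0; lra.
  by have := hyp 0%N; rewrite /= /H expr0; lra.
set z := pt x y in cg fE.
set L := (x2 - x1) + (y2 - y1).
have L0 : 0 <= L by rewrite addr_ge0// subr_ge0.
suff key (e : R) : 0 < e -> nm (rectI f x1 x2 y1 y2) <= 4 * e * L * L.
  apply: nm_eq0; apply/eqP; rewrite eq_le nm_ge0 andbT leNgt; apply/negP => I0.
  have := key (nm (rectI f x1 x2 y1 y2) / (8 * L * L + 1)).
  have LL : 0 <= L * L by rewrite mulr_ge0.
  have D0 : 0 < 8 * L * L + 1 by rewrite -mulrA; lra.
  rewrite divr_gt0// => /(_ isT).
  rewrite (_ : 4 * _ * L * L = nm (rectI f x1 x2 y1 y2) * (4 * L * L / (8 * L * L + 1))); last by ring.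
  rewrite -{1}[nm _]mulr1 ler_pM2l// leNgt ltr_pdivrMr// mul1r -!mulrA.
  by apply/negP/negPn; lra.
move=> e0; have /contP/(_ e e0)[d d0 hd] := cg.
have [k hk] := ex_pow2 L d0.
pose r w := (w - z) * (g w - g z).
have fr : f = fun w => (f z - g z * z + g z * w) + r w.
  by apply/funext => w; rewrite /r {1}fE; ring.
have sk := subp k; have cr := sub_crect sk.
have W0k := W0 k; have H0k := H0 k.
have lx : (p k).1 <= (p k).1 + W k by rewrite lerDl.
have ly : (p k).2 <= (p k).2 + H k by rewrite lerDl.
have caff : cont_rect (fun w => f z - g z * z + g z * w) (p k).1 ((p k).1 + W k) (p k).2 ((p k).2 + H k).
  by move=> a b _ _; exact: cont_affine.
have rE : r = fun w => f w - (f z - g z * z + g z * w).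
  by apply/funext => w; rewrite {1}fr addrAC subrr add0r.
have crr : cont_rect r (p k).1 ((p k).1 + W k) (p k).2 ((p k).2 + H k).
  by move=> a b ha hb; rewrite rE; exact: (contB (cr a b ha hb) (caff a b ha hb)).
apply: (le_trans (Jp k)); rewrite /J {1}fr (rectI_D (cont_rect_bd lx ly caff) (cont_rect_bd lx ly crr)).
rewrite (@rectI_affine _ _ _ _ _ lx ly (f z - g z * z) (g z))// add0r.
have WH : W k + H k = L / 2 ^+ k by rewrite /W/H/L -mulrDl.
have bd a b : (p k).1 <= a <= (p k).1 + W k -> (p k).2 <= b <= (p k).2 + H k ->
    nm (r (pt a b)) <= e * (L / 2 ^+ k).
  move=> ha hb; rewrite /r nmM mulrC.
  have nz : nm (pt a b - z) <= L / 2 ^+ k.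
    rewrite ptB (le_trans (nm_pt _ _))// -WH.
    move: (hxp k) (hyp k) ha hb => /andP[? ?] /andP[? ?] /andP[? ?] /andP[? ?].
    by apply: lerD; rewrite ler_norml; apply/andP; split; lra.
  apply: ler_pM => //; [exact: nm_ge0|exact: nm_ge0|].
  by apply/ltW/hd/(le_lt_trans nz).
have := @rectI_bound _ _ _ _ _ lx ly (e * (L / 2 ^+ k)) r (cont_rect_bd lx ly crr)
   (fun a b hab => bd a b (on_bd_in lx ly hab).1 (on_bd_in lx ly hab).2).
rewrite ![_ + _ - _]addrAC !subrr !add0r WH => hb.
rewrite -ler_pdivlMl ?exprn_gt0//; apply: (le_trans hb).
have -> : (4 : R) ^+ k = 2 ^+ k * 2 ^+ k by rewrite -exprMn; congr (_ ^+ _); ring.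
by rewrite le_eqVlt; apply/orP; left; apply/eqP; field; rewrite expf_neq0.
Qed.

End Proof.
End Goursat.

(** * The maximum modulus principle on rectangles *)

Section MaxMod.
Variable R : realType.
Local Notation C := (Cx R).
Implicit Types (f g : C -> C).

Lemma expr_small (q e : R) : 0 <= q < 1 -> 0 < e -> exists N, q ^+ N < e.
Proof.
move=> /andP[q0 q1] e0.
have /cvgrPdist_lt/(_ e e0)[N _ hN] : (q ^+ n) @[n --> \oo] --> (0 : R).
  by apply: cvg_expr; rewrite ger0_norm.
exists N; have := hN N (leqnn N); rewrite sub0r normrN ger0_norm//.
exact: exprn_ge0.
Qed.

(** An estimate with a multiplicative constant, once it holds for all the powers, holds
    with the constant 1. *)
Lemma power_trick (c K A M : R) : 0 < c -> 0 <= M ->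
  (forall N, c * A ^+ N <= K * M ^+ N) -> A <= M.
Proof.
move=> c0 M0 h; rewrite leNgt; apply/negP => MA.
have A0 : 0 < A by exact: le_lt_trans MA.
have K0 : 0 < K.
  by have := h 0%N; rewrite !expr0 !mulr1; apply: lt_le_trans.
have [N hN] : exists N, (M / A) ^+ N < c / K.
  apply: expr_small; last by rewrite divr_gt0.
  by rewrite divr_ge0 ?(ltW A0)//= ltr_pdivrMr// mul1r.
have := h N; rewrite leNgt => /negP; apply.
by move: hN; rewrite exprMn exprVn ltr_pdivrMr ?exprn_gt0// mulrAC ltr_pdivlMr// mulrC.
Qed.

Section Rect.
Variables (x1 x2 y1 y2 a1 a2 : R).
Hypotheses (hx1 : x1 < a1) (hx2 : a1 < x2) (hy1 : y1 < a2) (hy2 : a2 < y2).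
Let a : C := pt a1 a2.
Let hx : x1 <= x2. Proof. exact/ltW/(lt_trans hx1). Qed.
Let hy : y1 <= y2. Proof. exact/ltW/(lt_trans hy1). Qed.

Lemma pt_eq (x y u v : R) : pt x y = pt u v <-> x = u /\ y = v.
Proof. by split => [[-> ->]//|[-> ->]]. Qed.

Lemma inv_pt (u v : R) : (pt u v)^-1 = pt (u / (u ^+ 2 + v ^+ 2)) (- v / (u ^+ 2 + v ^+ 2)).
Proof. by rewrite mulNr. Qed.

Lemma on_bd_far : exists2 r : R, 0 < r & forall x y, on_bd x1 x2 y1 y2 x y -> r <= nm (pt x y - a).
Proof.
pose r := Num.min (Num.min (a1 - x1) (x2 - a1)) (Num.min (a2 - y1) (y2 - a2)).
exists r; first by rewrite !lt_min !subr_gt0 hx1 hx2 hy1 hy2.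
have [[r1 r2] [r3 r4]] : (r <= a1 - x1 /\ r <= x2 - a1) /\ (r <= a2 - y1 /\ r <= y2 - a2).
  by rewrite /r !ge_min !lexx ?orbT.
move=> x y [[_ hh]|[_ hh]]; rewrite ptB.
  apply: le_trans (nm_Im _) => /=; case: hh => ->.
    by rewrite distrC (le_trans r3)// ler_norm.
  by rewrite (le_trans r4)// ler_norm.
apply: le_trans (nm_Re _) => /=; case: hh => ->.
  by rewrite distrC (le_trans r1)// ler_norm.
by rewrite (le_trans r2)// ler_norm.
Qed.

Lemma on_bd_neq x y : on_bd x1 x2 y1 y2 x y -> pt x y - a != 0.
Proof. by have [r r0 h] := on_bd_far => /h; rewrite -nm_gt0; exact: lt_le_trans. Qed.

Lemma cont_bd_kernel : cont_bd x1 x2 y1 y2 (fun z => (z - a)^-1).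
Proof. by move=> x y /on_bd_neq h; apply/hol_cont/holV => //; exact: hol_subc. Qed.

(** That the integral is not 0 is all that the maximum principle needs: its imaginary
    part is positive because no edge contributes a negative amount and the lower one a
    positive amount. *)
Lemma kernel_neq0 : rectI (fun z => (z - a)^-1) x1 x2 y1 y2 != 0.
Proof.
have [c1 c2 c3 c4] := cont_bd_edges cont_bd_kernel.
have den (u v : R) : u != 0 \/ v != 0 -> 0 < u ^+ 2 + v ^+ 2.
  by case=> n0; [apply: ltr_wpDr|apply: ltr_wpDl]; rewrite ?sqr_ge0// exprn_even_gt0.
set w := (x2 - x1) ^+ 2 + (a2 - y1) ^+ 2.
have w0 : 0 < w by apply: den; right; rewrite subr_eq0 gt_eqF.
have i1 : (a2 - y1) / w * (x2 - x1) <= complex.Im (cint (fun x => (pt x y1 - a)^-1) x1 x2).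
  apply: (rint_ge hx (ccont_itv_Im c1)) => x /andP[xa xb]; rewrite ptB inv_pt /= opprB; apply: ler_wpM2l.
    by rewrite subr_ge0 ltW.
  rewrite lef_pV2 ?posrE//; last by apply: den; right; rewrite subr_eq0 lt_eqF.
  have -> : (y1 - a2) ^+ 2 = (a2 - y1) ^+ 2 by rewrite -sqrrN opprB.
  have h1 : 0 <= (x2 - x1) - (x - a1) by move: hx1 hx2; lra.
  have h2 : 0 <= (x2 - x1) + (x - a1) by move: hx1 hx2; lra.
  by rewrite /w lerD2r -subr_ge0 subr_sqr mulr_ge0.
have i2 : complex.Im (cint (fun x => (pt x y2 - a)^-1) x1 x2) <= 0.
  rewrite -(mul0r (x2 - x1)) -rint_cst//; apply: rint_le => //; [exact: ccont_itv_Im|exact: cont_itv_cst|].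
  move=> x _; rewrite ptB inv_pt /= mulNr oppr_le0 divr_ge0//; first by rewrite subr_ge0 ltW.
  by rewrite addr_ge0 ?sqr_ge0.
have i3 : 0 <= complex.Re (cint (fun y => (pt x2 y - a)^-1) y1 y2).
  rewrite -(mul0r (y2 - y1)) -rint_cst//; apply: rint_le => //; [exact: cont_itv_cst|exact: ccont_itv_Re|].
  move=> x _; rewrite ptB inv_pt /= divr_ge0//; first by rewrite subr_ge0 ltW.
  by rewrite addr_ge0 ?sqr_ge0.
have i4 : complex.Re (cint (fun y => (pt x1 y - a)^-1) y1 y2) <= 0.
  rewrite -(mul0r (y2 - y1)) -rint_cst//; apply: rint_le => //; [exact: ccont_itv_Re|exact: cont_itv_cst|].
  move=> x _; rewrite ptB inv_pt /= -oppr_ge0 -mulNr opprB divr_ge0//.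
    by rewrite subr_ge0 ltW.
  by rewrite addr_ge0 ?sqr_ge0.
apply: contraTneq (_ : 0 < complex.Im (rectI (fun z => (z - a)^-1) x1 x2 y1 y2)) => [->|].
  by rewrite ltxx.
have ImE (u v s t : C) : complex.Im (u - v + ('i)%C * (s - t)) =
    complex.Im u - complex.Im v + (complex.Re s - complex.Re t).
  by case: u v s t => [? ?] [? ?] [? ?] [? ?] /=; ring.
rewrite /rectI ImE; apply: ltr_pwDl; last by rewrite subr_ge0 (le_trans i4).
rewrite subr_gt0 (le_lt_trans i2)// (lt_le_trans _ i1)// mulr_gt0//.
  by rewrite divr_gt0// subr_gt0.
by rewrite subr_gt0 (lt_trans hx1).
Qed.

(** A small square around a is cut out; the other pieces contribute 0, and the square
    contributes an amount proportional to its side, since g is bounded near a. *)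
Lemma goursat_exc g : cont_rect g x1 x2 y1 y2 ->
  (forall x y, x1 <= x <= x2 -> y1 <= y <= y2 -> pt x y != a -> hol g (pt x y)) ->
  rectI g x1 x2 y1 y2 = 0.
Proof.
move=> cg hg.
have [H1 H2 H3 H4] := And4 hx1 hx2 hy1 hy2.
have ca : {for a, continuous g} by apply: cg; rewrite !ltW.
have /contP/(_ 1 ltr01)[d0 d00 hd] := ca.
set K := nm (g a) + 1.
have K0 : 0 <= K by rewrite addr_ge0 ?nm_ge0.
pose r := Num.min (Num.min (a1 - x1) (x2 - a1)) (Num.min (a2 - y1) (y2 - a2)).
have r0 : 0 < r by rewrite !lt_min !subr_gt0 hx1 hx2 hy1 hy2.
have [[r1 r2] [r3 r4]] : (r <= a1 - x1 /\ r <= x2 - a1) /\ (r <= a2 - y1 /\ r <= y2 - a2).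
  by rewrite /r !ge_min !lexx ?orbT.
clearbody r.
suff key (s : R) : 0 < s -> s <= r -> 2 * s < d0 -> nm (rectI g x1 x2 y1 y2) <= 16 * K * s.
  apply: nm_eq0; apply/eqP; rewrite eq_le nm_ge0 andbT leNgt; apply/negP => I0.
  pose s := Num.min (Num.min r (d0 / 4)) (nm (rectI g x1 x2 y1 y2) / (16 * K + 1) / 2).
  have D0 : 0 < 16 * K + 1 by lra.
  have s0 : 0 < s by rewrite !lt_min r0 !divr_gt0.
  have [[s1 s2] s3] : (s <= r /\ s <= d0 / 4) /\ s <= nm (rectI g x1 x2 y1 y2) / (16 * K + 1) / 2.
    by rewrite /s !ge_min !lexx ?orbT.
  have := key s s0 s1; have -> : 2 * s < d0 by lra.
  move=> /(_ isT); rewrite leNgt => /negP; apply.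
  apply: (@le_lt_trans _ _ ((16 * K + 1) * s)); first by rewrite ler_pM2r//; lra.
  rewrite mulrC -ltr_pdivlMr//; apply: (le_lt_trans s3).
  have : 0 < nm (rectI g x1 x2 y1 y2) / (16 * K + 1) by rewrite divr_gt0.
  by set u := _ / _; lra.
move=> s0 sr sd.
have cS u1 u2 v1 v2 : x1 <= u1 -> u2 <= x2 -> y1 <= v1 -> v2 <= y2 -> cont_rect g u1 u2 v1 v2.
  move=> e1 e2 e3 e4 x y /andP[e5 e6] /andP[e7 e8]; apply: cg.
    by rewrite (le_trans e1 e5) (le_trans e6 e2).
  by rewrite (le_trans e3 e7) (le_trans e8 e4).
have z u1 u2 v1 v2 : x1 <= u1 -> u2 <= x2 -> y1 <= v1 -> v2 <= y2 -> u1 <= u2 -> v1 <= v2 ->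
   u2 < a1 \/ a1 < u1 \/ v2 < a2 \/ a2 < v1 -> rectI g u1 u2 v1 v2 = 0.
  move=> e1 e2 e3 e4 e5 e6 e; apply: goursat => // x y /andP[f1 f2] /andP[f3 f4].
  apply: hg.
  - by rewrite (le_trans e1 f1) (le_trans f2 e2).
  - by rewrite (le_trans e3 f3) (le_trans f4 e4).
  - apply/eqP => /pt_eq[xa ya]; subst x y; case: e => [h|[h|[h|h]]].
    + by move: (le_lt_trans f2 h); rewrite ltxx.
    + by move: (lt_le_trans h f1); rewrite ltxx.
    + by move: (le_lt_trans f4 h); rewrite ltxx.
    + by move: (lt_le_trans h f3); rewrite ltxx.
have l1 : x1 <= a1 - s by lra.
have l2 : a1 + s <= x2 by lra.
have l3 : y1 <= a2 - s by lra.
have l4 : a2 + s <= y2 by lra.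
have l5 : a1 - s <= a1 + s by lra.
have l6 : a2 - s <= a2 + s by lra.
have l7 : a1 - s < a1 by lra.
have l8 : a1 < a1 + s by lra.
have l9 : a2 - s < a2 by lra.
have l10 : a2 < a2 + s by lra.
have cA : cont_rect g (a1 - s) x2 y1 y2 := cS _ _ _ _ l1 (lexx _) (lexx _) (lexx _).
have cB : cont_rect g (a1 - s) (a1 + s) y1 y2 := cS _ _ _ _ l1 l2 (lexx _) (lexx _).
have cD : cont_rect g (a1 - s) (a1 + s) (a2 - s) y2 := cS _ _ _ _ l1 l2 l3 (lexx _).
have cE : cont_rect g (a1 - s) (a1 + s) (a2 - s) (a2 + s) := cS _ _ _ _ l1 l2 l3 l4.
have b1 : x1 <= a1 - s <= x2 by rewrite l1 (le_trans l5 l2).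
have b2 : a1 - s <= a1 + s <= x2 by rewrite l5 l2.
have b3 : y1 <= a2 - s <= y2 by rewrite l3 (le_trans l6 l4).
have b4 : a2 - s <= a2 + s <= y2 by rewrite l6 l4.
rewrite (rectI_splitx hy b1 cg) (rectI_splitx hy b2 cA).
rewrite (rectI_splity l5 b3 cB) (rectI_splity l5 b4 cD).
have z1 : rectI g x1 (a1 - s) y1 y2 = 0.
  by apply: z => //; [exact: le_trans l5 l2|left].
have z2 : rectI g (a1 + s) x2 y1 y2 = 0.
  by apply: z => //; [exact: le_trans l1 l5|right; left].
have z3 : rectI g (a1 - s) (a1 + s) y1 (a2 - s) = 0.
  by apply: z => //; [exact: le_trans l6 l4|right; right; left].
have z4 : rectI g (a1 - s) (a1 + s) (a2 + s) y2 = 0.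
  by apply: z => //; [exact: le_trans l3 l6|right; right; right].
rewrite z1 z2 z3 z4 !add0r !addr0.
have := @rectI_bound _ _ _ _ _ l5 l6 K g.
have -> : 4 * K * (a1 + s - (a1 - s) + (a2 + s - (a2 - s))) = 16 * K * s by ring.
apply; first exact: (cont_rect_bd l5 l6 cE).
move=> x y /(on_bd_in l5 l6)[/andP[p1 p2] /andP[p3 p4]].
have := nmBge (g (pt x y)) (g a); rewrite lerBlDr => /le_trans; apply.
rewrite addrC lerD2l ltW//; apply: hd; apply: le_lt_trans sd; rewrite ptB.
rewrite (le_trans (nm_pt _ _))// mulr2n mulrDl mul1r.
by apply: lerD; rewrite ler_norml; apply/andP; split; lra.
Qed.

(** By Goursat's theorem for the difference quotient of F at a, the integral of F / (z -
    a) is F a times that of 1 / (z - a). For F = (f / f a) ^ N this bounds a constant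
    times |f a| ^ N by another constant times M ^ N. *)
Lemma maxmod_rect f (M : R) :
  (forall x y, x1 <= x <= x2 -> y1 <= y <= y2 -> hol f (pt x y)) ->
  (forall x y, on_bd x1 x2 y1 y2 x y -> nm (f (pt x y)) <= M) -> nm (f a) <= M.
Proof.
move=> hf hM.
have onb1 : on_bd x1 x2 y1 y2 x1 y1 by left; split; [rewrite lexx|left].
have M0 : 0 <= M by apply: le_trans (hM _ _ onb1); exact: nm_ge0.
have [r r0 hr] := on_bd_far.
set c := nm (rectI (fun z => (z - a)^-1) x1 x2 y1 y2).
have c0 : 0 < c by rewrite nm_gt0 kernel_neq0.
pose K := 4 / r * ((x2 - x1) + (y2 - y1)).
have [->|fa0] := eqVneq (f a) 0; first by rewrite nm0.
have nfa0 : 0 < nm (f a) by rewrite nm_gt0.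
rewrite -[nm (f a)]mul1r -ler_pdivlMr//.
apply: (@power_trick c K) => // [|N]; first by rewrite divr_ge0 ?nm_ge0.
pose F z := (f z / f a) ^+ N.
have hF x y : x1 <= x <= x2 -> y1 <= y <= y2 -> hol F (pt x y).
  move=> e1 e2; apply: (@holX _ (fun z => f z / f a)).
  by apply: (@holM _ f (fun=> (f a)^-1)); [exact: hf|exact: hol_cst].
have Fa : F a = 1 by rewrite /F divff// expr1n.
have aF : hol F a by apply: hF; rewrite !ltW.
have I0 : rectI (dq F a) x1 x2 y1 y2 = 0.
  apply: goursat_exc => x y e1 e2; first by apply: hol_dq_contw => //; exact: hF.
  by move=> ne; apply: hol_dq_off => //; exact: hF.
have cK := cont_bd_kernel.
have cdq : cont_bd x1 x2 y1 y2 (dq F a).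
  by move=> x y /(on_bd_in hx hy)[? ?]; apply: hol_dq_contw => //; exact: hF.
have E : rectI (fun z => (z - a)^-1 + dq F a z) x1 x2 y1 y2 =
         rectI (fun z => F z / (z - a)) x1 x2 y1 y2.
  apply: rectI_ext => // x y h; have n0 := on_bd_neq h.
  have ne : pt x y != a by rewrite -subr_eq0.
  by rewrite (dq_neq _ ne) Fa -[X in X + _]mul1r -mulrDl addrC subrK.
rewrite (rectI_D cK cdq) I0 addr0 in E.
rewrite expr1n mulr1 /c E.
have -> : K * (M / nm (f a)) ^+ N = 4 * ((M / nm (f a)) ^+ N / r) * ((x2 - x1) + (y2 - y1)).
  by rewrite /K; ring.
apply: (rectI_bound hx hy).
  move=> x y h; apply: (@contM _ _ F (fun z => (z - a)^-1)); last exact: cK.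
  by have [? ?] := on_bd_in hx hy h; apply: hol_cont; exact: hF.
move=> x y h; rewrite nmM nmV nmX nmM nmV; apply: ler_pM.
- by rewrite exprn_ge0// divr_ge0 ?nm_ge0.
- by rewrite invr_ge0 nm_ge0.
- apply: lerXn2r; rewrite ?nnegrE ?divr_ge0 ?nm_ge0//.
  by rewrite ler_pM2r ?invr_gt0//; exact: hM.
- by rewrite lef_pV2 ?posrE ?hr// (lt_le_trans r0) ?hr.
Qed.

End Rect.
End MaxMod.

(** * The maximum modulus principle with exceptional points *)

Section Squares.
Variable R : realType.
Local Notation C := (Cx R).
Implicit Types (f g : C -> C) (a b c z : C) (r M : R).

(** The norm whose balls are the squares with sides parallel to the axes, to which the
    results for rectangles apply. *)
Definition mx z : R := Num.max `|complex.Re z| `|complex.Im z|.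

Lemma mx_le z r : (mx z <= r) = (`|complex.Re z| <= r) && (`|complex.Im z| <= r).
Proof. by rewrite ge_max. Qed.
Lemma mx_lt z r : (mx z < r) = (`|complex.Re z| < r) && (`|complex.Im z| < r).
Proof. by rewrite gt_max. Qed.
Lemma mx_nm z : mx z <= nm z.
Proof. by rewrite mx_le nm_Re nm_Im. Qed.
Lemma nm_mx z : nm z <= 2 * mx z.
Proof.
rewrite (le_trans (nm_ReIm z))// mulr2n mulrDl mul1r; apply: lerD.
  by rewrite le_max lexx.
by rewrite le_max lexx orbT.
Qed.
Lemma mx_ge0 z : 0 <= mx z. Proof. by rewrite le_max normr_ge0. Qed.
Lemma mx0 : mx 0 = 0. Proof. by rewrite /mx /= normr0 maxxx. Qed.

Lemma ReD (w z : C) : complex.Re (w + z) = complex.Re w + complex.Re z.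
Proof. by case: w; case: z. Qed.
Lemma ImD (w z : C) : complex.Im (w + z) = complex.Im w + complex.Im z.
Proof. by case: w; case: z. Qed.

Lemma mxD w z : mx (w + z) <= mx w + mx z.
Proof.
rewrite mx_le ReD ImD; apply/andP; split.
  by apply: (le_trans (ler_normD _ _)); rewrite lerD// le_max lexx.
by apply: (le_trans (ler_normD _ _)); rewrite lerD// le_max lexx orbT.
Qed.

Lemma maxmod_sq f c r M a : (forall z, mx (z - c) <= r -> hol f z) ->
  (forall z, mx (z - c) = r -> nm (f z) <= M) -> mx (a - c) < r -> nm (f a) <= M.
Proof.
move=> hf hM; rewrite mx_lt !(ReB, ImB) !ltr_norml => /andP[/andP[A1 A2] /andP[A3 A4]].
rewrite -(pt_ReIm a).
have inq x y : complex.Re c - r <= x <= complex.Re c + r -> complex.Im c - r <= y <= complex.Im c + r ->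
    mx (pt x y - c) <= r.
  move=> /andP[? ?] /andP[? ?]; rewrite mx_le !(ReB, ImB) /= !ler_norml.
  by apply/andP; split; apply/andP; split; lra.
have e1 : complex.Re c - r < complex.Re a by lra.
have e2 : complex.Re a < complex.Re c + r by lra.
have e3 : complex.Im c - r < complex.Im a by lra.
have e4 : complex.Im a < complex.Im c + r by lra.
apply: (maxmod_rect e1 e2 e3 e4) => [x y hx hy|x y h]; first exact/hf/inq.
have r0 : 0 <= r by clear - e1 e2; lra.
have hxy := on_bd_in (ltW (lt_trans e1 e2)) (ltW (lt_trans e3 e4)) h.
apply: hM; apply/eqP; rewrite eq_le; apply/andP; split; first by apply: inq; case: hxy.
rewrite le_max !(ReB, ImB) /=; apply/orP; case: h => [[_ [|] ->]|[_ [|] ->]].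
- by right; rewrite addrAC subrr add0r normrN ler_norm.
- by right; rewrite addrAC subrr add0r ler_norm.
- by left; rewrite addrAC subrr add0r normrN ler_norm.
- by left; rewrite addrAC subrr add0r ler_norm.
Qed.

Lemma hol_excmul f e : {for e, continuous f} -> hol (fun z => (z - e) * f z) e.
Proof. by move=> h; exists f => // z; rewrite subrr mul0r add0r. Qed.

(** Multiplication by z - e makes a continuous function differentiable at the
    exceptional point e; applied to the powers of f, this costs only a constant factor,
    which the powers absorb. *)
Lemma maxmod_exc (E : seq C) f c r M a :
  (forall z, mx (z - c) <= r -> {for z, continuous f}) ->
  (forall z, mx (z - c) <= r -> z \notin E -> hol f z) ->
  (forall z, mx (z - c) = r -> nm (f z) <= M) -> mx (a - c) < r -> nm (f a) <= M.
Proof.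
elim: E f M a => [|e E IH] f M a cf hf hM ha.
  by apply: maxmod_sq ha => // z hz; apply: hf.
have r0 : 0 <= r by apply: le_trans (ltW ha); exact: mx_ge0.
have M0 : 0 <= M.
  apply: le_trans (hM (c + ofR r) _); first exact: nm_ge0.
  by rewrite addrAC subrr add0r /mx/= normr0 ger0_norm// max_l.
have key b : mx (b - c) < r -> b != e -> nm (f b) <= M.
  move=> hb be; pose K := 2 * r + nm (c - e).
  have be0 : 0 < nm (b - e) by rewrite nm_gt0 subr_eq0.
  apply: (@power_trick _ _ K _ _ be0 M0) => N.
  rewrite -(nmX (f b) N) -(nmM (b - e)).
  apply: (IH (fun z => (z - e) * f z ^+ N) (K * M ^+ N) b _ _ _ hb) => z hz.
  - exact: (contM (hol_cont (hol_subc e z)) (contX N (cf z hz))).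
  - move=> zE; have [ze|ze] := eqVneq z e.
      by rewrite ze in hz *; apply: hol_excmul; exact: (contX N (cf e hz)).
    apply: (holM (hol_subc e z)); apply: holX; apply: hf => //.
    by rewrite inE negb_or ze zE.
  - rewrite nmM nmX; apply: ler_pM; rewrite ?exprn_ge0 ?nm_ge0//.
      apply: (le_trans (nm_tri z c e)); rewrite lerD2r.
      by apply: (le_trans (nm_mx _)); rewrite hz.
    by apply: lerXn2r; rewrite ?nnegrE ?nm_ge0 ?hM.
have [ae|ae] := eqVneq a e; last exact: key.
have /contP cfa := cf a (ltW ha).
rewrite leNgt; apply/negP => lt.
have d0 : 0 < nm (f a) - M by rewrite subr_gt0.
have [d dd hd] := cfa _ d0.
pose s := Num.min (d / 2) ((r - mx (a - c)) / 2).
have s0 : 0 < s by rewrite lt_min !divr_gt0// subr_gt0.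
have s1 : s < d by rewrite gt_min ltr_pdivrMr// mulr_natr mulr2n ltrDl dd.
have s2 : s < r - mx (a - c).
  by rewrite gt_min [X in _ || X]ltr_pdivrMr// mulr_natr mulr2n ltrDl subr_gt0 ha orbT.
pose b := a + ofR s.
have ba : b - a = ofR s by rewrite /b addrAC subrr add0r.
have hb : mx (b - c) < r.
  rewrite /b addrAC (le_lt_trans (mxD _ _))// -ltrBrDl (le_lt_trans (mx_nm _))//.
  by rewrite nm_ofR ger0_norm ?ltW.
have be : b != e.
  by rewrite -subr_eq0 -ae ba -nm_gt0 nm_ofR normr_gt0 gt_eqF.
have := hd b; rewrite ba nm_ofR ger0_norm ?ltW// => /(_ s1).
rewrite nmC => /(le_lt_trans (nmBge _ _)); rewrite ltrD2l ltrN2.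
by rewrite ltNge key.
Qed.

End Squares.

(** * Compactness, completeness and removable singularities *)

Section Removable.
Variable R : realType.
Local Notation C := (Cx R).
Implicit Types (f g : C -> C) (a b c z : C) (r M : R).

Lemma nm_cont (V : normedModType C) (x : V) : {for x, continuous (@nm R V)}.
Proof.
move=> P /= /nbhs_normP[e /= e0 he]; apply/nbhs_nm; exists e => // y hy.
apply: he => /=; apply: le_lt_trans hy; rewrite ler_norml.
by rewrite lerNl opprB nmBge nmC nmBge.
Qed.

Lemma compact_sq c r : compact [set z : C | mx (z - c) <= r].
Proof.
pose A := [set` `[complex.Re c - r, complex.Re c + r]] : set R.
pose B := [set` `[complex.Im c - r, complex.Im c + r]] : set R.
have -> : [set z : C | mx (z - c) <= r] = (fun p : R * R => pt p.1 p.2) @` (A `*` B).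
  apply/seteqP; split => [z /=|_ /= [[x y] [/= hx hy] <-]].
    rewrite mx_le ReB ImB !ler_norml => /andP[h1 h2].
    exists (complex.Re z, complex.Im z); last by rewrite /= pt_ReIm.
    by split; rewrite /A/B/= in_itv/=; lra.
  move: hx hy; rewrite /A/B/= !in_itv/= => hx hy.
  by rewrite mx_le ReB ImB /= !ler_norml; lra.
apply: continuous_compact; last by apply: compact_setX; exact: segment_compact.
apply: continuous_subspaceT => -[x y] P /nbhs_nm[e e0 he].
have e2 : 0 < e / 2 by rewrite divr_gt0.
exists (ball x (e / 2), ball y (e / 2)); first by split; exact: nbhsx_ballx.
move=> [u v] /= [hu hv]; apply: he => /=; rewrite ptB (le_lt_trans (nm_pt _ _))//.
by rewrite (splitr e) distrC [X in _ + X]distrC ltrD.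
Qed.

Lemma compact_disc c r : compact [set z : C | nm (z - c) <= r].
Proof.
apply: (subclosed_compact _ (@compact_sq c r)); last first.
  by move=> z /=; apply: le_trans; exact: mx_nm.
have -> : [set z : C | nm (z - c) <= r] = (fun z => nm (z - c)) @^-1` [set x | x <= r] by [].
apply: closed_comp; last exact: closed_le.
move=> z _; apply: (continuous_comp (hol_cont (hol_subc c z))); exact: nm_cont.
Qed.

Lemma compact_bd (A : set C) f : compact A -> (forall z, A z -> {for z, continuous f}) ->
  exists2 M : R, 0 < M & forall z, A z -> nm (f z) <= M.
Proof.
move=> cA cf; have [[z0 Az0]|A0] := pselect (A !=set0); last first.
  by exists 1 => // z Az; case: A0; exists z.
have [||m Am hm] := @compact_EVT_max _ R (fun z => nm (f z)) A _ cA.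
- by exists z0.
- apply: continuous_in_subspaceT => z /set_mem /cf h.
  exact: (continuous_comp h (@nm_cont _ _)).
exists (nm (f m) + 1); first by rewrite ltr_wpDl ?nm_ge0.
by move=> z Az; rewrite (le_trans (hm z _)) ?lerDl//; exact: mem_set.
Qed.

(** Completeness of the complex plane, as a Cauchy criterion for the limit of u at a. *)
Lemma cauchy_limit (u : C -> C) a :
  (forall e : R, 0 < e -> exists2 d : R, 0 < d & forall b b', b != a -> b' != a ->
     nm (b - a) < d -> nm (b' - a) < d -> nm (u b - u b') <= e) ->
  exists l, forall e : R, 0 < e -> exists2 d : R, 0 < d & forall b, b != a ->
     nm (b - a) < d -> nm (u b - l) <= e.
Proof.
move=> hc; pose b n : C := a + ofR (n.+1%:R^-1).
have bE n : b n - a = ofR (n.+1%:R^-1) by rewrite /b addrAC subrr add0r.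
have ba n : b n != a by rewrite -subr_eq0 bE -nm_gt0 nm_ofR normr_gt0 invr_eq0 pnatr_eq0.
have bd (d : R) : 0 < d -> \forall n \near \oo, nm (b n - a) < d.
  move=> d0; near=> n; rewrite bE nm_ofR ger0_norm//.
  by near: n; exact: near_infty_natSinv_lt (PosNum d0).
have lim (p : C -> R) : (forall w z, `|p w - p z| <= nm (w - z)) ->
    exists l : R, p (u (b n)) @[n --> \oo] --> l.
  move=> hp; apply/cvg_ex; apply/cauchy_cvgP/cauchy_ballP => e e0.
  have e2 : 0 < e / 2 by rewrite divr_gt0.
  have [d d0 hd] := hc _ e2.
  have [N _ hN] := bd d d0.
  exists ([set x | exists2 n, (N <= n)%N & p (u (b n)) = x],
          [set x | exists2 n, (N <= n)%N & p (u (b n)) = x]).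
    by split => /=; exists N => // n /= Nn; exists n.
  move=> [_ _] /= [[n Nn <-] [m Nm <-]].
  rewrite /ball/=; apply: le_lt_trans (hp _ _) _.
  apply: (@le_lt_trans _ _ (e / 2)); last by rewrite ltr_pdivrMr// mulr_natr mulr2n ltrDl.
  by apply: hd; [exact: ba|exact: ba|exact: hN|exact: hN].
have hRe (w z : C) : `|complex.Re w - complex.Re z| <= nm (w - z) by rewrite -ReB nm_Re.
have hIm (w z : C) : `|complex.Im w - complex.Im z| <= nm (w - z) by rewrite -ImB nm_Im.
have [l1 h1] := lim _ hRe.
have [l2 h2] := lim _ hIm.
exists (pt l1 l2) => e e0.
have e3 : 0 < e / 3 by rewrite divr_gt0.
have [d d0 hd] := hc _ e3; exists d => // w wa hw.
have /cvgrPdist_lt/(_ _ e3) n1 := h1.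
have /cvgrPdist_lt/(_ _ e3) n2 := h2.
have [N [a1 a2 a3]] : exists N, [/\ `|l1 - complex.Re (u (b N))| < e / 3,
    `|l2 - complex.Im (u (b N))| < e / 3 & nm (b N - a) < d].
  have [N1 _ H1] := n1; have [N2 _ H2] := n2; have [N3 _ H3] := bd d d0.
  exists (maxn N1 (maxn N2 N3)); split.
  - by apply: H1 => /=; rewrite leq_maxl.
  - by apply: H2 => /=; rewrite !leq_max leqnn !orbT.
  - by apply: H3 => /=; rewrite !leq_max leqnn !orbT.
apply: (le_trans (nm_tri _ (u (b N)) _)).
have := hd w (b N) wa (ba N) hw a3.
have : nm (u (b N) - pt l1 l2) <= e / 3 + e / 3.
  apply: (le_trans (nm_ReIm _)); rewrite ReB ImB /=.
  by rewrite distrC [X in _ + X]distrC; apply: lerD; exact: ltW.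
lra.
Unshelve. all: end_near. Qed.

(** Cauchy's criterion holds for the difference quotients of g at a: their difference at
    b and b' is the value at a of a function that is continuous on the square,
    holomorphic off three points, and small on the boundary of the square when b and b'
    are close to a. *)
Lemma removable g a r : 0 < r -> (forall z, mx (z - a) <= r -> {for z, continuous g}) ->
  (forall z, mx (z - a) <= r -> z != a -> hol g z) -> hol g a.
Proof.
move=> r0 cg hg.
have r2 : 0 < r / 2 by rewrite divr_gt0.
have rr : r / 2 <= r by lra.
have [G G0 hG] := compact_bd (@compact_sq a r) cg.
have ia : mx (a - a) <= r by rewrite subrr mx0 ltW.
have ca := cg a ia.
have [l hl] : exists l, forall e : R, 0 < e -> exists2 d : R, 0 < d & forall b, b != a ->
     nm (b - a) < d -> nm (dq g a b - l) <= e.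
  apply: cauchy_limit => e e0.
  have [d d0 hd] := (contP g a).1 ca (e * r / 8) (divr_gt0 (mulr_gt0 e0 r0) (ltr0n _ 8)).
  pose s := Num.min (Num.min d (r / 2)) (e * (r * r) / (32 * G)).
  have s0 : 0 < s by rewrite !lt_min d0 r2 divr_gt0 ?mulr_gt0.
  have [[s1 s2] s3] : (s <= d /\ s <= r / 2) /\ s <= e * (r * r) / (32 * G).
    by rewrite /s !ge_min !lexx ?orbT.
  clearbody s; exists s => // b b' ba ba' hb hb'.
  have ib : mx (b - a) <= r / 2 by apply: le_trans (mx_nm _) _; rewrite (le_trans (ltW hb)).
  have ib' : mx (b' - a) <= r / 2 by apply: le_trans (mx_nm _) _; rewrite (le_trans (ltW hb')).
  have jb : mx (b - a) <= r by rewrite (le_trans ib).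
  have jb' : mx (b' - a) <= r by rewrite (le_trans ib').
  rewrite dqC// (dqC _ ba').
  apply: (@maxmod_exc R [:: a; b; b'] (fun z => dq g b z - dq g b' z) a r e a); last first.
  - by rewrite subrr mx0.
  - move=> z hz.
    have zb : r / 2 <= nm (z - b).
      apply: le_trans (mx_nm _); have := mxD (z - b) (b - a).
      rewrite addrA subrK hz; lra.
    have zb' : r / 2 <= nm (z - b').
      apply: le_trans (mx_nm _); have := mxD (z - b') (b' - a).
      rewrite addrA subrK hz; lra.
    have z0 : z - b != 0 by rewrite -nm_gt0 (lt_le_trans r2).
    have z0' : z - b' != 0 by rewrite -nm_gt0 (lt_le_trans r2).
    have zb1 : z != b by rewrite -subr_eq0.
    have zb2 : z != b' by rewrite -subr_eq0.
    rewrite (dq_neq _ zb1) (dq_neq _ zb2).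
    have -> : (g z - g b) / (z - b) - (g z - g b') / (z - b') =
      (g z - g b) * (b - b') / ((z - b) * (z - b')) + (g b' - g b) / (z - b').
      by field; rewrite z0 z0'.
    have gb : nm (g b - g a) <= e * r / 8 by apply/ltW/hd/(lt_le_trans hb).
    have gb' : nm (g b' - g a) <= e * r / 8 by apply/ltW/hd/(lt_le_trans hb').
    have n1 : nm (g z - g b) <= 2 * G.
      apply: (le_trans (nmB _ _)); rewrite mulr2n mulrDl mul1r.
      by apply: lerD; apply: hG => //=; rewrite hz.
    have n2 : nm (b - b') <= 2 * s.
      apply: (le_trans (nm_tri _ a _)); rewrite [X in _ + X]nmC mulr2n mulrDl mul1r.
      by apply: lerD; exact: ltW.
    have n3 : nm (g b' - g b) <= e * r / 4.
      apply: (le_trans (nm_tri _ (g a) _)); rewrite [X in _ + X]nmC.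
      have -> : e * r / 4 = e * r / 8 + e * r / 8 by field.
      exact: lerD.
    have i1 : (nm (z - b))^-1 <= 2 / r.
      by rewrite -[2 / r]invf_div lef_pV2 ?posrE// (lt_le_trans r2).
    have i2 : (nm (z - b'))^-1 <= 2 / r.
      by rewrite -[2 / r]invf_div lef_pV2 ?posrE// (lt_le_trans r2).
    have p1 : 0 <= (nm (z - b))^-1 by rewrite invr_ge0 nm_ge0.
    have p2 : 0 <= (nm (z - b'))^-1 by rewrite invr_ge0 nm_ge0.
    have -> : e = 2 * G * (2 * (e * (r * r) / (32 * G))) * (2 / r * (2 / r)) * 1 + e * r / 4 * (2 / r).
      by field; rewrite !gt_eqF.
    apply: (le_trans (nmD _ _)); apply: lerD.
      rewrite mulr1 !nmM nmV nmM invfM; apply: ler_pM => //; rewrite ?mulr_ge0 ?nm_ge0//.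
      - apply: ler_pM => //; rewrite ?nm_ge0//.
        by apply: (le_trans n2); rewrite ler_pM2l.
      - exact: ler_pM.
    by rewrite nmM nmV; apply: ler_pM; rewrite ?nm_ge0.
  - move=> z hz; rewrite !inE !negb_or => /and3P[za zb zb'].
    have hz' := hg z hz za.
    exact: (holB (hol_dq_off hz' zb) (hol_dq_off hz' zb')).
  - move=> z hz; apply: contB.
      have [->|zb] := eqVneq z b; first exact/hol_dq_cont/hg.
      have zb0 : z - b != 0 by rewrite subr_eq0.
      apply: (cont_near _ (contM (contB (cg z hz) (cont_cst (g b) z)) (contV (hol_cont (hol_subc b z)) zb0))).
      by apply: filterS (neq_near zb) => w wb; rewrite dq_neq.
    have [->|zb] := eqVneq z b'; first exact/hol_dq_cont/hg.
    have zb0 : z - b' != 0 by rewrite subr_eq0.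
    apply: (cont_near _ (contM (contB (cg z hz) (cont_cst (g b') z)) (contV (hol_cont (hol_subc b' z)) zb0))).
    by apply: filterS (neq_near zb) => w wb; rewrite dq_neq.
apply: (@hol_near_ex _ _ _ (fun w => if w == a then l else dq g a w)).
  apply/contP => e e0; have e2 : 0 < e / 2 by rewrite divr_gt0.
  have [d d0 hd] := hl _ e2; exists d => // w hw; rewrite eqxx.
  case: eqVneq => [_|wa]; first by rewrite subrr nm0.
  by apply: le_lt_trans (hd w wa hw) _; rewrite ltr_pdivrMr// mulr_natr mulr2n ltrDl.
by apply: filterE => w; case: eqVneq => [->|_]; [rewrite subrr mul0r addr0|exact: dqE].
Qed.

End Removable.

(** * Orders of zeros, and maximum principles of Rado type *)

Section Holomorphic.
Variable R : realType.
Local Notation C := (Cx R).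
Implicit Types (f g G : C -> C) (a b c z w : C) (r M : R).

(** The difference quotient is continuous, and holomorphic off a, so a is a removable
    singularity. *)
Lemma hol_dq f a : (\forall z \near a, hol f z) -> hol (dq f a) a.
Proof.
move=> /nbhs_nm[e e0 he]; have r0 : 0 < e / 4 by rewrite divr_gt0.
have h z : mx (z - a) <= e / 4 -> hol f z.
  by move=> hz; apply: he; apply: le_lt_trans (nm_mx _) _; lra.
have ha : hol f a by apply: h; rewrite subrr mx0 ltW.
apply: (removable r0) => z hz.
  by apply: hol_dq_contw => //; exact: h.
by move=> za; apply: hol_dq_off => //; exact: h.
Qed.

Definition holb f c r := forall z, nm (z - c) < r -> hol f z.

Lemma holb_dq f c r a : holb f c r -> nm (a - c) < r -> holb (dq f a) c r.
Proof.
move=> h ha z hz; have [->|za] := eqVneq z a; last by apply: hol_dq_off => //; exact: h.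
by apply: hol_dq; apply: filterS (ball_near ha) => w; exact: h.
Qed.

(** The maximum principle for the difference quotient at a bounds the derivative;
    applied to the difference quotient of the difference quotient, it bounds the rate of
    convergence to the derivative. *)
Lemma cauchy_der f a r M : 0 < r -> (forall z, mx (z - a) <= r -> hol f z) ->
  (forall z, mx (z - a) <= r -> nm (f z) <= M) ->
  nm (der f a) <= 2 * M / r /\
  forall w, mx (w - a) < r -> nm (dq f a w - der f a) <= 4 * M / (r * r) * nm (w - a).
Proof.
move=> r0 hf hM.
have ia : mx (a - a) < r by rewrite subrr mx0.
have rn z : mx (z - a) = r -> r <= nm (z - a) by move=> <-; exact: mx_nm.
have rne z : mx (z - a) = r -> z != a.
  by move=> /rn h; rewrite -subr_eq0 -nm_gt0 (lt_le_trans r0).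
have ha := hf a (ltW ia).
have hn : \forall z \near a, hol f z.
  by apply/nbhs_nm; exists r => // z hz; apply: hf; rewrite (le_trans (mx_nm _)) ?ltW.
have M0 : 0 <= M by apply: le_trans (hM a (ltW ia)); exact: nm_ge0.
have derE : dq f a a = der f a by rewrite /dq eqxx.
have hu z : mx (z - a) <= r -> hol (dq f a) z.
  move=> hz; have [->|za] := eqVneq z a; first exact: hol_dq.
  by apply: hol_dq_off => //; exact: hf.
have ub z : mx (z - a) = r -> nm (dq f a z) <= 2 * M / r.
  move=> hz; rewrite (dq_neq _ (rne z hz)) nmM nmV.
  apply: ler_pM; rewrite ?nm_ge0 ?invr_ge0 ?nm_ge0//.
    apply: (le_trans (nmB _ _)); rewrite mulr2n mulrDl mul1r.
    by apply: lerD; apply: hM; rewrite ?hz// ltW.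
  by rewrite lef_pV2 ?posrE ?rn// (lt_le_trans r0)// rn.
have b1 : nm (der f a) <= 2 * M / r by rewrite -derE; apply: (maxmod_sq hu ub ia).
split => // w hw.
have hnu : \forall z \near a, hol (dq f a) z.
  by apply/nbhs_nm; exists r => // z hz; apply: hu; rewrite (le_trans (mx_nm _)) ?ltW.
have hu2 z : mx (z - a) <= r -> hol (dq (dq f a) a) z.
  move=> hz; have [->|za] := eqVneq z a; first exact: hol_dq.
  by apply: hol_dq_off => //; exact: hu.
have ub2 z : mx (z - a) = r -> nm (dq (dq f a) a z) <= 4 * M / (r * r).
  move=> hz; rewrite (dq_neq _ (rne z hz)) derE nmM nmV.
  have -> : 4 * M / (r * r) = (2 * M / r + 2 * M / r) / r by field; rewrite gt_eqF.
  apply: ler_pM; rewrite ?nm_ge0 ?invr_ge0 ?nm_ge0//.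
    by apply: (le_trans (nmB _ _)); apply: lerD => //; exact: ub.
  by rewrite lef_pV2 ?posrE ?rn// (lt_le_trans r0)// rn.
have := maxmod_sq hu2 ub2 hw.
move=> h; have -> : dq f a w - der f a = (w - a) * dq (dq f a) a w.
  by rewrite {1}(dqE (dq f a) a w) derE addrAC subrr add0r.
by rewrite nmM mulrC ler_wpM2r ?nm_ge0.
Qed.

(** If f is divisible by all the powers of z - a, the maximum principle bounds the
    quotients by M / s ^ k, and |f z| by M (|z - a| / s) ^ k for all k. *)
Lemma finite_order f a r : 0 < r -> holb f a r ->
  (forall z, nm (z - a) < r / 2 -> f z = 0) \/
  exists m g, [/\ holb g a r, g a != 0 & forall z, f z = (z - a) ^+ m * g z].
Proof.
move=> r0 hf; have [|nex] := pselect (exists m g, [/\ holb g a r, g a != 0 &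
  forall z, f z = (z - a) ^+ m * g z]); first by right.
have aa : nm (a - a) < r by rewrite subrr nm0.
have ex k : exists2 g, holb g a r & forall z, f z = (z - a) ^+ k * g z.
  elim: k => [|k [g hg fE]]; first by exists f => // z; rewrite expr0 mul1r.
  have [ga|ga] := eqVneq (g a) 0; last by case: nex; exists k, g.
  exists (dq g a); first exact: holb_dq.
  by move=> z; rewrite fE exprSr -mulrA {1}(dqE g a z) ga add0r.
left=> z hz.
pose s := (nm (z - a) + r / 2) / 2.
have n0 := nm_ge0 (z - a).
have s1 : nm (z - a) < s by rewrite /s; lra.
have s2 : s < r / 2 by rewrite /s; lra.
have s0 : 0 < s by lra.
clearbody s.
(* the square of radius s is inside the disc of radius r, as nm is at most twice mx *)
have sq w : mx (w - a) <= s -> nm (w - a) < r.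
  by move=> hw; apply: le_lt_trans (nm_mx _) _; lra.
have [M M0 hM] : exists2 M : R, 0 < M & forall w, mx (w - a) <= s -> nm (f w) <= M.
  by apply: (compact_bd (@compact_sq _ a s)) => w /sq /hf /hol_cont.
apply: nm_eq0; apply/eqP; rewrite eq_le nm_ge0 andbT.
suff h k : nm (f z) <= M * (nm (z - a) / s) ^+ k.
  rewrite leNgt; apply/negP => fz0.
  have [k hk] : exists k, (nm (z - a) / s) ^+ k < nm (f z) / M.
    apply: expr_small; last by rewrite divr_gt0.
    by rewrite divr_ge0 ?(ltW s0)//= ltr_pdivrMr// mul1r.
  by have := h k; rewrite leNgt mulrC -ltr_pdivlMr// hk.
have [g hg fE] := ex k.
have hgM : nm (g z) <= M / s ^+ k.
  apply: (@maxmod_sq _ g a s) => [w /sq/hg//|w hw|]; last exact: le_lt_trans (mx_nm _) _.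
  have ws : s <= nm (w - a) by rewrite -hw mx_nm.
  have w0 : 0 < nm (w - a) by apply: lt_le_trans ws.
  have := hM w; rewrite hw lexx fE nmM nmX => /(_ isT) h.
  rewrite ler_pdivlMr ?exprn_gt0//; apply: le_trans h; rewrite mulrC.
  apply: ler_wpM2r; first exact: nm_ge0.
  by apply: lerXn2r ws; rewrite nnegrE ltW.
rewrite fE nmM nmX expr_div_n mulrCA; apply: ler_wpM2l => //.
by rewrite exprn_ge0.
Qed.

(** Otherwise f z = f a + (z - a) ^ m * g z with m > 0 and g a != 0, and |f| increases
    when z moves from a in the direction of an m-th root of f a / g a. *)
Lemma maxmod_local f a : (\forall z \near a, hol f z) ->
  (\forall z \near a, nm (f z) <= nm (f a)) -> \forall z \near a, f z = f a.
Proof.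
move=> /nbhs_nm[r r0 hf] hmax.
have hfa : holb (fun z => f z - f a) a r.
  by move=> z hz; apply: (holB (hf z hz)); exact: hol_cst.
have [h|[m [g [hg ga fE]]]] := finite_order r0 hfa.
  apply/nbhs_nm; exists (r / 2); first by rewrite divr_gt0.
  by move=> z /h /eqP; rewrite subr_eq0 => /eqP.
have [fa0|fa0] := eqVneq (f a) 0.
  apply: filterS hmax => z; rewrite fa0 nm0 => h.
  by apply: nm_eq0; apply/eqP; rewrite eq_le h nm_ge0.
have m0 : (0 < m)%N.
  rewrite lt0n; apply/eqP => m0; have := fE a.
  by rewrite subrr m0 expr0 mul1r => /esym/eqP; rewrite (negbTE ga).
(* the direction in which (z - a) ^ m * g z is aligned with f a *)
pose om : C := m.-root (f a / g a).
have omE : om ^+ m = f a / g a by rewrite /om rootCK.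
have cg : {for a, continuous g} by apply/hol_cont/hg; rewrite subrr nm0.
have ga0 : 0 < nm (g a) by rewrite nm_gt0.
have [d1 d10 hd1] := (contP g a).1 cg _ ga0.
have [d2 d20 hd2] := (nbhs_nm _ _).1 hmax.
pose d := Num.min d1 d2.
have d0 : 0 < d by rewrite lt_min d10.
have n1 : 0 < nm om + 1 by rewrite ltr_wpDl ?nm_ge0.
pose s := d / (nm om + 1).
have s0 : 0 < s by rewrite divr_gt0.
pose z := a + ofR s * om.
have za : z - a = ofR s * om by rewrite /z addrAC subrr add0r.
have nz : nm (z - a) < d.
  rewrite za nmM nm_ofR ger0_norm ?(ltW s0)// /s mulrAC ltr_pdivrMr//.
  by rewrite ltr_pM2l// ltrDl.
have /hd1 g1 : nm (z - a) < d1 by rewrite (lt_le_trans nz)// /d ge_min lexx.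
have /hd2 : nm (z - a) < d2 by rewrite (lt_le_trans nz)// /d ge_min lexx orbT.
have -> : f z = f a * (1 + ofR (s ^+ m) * (g z / g a)).
  have := fE z; rewrite za exprMn omE => /eqP; rewrite subr_eq => /eqP ->.
  have -> : ofR (s ^+ m) = ofR s ^+ m by rewrite /ofR rmorphXn.
  by rewrite mulrDr mulr1 addrC; congr (_ + _); ring.
rewrite nmM -[X in _ <= X]mulr1 ler_pM2l ?nm_gt0// leNgt => /negP; case.
have re : 0 < complex.Re (g z / g a).
  have -> : g z / g a = 1 + (g z - g a) / g a by rewrite mulrBl divff// addrC subrK.
  have := nm_Re ((g z - g a) / g a); rewrite ReD /= nmM nmV.
  have : nm (g z - g a) / nm (g a) < 1 by rewrite ltr_pdivrMr// mul1r.
  move=> h1 h2; have := le_lt_trans h2 h1; rewrite ltr_norml => /andP[? _].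
  by rewrite -ltrBlDl sub0r.
apply: lt_le_trans (le_trans (ler_norm _) (nm_Re _)).
rewrite ReD /= ltrDl.
have -> : complex.Re (ofR (s ^+ m) * (g z / g a)) = s ^+ m * complex.Re (g z / g a).
  by case: (g z / g a) => x y /=; rewrite mul0r subr0.
by rewrite mulr_gt0// exprn_gt0.
Qed.

(** If |G| exceeds M somewhere, it is maximal at interior points, where G is not 0 and
    hence holomorphic and locally constant. Among these points one has the largest real
    part, which is impossible as its right neighbours are maximum points as well. *)
Lemma maxmod_rado G c r M : 0 < r ->
  (forall z, nm (z - c) <= r -> {for z, continuous G}) ->
  (forall z, nm (z - c) < r -> G z != 0 -> hol G z) ->
  (forall z, nm (z - c) = r -> nm (G z) <= M) ->
  forall z, nm (z - c) <= r -> nm (G z) <= M.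
Proof.
move=> r0 cG hG hM.
have M0 : 0 <= M.
  apply: le_trans (hM (c + ofR r) _); first exact: nm_ge0.
  by rewrite addrAC subrr add0r nm_ofR ger0_norm ?ltW.
have cD := @compact_disc R c r.
have D0 : [set z : C | nm (z - c) <= r] !=set0 by exists c => /=; rewrite subrr nm0 ltW.
have [|x /set_mem /= xD hx] := @compact_EVT_max _ R (fun z => nm (G z)) _ D0 cD.
  apply: continuous_in_subspaceT => z /set_mem /cG h.
  exact: (continuous_comp h (@nm_cont _ _ _)).
suff le : nm (G x) <= M by move=> z hz; apply: le_trans le; apply: hx; exact: mem_set.
rewrite leNgt; apply/negP => Mx; set m := nm (G x) in Mx hx.
pose K := [set z : C | nm (z - c) <= r /\ nm (G z) = m].
have clK : closed K.
  rewrite -[K]setCK; apply: open_closedC; rewrite openE => z nK.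
  have [hz|hz] := leP (nm (z - c)) r; last first.
    have : \forall w \near z, nm (w - z) < nm (z - c) - r by apply: near_nm; rewrite subr_gt0.
    apply: filterS => w hw [hw2 _]; have := nm_tri z w c; rewrite [nm (z - w)]nmC; lra.
  have nm0 : nm (G z) != m by apply/eqP => e; apply: nK.
  have : \forall w \near z, nm (G w) != m.
    have e0 : 0 < `|nm (G z) - m| by rewrite normr_gt0 subr_eq0.
    have [d d0 hd] := (contP G z).1 (cG z hz) _ e0.
    apply/nbhs_nm; exists d => // w /hd; apply: contraTneq => <-.
    by rewrite -leNgt ler_norml nmC nmBge andbT lerNl opprB nmC nmBge.
  by apply: filterS => w hw [_ e]; rewrite e eqxx in hw.
have cK : compact K by apply: (subclosed_compact clK cD) => z [].
have K0 : K !=set0 by exists x.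
have [|y /set_mem[yD yM] hy] := @compact_EVT_max _ R (fun z => complex.Re z) _ K0 cK.
  by apply: continuous_in_subspaceT => z _; exact: Re_cont.
have yr : nm (y - c) < r.
  rewrite lt_neqAle yD andbT; apply/eqP => e.
  by have := hM y e; rewrite yM leNgt Mx.
have Gy : G y != 0 by rewrite -nm_gt0 yM (le_lt_trans M0).
have h1 : \forall z \near y, hol G z.
  have e1 := ball_near yr; have e2 := cont_neq0 (cG y yD) Gy.
  by near=> z; apply: hG; [near: z; exact: e1|near: z; exact: e2].
have h2 : \forall z \near y, nm (G z) <= nm (G y).
  by apply: filterS (ball_near yr) => z hz; rewrite yM; apply: hx; apply: mem_set; exact: ltW.
have h3 := maxmod_local h1 h2.
have [e e0 he] := (nbhs_nm _ _).1 (filterI h3 (ball_near yr)).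
pose w := y + ofR (e / 2).
have e2 : 0 < e / 2 by rewrite divr_gt0.
have [Gw wr] : G w = G y /\ nm (w - c) < r.
  apply: he; rewrite /w addrAC subrr add0r nm_ofR ger0_norm ?ltW//; lra.
have := hy w; rewrite mem_set; last by split; [exact: ltW|rewrite Gw].
move=> /(_ isT); rewrite /w ReD /= ; lra.
Unshelve. all: end_near. Qed.

(** As G vanishes near c, the quotients of G by the powers of z - c are again
    continuous, and holomorphic off their zeros; the maximum principle for these
    quotients gives |G z| <= M (|z - c| / r) ^ k. *)
Lemma identity_rado G c r : 0 < r ->
  (forall z, nm (z - c) <= r -> {for z, continuous G}) ->
  (forall z, nm (z - c) < r -> G z != 0 -> hol G z) ->
  (\forall z \near c, G z = 0) -> forall z, nm (z - c) < r -> G z = 0.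
Proof.
move=> r0 cG hG G0 z hz.
have [M M0 hM] := compact_bd (@compact_disc R c r) cG.
apply: nm_eq0; apply/eqP; rewrite eq_le nm_ge0 andbT.
suff h k : nm (G z) <= M * (nm (z - c) / r) ^+ k.
  rewrite leNgt; apply/negP => fz0.
  have [k hk] : exists k, (nm (z - c) / r) ^+ k < nm (G z) / M.
    apply: expr_small; last by rewrite divr_gt0.
    by rewrite divr_ge0 ?(ltW r0) ?nm_ge0//= ltr_pdivrMr// mul1r.
  by have := h k; rewrite leNgt mulrC -ltr_pdivlMr// hk.
have Gc := nbhs_singleton G0.
have [zc|zc] := eqVneq z c.
  rewrite zc Gc nm0; apply: mulr_ge0; first exact: ltW.
  by apply: exprn_ge0; rewrite divr_ge0 ?nm_ge0 ?(ltW r0).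
have pk w : w != c -> (w - c) ^+ k != 0 by move=> wc; rewrite expf_neq0// subr_eq0.
have : nm (G z / (z - c) ^+ k) <= M / r ^+ k.
  apply: (@maxmod_rado (fun z => G z / (z - c) ^+ k) c r _ r0 _ _ _ z (ltW hz)).
  - move=> w hw; have [->|wc] := eqVneq w c.
      apply: (cont_near _ (cont_cst (0 : C) c)).
      by apply: filterS G0 => u ->; rewrite mul0r.
    exact: (contM (cG w hw) (contV (contX k (hol_cont (hol_subc c w))) (pk w wc))).
  - move=> w hw; rewrite mulf_eq0 negb_or => /andP[Gw _].
    have wc : w != c by apply: contraNneq Gw => ->; rewrite Gc.
    exact: (holM (hG w hw Gw) (holV (@holX _ _ k _ (hol_subc c w)) (pk w wc))).
  - move=> w hw; rewrite nmM nmV nmX hw ler_pM2r ?invr_gt0 ?exprn_gt0//.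
    by apply: hM; rewrite /= hw.
rewrite nmM nmV nmX ler_pdivrMr ?exprn_gt0 ?nm_gt0 ?subr_eq0// => /le_trans; apply.
by rewrite expr_div_n mulrAC mulrA.
Qed.

End Holomorphic.

(** * Functions holomorphic on complex lines *)

Section Lines.
Variable R : realType.
Local Notation C := (Cx R).

Lemma der_uniq (f g : C -> C) z : {for z, continuous g} ->
  (forall w, f w = f z + (w - z) * g w) -> der f z = g z.
Proof.
move=> cg fE.
have hf : hol f z by exists g.
have cd := hol_dq_cont hf.
have eqn w : w != z -> dq f z w = g w.
  move=> wz; rewrite dq_neq// (fE w) addrAC subrr add0r mulrAC divff ?mul1r//.
  by rewrite subr_eq0.
have [//|ne] := eqVneq (der f z) (g z); exfalso.
have d0 : 0 < nm (der f z - g z) by rewrite nm_gt0 subr_eq0.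
have d2 : 0 < nm (der f z - g z) / 2 by rewrite divr_gt0.
have [e1 e10 h1] := (contP _ _).1 cd _ d2.
have [e2 e20 h2] := (contP _ _).1 cg _ d2.
pose s := Num.min e1 e2 / 2.
have m0 : 0 < Num.min e1 e2 by rewrite lt_min e10.
have s0 : 0 < s by rewrite divr_gt0.
have [s1 s2] : s < e1 /\ s < e2.
  have : s < Num.min e1 e2 by rewrite /s; lra.
  by rewrite lt_min => /andP.
pose w := z + ofR s.
have wz : w - z = ofR s by rewrite /w addrAC subrr add0r.
have wne : w != z by rewrite -subr_eq0 wz -nm_gt0 nm_ofR normr_gt0 gt_eqF.
have := h1 w; have := h2 w; rewrite wz nm_ofR ger0_norm ?ltW// => /(_ s2) a2 /(_ s1).
rewrite (eqn _ wne) {1}/dq eqxx => a1.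
have := nm_tri (der f z) (g w) (g z); rewrite [nm (der f z - g w)]nmC.
lra.
Qed.

Variable V : normedModType C.
Implicit Types (f : V -> C) (x y u v c : V) (r : R).

(** Holomorphy of a function of several variables at a point, in the form in which it is
    used: continuity, and holomorphy along the complex lines through the point. *)
Definition mhol f y := {for y, continuous f} /\ forall u, hol (fun t : C => f (y + t *: u)) 0.
Definition mholb f c r := forall y, nm (y - c) < r -> mhol f y.

Lemma mhol_line f y u (t0 : C) : mhol f (y + t0 *: u) -> hol (fun t => f (y + t *: u)) t0.
Proof.
move=> [_ /(_ u) h].
have hz : hol (fun t : C => f (y + t0 *: u + t *: u)) (t0 - t0) by rewrite subrr.
apply: (hol_near _ (hol_comp (hol_subc t0 t0) hz)).
by apply: filterE => t /=; rewrite -addrA -scalerDl addrC [t0 + _]addrC subrK addrC.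
Qed.

Lemma mholM f g y : mhol f y -> mhol g y -> mhol (fun x => f x * g x) y.
Proof. by move=> [cf hf] [cg hg]; split; [exact: (contM cf cg)|move=> u; exact: (holM (hf u) (hg u))]. Qed.

Definition Dv v f y : C := der (fun t : C => f (y + t *: v)) 0.

Lemma mhol_bounded f c r y : mholb f c r -> nm (y - c) < r -> exists d M : R,
  [/\ 0 < d, 0 < M & forall x, nm (x - y) < d -> mhol f x /\ nm (f x) <= M].
Proof.
move=> hf hy; have [cf _] := hf y hy.
have [d d0 hd] := (contP f y).1 cf 1 ltr01.
have [d' d'0 hd'] := (nbhs_nm _ _).1 (ball_near hy).
exists (Num.min d d'), (nm (f y) + 1); split.
- by rewrite lt_min d0.
- by rewrite ltr_wpDl ?nm_ge0.
move=> x; rewrite lt_min => /andP[h1 h2]; split; first exact/hf/hd'.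
have := nmBge (f x) (f y); have := hd x h1; lra.
Qed.

Lemma nm_shift y y0 (t : C) v d s : nm (y - y0) < d / 2 -> mx t <= s ->
  s * (nm v + 1) <= d / 8 -> nm (y + t *: v - y0) < d.
Proof.
move=> h1 h2 h3; rewrite addrAC; apply: le_lt_trans (nmD _ _) _.
rewrite nmZ; have tt : nm t <= 2 * s by apply: le_trans (nm_mx t) _; rewrite ler_pM2l.
have v0 := nm_ge0 v; have t0 := nm_ge0 t; have y0' := nm_ge0 (y - y0).
have : nm t * nm v <= 2 * s * (nm v + 1) by apply: ler_pM => //; rewrite lerDl.
lra.
Qed.

Lemma dq_line f y v (w : C) : w != 0 ->
  dq (fun t : C => f (y + t *: v)) 0 w = (f (y + w *: v) - f y) / w.
Proof. by move=> w0; rewrite dq_neq// scale0r addr0 subr0. Qed.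

(** The difference quotients of f in the direction u, on the disc y0 + z v, converge
    uniformly as the increment tends to 0. By Cauchy's inequality their derivatives at z
    = 0 converge too, and these are the difference quotients of Dv v f in the direction
    u. *)
Lemma mholb_D f c r v : mholb f c r -> mholb (Dv v f) c r.
Proof.
move=> hf y0 hy0; have [d [M [d0 M0 hd]]] := mhol_bounded hf hy0.
pose sz u := d / (8 * (nm u + 1)).
have szp u : 0 < sz u by rewrite divr_gt0// mulr_gt0// ltr_wpDl ?nm_ge0.
have szE u : sz u * (nm u + 1) <= d / 8.
  by rewrite le_eqVlt; apply/orP; left; apply/eqP; rewrite /sz; field; rewrite gt_eqF// ltr_wpDl ?nm_ge0.
have lin u y : nm (y - y0) < d / 2 -> forall t : C, mx t <= sz u ->
    hol (fun t => f (y + t *: u)) t /\ nm (f (y + t *: u)) <= M.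
  move=> hy t ht; have [h1 h2] := hd _ (nm_shift hy ht (szE u)).
  by split => //; exact: mhol_line.
have cd u y : nm (y - y0) < d / 2 -> forall w : C, w != 0 -> mx w < sz u ->
    nm ((f (y + w *: u) - f y) / w - Dv u f y) <= 4 * M / (sz u * sz u) * nm w.
  move=> hy w w0 hw; rewrite -dq_line//.
  have [||_ h] := @cauchy_der R (fun t => f (y + t *: u)) 0 (sz u) M (szp u).
  - by move=> t; rewrite subr0 => /(lin u y hy)[].
  - by move=> t; rewrite subr0 => /(lin u y hy)[].
  by have := h w; rewrite subr0 => /(_ hw).
split.
  apply/contP => e e0; set K := 4 * M / (sz v * sz v) in cd.
  have K0 : 0 < K by apply: divr_gt0; apply: mulr_gt0.
  pose t := Num.min (sz v) (e / (4 * K)) / 2.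
  have m0 : 0 < Num.min (sz v) (e / (4 * K)) by rewrite lt_min szp divr_gt0// mulr_gt0.
  have t0 : 0 < t by rewrite divr_gt0.
  have [t1 t2] : t < sz v /\ t < e / (4 * K).
    have : t < Num.min (sz v) (e / (4 * K)) by rewrite /t; lra.
    by rewrite lt_min => /andP.
  clearbody t.
  have wn : nm (ofR t : C) = t by rewrite nm_ofR ger0_norm ?ltW.
  have w0 : (ofR t : C) != 0 by rewrite -nm_gt0 wn.
  have wm : mx (ofR t : C) < sz v by apply: le_lt_trans (mx_nm _) _; rewrite wn.
  have y00 : nm (y0 - y0) < d / 2 by rewrite subrr nm0 divr_gt0.
  have cf1 : {for y0, continuous (fun y => f (y + ofR t *: v))}.
    have /hd[[cf _] _] : nm (y0 + ofR t *: v - y0) < d.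
      by apply: (nm_shift y00 (ltW wm)); exact: szE.
    apply/contP => e' e'0; have [d' d'0 h'] := (contP _ _).1 cf _ e'0.
    by exists d' => // y hy; apply: h'; rewrite opprD addrACA subrr addr0.
  have hh0 : nm (y0 - y0) < d by rewrite subrr nm0.
  have cf0 : {for y0, continuous f} := (hd y0 hh0).1.1.
  have cq := contM (contB cf1 cf0) (cont_cst ((ofR t : C)^-1) y0).
  have [d1 d10 h1] := (contP _ _).1 cq (e / 2) (divr_gt0 e0 (ltr0n _ 2)).
  exists (Num.min d1 (d / 2)); first by rewrite lt_min d10 divr_gt0.
  move=> y; rewrite lt_min => /andP[hy1 hy2].
  have b0 := cd v y0 y00 (ofR t) w0 wm.
  have b1 := cd v y hy2 (ofR t) w0 wm.
  have b2 := h1 y hy1; rewrite wn in b0 b1.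
  have kt : K * t < e / 4.
    by move: t2; rewrite invfM mulrA ltr_pdivlMr// mulrC.
  have -> : e = e / 4 + (e / 2 + e / 4) by field.
  apply: le_lt_trans (nm_tri _ ((f (y + ofR t *: v) - f y) / ofR t) _) _.
  apply: ltrD; first by rewrite nmC; apply: le_lt_trans b1 kt.
  apply: le_lt_trans (nm_tri _ ((f (y0 + ofR t *: v) - f y0) / ofR t) _) _.
  by apply: ltrD => //; apply: le_lt_trans b0 kt.
move=> u.
have y00 : nm (y0 - y0) < d / 4 by rewrite subrr nm0 divr_gt0.
pose E (t : C) := Dv v f (y0 + t *: u).
(* the difference quotients k_t in the direction u, as functions of the parameter along v *)
pose k (t z : C) := (f (y0 + z *: v + t *: u) - f (y0 + z *: v)) / t.
pose sv := sz v / 2; pose su := sz u / 2.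
have sv0 : 0 < sv by rewrite divr_gt0.
have su0 : 0 < su by rewrite divr_gt0.
have yv (z : C) : mx z <= sv -> nm (y0 + z *: v - y0) < d / 2.
  move=> hz; have y00' : nm (y0 - y0) < (d / 2) / 2 by rewrite subrr nm0 !divr_gt0.
  apply: (nm_shift y00' hz); rewrite /sv mulrAC ler_pdivrMr//.
  by have := szE v; lra.
have yu (t : C) : mx t <= su -> nm (y0 + t *: u - y0) < d / 2.
  move=> hz; have y00' : nm (y0 - y0) < (d / 2) / 2 by rewrite subrr nm0 !divr_gt0.
  apply: (nm_shift y00' hz); rewrite /su mulrAC ler_pdivrMr//.
  by have := szE u; lra.
have svz : sv < sz v by rewrite /sv; have := szp v; lra.
have suz : su < sz u by rewrite /su; have := szp u; lra.
set K := 4 * M / (sz u * sz u).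
have K0 : 0 < K by apply: divr_gt0; apply: mulr_gt0.
have kk (t t' : C) : t != 0 -> t' != 0 -> mx t < su -> mx t' < su ->
    forall z, mx z <= sv -> nm (k t z - k t' z) <= K * (nm t + nm t').
  move=> t0 t0' ht ht' z hz.
  have c1 := cd u _ (yv z hz) t t0 (lt_trans ht suz).
  have c2 := cd u _ (yv z hz) t' t0' (lt_trans ht' suz).
  apply: (le_trans (nm_tri _ (Dv u f (y0 + z *: v)) _)); rewrite mulrDr.
  by apply: lerD => //; rewrite nmC.
have kdec (t : C) : t != 0 -> mx t < su ->
    forall w, k t w = k t 0 + w * ((dq (fun z => f (y0 + t *: u + z *: v)) 0 w
       - dq (fun z => f (y0 + z *: v)) 0 w) / t).
  move=> t0 ht w; rewrite /k scale0r !addr0.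
  have e1 := dqE (fun z => f (y0 + t *: u + z *: v)) 0 w.
  have e2 := dqE (fun z => f (y0 + z *: v)) 0 w.
  rewrite scale0r addr0 subr0 in e1; rewrite scale0r addr0 subr0 in e2.
  by rewrite addrAC e1 e2; field.
have qder (t t' : C) : t != 0 -> t' != 0 -> mx t < su -> mx t' < su ->
    der (fun z => k t z - k t' z) 0 = dq E 0 t - dq E 0 t'.
  move=> t0 t0' ht ht'.
  pose g w := (dq (fun z => f (y0 + t *: u + z *: v)) 0 w
       - dq (fun z => f (y0 + z *: v)) 0 w) / t -
     (dq (fun z => f (y0 + t' *: u + z *: v)) 0 w
       - dq (fun z => f (y0 + z *: v)) 0 w) / t'.
  have mx00 : mx (0 : C) <= sz v by rewrite mx0 ltW.
  have cdq y : nm (y - y0) < d / 2 -> {for 0, continuous (dq (fun z => f (y + z *: v)) 0)}.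
    by move=> hy; apply: hol_dq_cont; have [] := lin v y hy 0 mx00.
  have c0 : nm (y0 - y0) < d / 2 by rewrite subrr nm0 divr_gt0.
  have c1 := cdq _ (yu t (ltW ht)); have c2 := cdq _ (yu t' (ltW ht')); have c3 := cdq _ c0.
  rewrite (@der_uniq _ g).
  - rewrite (@dq_neq _ E 0 t t0) (@dq_neq _ E 0 t' t0') !subr0 /g /dq eqxx /E /Dv scale0r addr0.
    by [].
  - apply: (contB (contM (contB c1 c3) (cont_cst (t^-1) 0)) (contM (contB c2 c3) (cont_cst (t'^-1) 0))).
  - by move=> w; rewrite (kdec t t0 ht w) (kdec t' t0' ht' w) subr0 /g; ring.
have khol (t : C) : t != 0 -> mx t < su -> forall z, mx z <= sv -> hol (k t) z.
  move=> t0 ht z hz.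
  have h1 := (lin v _ (yu t (ltW ht)) z (le_trans hz (ltW svz))).1.
  have h2 : hol (fun z => f (y0 + z *: v)) z.
    by apply: (lin v _ _ z (le_trans hz (ltW svz))).1; rewrite subrr nm0 divr_gt0.
  apply: (hol_near _ (holM (holB h1 h2) (hol_cst (t^-1) z))).
  by apply: filterE => w; rewrite /k [y0 + w *: v + _]addrAC.
have [l hl] : exists l, forall e : R, 0 < e -> exists2 d : R, 0 < d & forall b, b != 0 ->
     nm (b - 0) < d -> nm (dq E 0 b - l) <= e.
  apply: cauchy_limit => e e0.
  pose d1 := Num.min su (e * sv / (4 * K)).
  have q0 : 0 < e * sv / (4 * K) by apply: divr_gt0; apply: mulr_gt0.
  have d10 : 0 < d1 by rewrite lt_min su0 q0.
  exists d1 => // b b' b0 b0'; rewrite !subr0 !lt_min => /andP[h1 h2] /andP[h3 h4].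
  have m1 := le_lt_trans (mx_nm b) h1; have m2 := le_lt_trans (mx_nm b') h3.
  rewrite -qder//.
  have [||dd _] := @cauchy_der R (fun z => k b z - k b' z) 0 sv (K * (nm b + nm b')) sv0.
  - by move=> z; rewrite subr0 => hz; apply: holB; exact: khol.
  - by move=> z; rewrite subr0 => hz; exact: kk.
  apply: (le_trans dd); rewrite ler_pdivrMr//.
  have -> : e * sv = 2 * (K * (e * sv / (4 * K) + e * sv / (4 * K))) by field; rewrite gt_eqF.
  by rewrite ler_pM2l// ler_pM2l// ltW// ltrD.
apply: (@hol_near_ex _ _ _ (fun w => if w == 0 then l else dq E 0 w)).
  apply/contP => e e0; have e2 : 0 < e / 2 by rewrite divr_gt0.
  have [d' d'0 hd'] := hl _ e2; exists d' => // w hw; rewrite eqxx.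
  case: eqVneq => [_|wa]; first by rewrite subrr nm0.
  by apply: le_lt_trans (hd' w wa hw) _; rewrite ltr_pdivrMr// mulr_natr mulr2n ltrDl.
apply: filterE => w; case: eqVneq => [->|_]; first by rewrite subrr mul0r addr0.
exact: (dqE E 0 w).
Qed.

End Lines.

(** * Zeros near a point on nearby parallel lines *)

Section LocalZeros.
Variable R : realType.
Local Notation C := (Cx R).
Variable V : normedModType C.
Implicit Types (f : V -> C) (x y v : V) (r : R) (z : C).

(** Compactness makes continuity along a compact part of a line uniform under
    translation of the line. *)
Lemma cont_tube (K : set C) f y1 v : compact K ->
  (forall z, K z -> {for y1 + z *: v, continuous f}) -> forall e : R, 0 < e ->
  \forall y \near y1, forall z, K z -> nm (f (y + z *: v) - f (y1 + z *: v)) < e.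
Proof.
move=> /compact_near_coveringP cK cf e e0.
apply: (cK _ (nbhs y1) (fun y z => nm (f (y + z *: v) - f (y1 + z *: v)) < e)) => z0 Kz0.
have e2 : 0 < e / 2 by rewrite divr_gt0.
have [d d0 hd] := (contP _ _).1 (cf z0 Kz0) _ e2.
have d2 : 0 < d / 2 by rewrite divr_gt0.
have v0 := nm_ge0 v.
have v1 : 0 < nm v + 1 by rewrite ltr_wpDl.
have s0 : 0 < d / 2 / (nm v + 1) by rewrite divr_gt0.
exists ([set z | nm (z - z0) < d / 2 / (nm v + 1)], [set y | nm (y - y1) < d / 2]).
  by split; [exact: (near_nm z0 s0)|exact: (near_nm y1 d2)].
move=> [z y] /= [hz hy].
have hzv : nm (z *: v - z0 *: v) < d / 2.
  rewrite -scalerBl nmZ; have := nm_ge0 (z - z0); move: hz; rewrite ltr_pdivlMr// => hz hz0.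
  by apply: le_lt_trans hz; apply: ler_wpM2l => //; rewrite lerDl.
have h1 : nm (f (y + z *: v) - f (y1 + z0 *: v)) < e / 2.
  apply: hd; rewrite opprD addrACA; apply: le_lt_trans (nmD _ _) _.
  by rewrite (splitr d) ltrD.
have h2 : nm (f (y1 + z *: v) - f (y1 + z0 *: v)) < e / 2.
  apply: hd; rewrite opprD addrACA subrr add0r; apply: lt_le_trans hzv _.
  by rewrite ler_pdivrMr// mulr_natr mulr2n lerDl ltW.
apply: le_lt_trans (nm_tri _ (f (y1 + z0 *: v)) _) _.
by rewrite (splitr e) [X in _ + X]nmC ltrD.
Qed.

Lemma compact_min (A : set C) (f : C -> C) : compact A -> (forall z, A z -> {for z, continuous f}) ->
  (forall z, A z -> f z != 0) -> exists2 M : R, 0 < M & forall z, A z -> M <= nm (f z).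
Proof.
move=> cA cf f0.
have cV z : A z -> {for z, continuous (fun z => (f z)^-1)}.
  by move=> Az; apply: contV; [exact: cf|exact: f0].
have [M M0 hM] := compact_bd cA cV; exists M^-1; first by rewrite invr_gt0.
move=> z Az; have := hM z Az; rewrite nmV -[X in _ -> X <= _]/(M^-1) => h.
by rewrite -[nm (f z)]invrK lef_pV2 ?posrE ?invr_gt0 ?nm_gt0 ?f0.
Qed.

Lemma mx_closed_ge (e : R) : closed [set z : C | e <= mx z].
Proof.
have -> : [set z : C | e <= mx z] = ~` [set z | mx z < e].
  by apply/seteqP; split => z /=; rewrite leNgt => /negP.
apply: open_closedC; rewrite openE => z /= hz.
apply/nbhs_nm; exists (e - mx z); first by rewrite subr_gt0.
move=> w hw; rewrite /= -(subrK z w); apply: le_lt_trans (mxD _ _) _.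
by rewrite -ltrBrDr; apply: le_lt_trans (mx_nm _) _.
Qed.

(** A bounded neighbourhood of y1 in which the restriction of f to the line y1 + C v has
    a zero of order m at y1, and no other, with explicit constants. *)
Record box f y1 v (m : nat) (s c0 c1 M : R) : Prop := Box {
  box_s : 0 < s; box_s4 : s <= 1 / 4; box_c0 : 0 < c0; box_c1 : 0 < c1; box_M : 0 < M;
  box_hol : \forall y \near y1, forall z, mx z <= s -> mhol f (y + z *: v) /\ nm (f (y + z *: v)) <= M;
  box_lo : forall z, mx z <= s -> c0 * nm z ^+ m <= nm (f (y1 + z *: v));
  box_hi : forall z, mx z <= s -> nm (f (y1 + z *: v)) <= c1 * nm z ^+ m }.

Lemma box_exists f y1 v r m (g : C -> C) rg : 0 < r -> mholb f y1 r -> 0 < rg -> holb g 0 rg ->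
  g 0 != 0 -> (forall z, f (y1 + z *: v) = z ^+ m * g z) ->
  forall e0 : R, 0 < e0 -> exists s c0 c1 M, s <= e0 /\ box f y1 v m s c0 c1 M.
Proof.
move=> r0 hf rg0 hg g0 fE e0 e00.
have y11 : nm (y1 - y1) < r by rewrite subrr nm0.
have [d [M [d0 M0 hd]]] := mhol_bounded hf y11.
have n0 : nm (0 - 0 : C) < rg by rewrite subrr nm0.
have cg := hol_cont (hg 0 n0).
have g1 : 0 < nm (g 0) / 2 by rewrite divr_gt0 ?nm_gt0.
have [d1 d10 hd1] := (contP _ _).1 cg _ g1.
pose s := Num.min (Num.min e0 (1 / 4)) (Num.min (d / (8 * (nm v + 1))) (d1 / 4)).
have v1 : 0 < nm v + 1 by rewrite ltr_wpDl ?nm_ge0.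
have s0 : 0 < s by rewrite !lt_min e00 !divr_gt0// mulr_gt0.
have [[s1 s2] [s3 s4]] : (s <= e0 /\ s <= 1 / 4) /\ (s <= d / (8 * (nm v + 1)) /\ s <= d1 / 4).
  by rewrite /s !ge_min !lexx ?orbT.
clearbody s.
have gb z : mx z <= s -> nm (g 0) / 2 <= nm (g z) <= 2 * nm (g 0).
  move=> hz; have : nm (z - 0) < d1.
    by rewrite subr0; apply: le_lt_trans (nm_mx z) _; lra.
  move=> /hd1 h; have := nmBge (g z) (g 0); have := nmBge (g 0) (g z).
  by rewrite [nm (g 0 - g z)]nmC => h1 h2; apply/andP; split; lra.
exists s, (nm (g 0) / 2), (2 * nm (g 0)), M; split => //; split => //.
- by rewrite mulr_gt0// nm_gt0.
- apply: filterS (near_nm y1 (divr_gt0 d0 (ltr0n _ 2))) => y hy z hz.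
  apply: hd; apply: (nm_shift hy hz).
  move: s3; rewrite ler_pdivlMr ?mulr_gt0//; lra.
- by move=> z /gb/andP[h _]; rewrite fE nmM nmX mulrC ler_wpM2l// exprn_ge0// nm_ge0.
- by move=> z /gb/andP[_ h]; rewrite fE nmM nmX mulrC ler_wpM2r// exprn_ge0// nm_ge0.
Qed.

Section Box.
Variables (f : V -> C) (y1 v : V) (m : nat) (s c0 c1 M : R).
Hypothesis B : box f y1 v m s c0 c1 M.

Let cf z : mx z <= s -> {for y1 + z *: v, continuous f}.
Proof. by move=> hz; have /nbhs_singleton/(_ z hz)[[]] := box_hol B. Qed.

Lemma box_close e : 0 < e -> \forall y \near y1, forall z, mx z <= s ->
  nm (f (y + z *: v) - f (y1 + z *: v)) < e.
Proof.
move=> e0; have := @cont_tube _ f y1 v (@compact_sq R 0 s) _ e e0.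
have h z : [set z : C | mx (z - 0) <= s] z -> {for y1 + z *: v, continuous f}.
  by rewrite /= subr0; exact: cf.
by move=> /(_ h); apply: filterS => y hy z hz; apply: hy; rewrite /= subr0.
Qed.

Lemma box_far e : 0 < e -> exists2 m0 : R, 0 < m0 &
  \forall y \near y1, forall z, e <= mx z <= s -> m0 <= nm (f (y + z *: v)).
Proof.
move=> e0; have k0 : 0 < c0 * e ^+ m by rewrite mulr_gt0 ?exprn_gt0 ?(box_c0 B).
exists (c0 * e ^+ m / 2); first by rewrite divr_gt0.
have k2 : 0 < c0 * e ^+ m / 2 by rewrite divr_gt0.
apply: filterS (box_close k2) => y hy z /andP[ez zero_list].
have h1 := hy z zero_list; have h2 := box_lo B zero_list.
have h3 : c0 * e ^+ m <= c0 * nm z ^+ m.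
  rewrite ler_pM2l ?(box_c0 B)//; apply: lerXn2r; rewrite ?nnegrE ?nm_ge0 ?(ltW e0)//.
  exact: le_trans ez (mx_nm z).
have := nmBge (f (y1 + z *: v)) (f (y + z *: v)); rewrite [nm (f (y1 + _) - _)]nmC.
lra.
Qed.

Lemma box_zero e : 0 < e -> \forall y \near y1, forall z, mx z <= s -> f (y + z *: v) = 0 -> mx z < e.
Proof.
move=> e0; have [m0 m00 h] := box_far e0.
apply: filterS h => y hy z zero_list fz; rewrite ltNge; apply/negP => ez.
by have := hy z; rewrite ez zero_list fz nm0 leNgt m00 => /(_ isT).
Qed.

(** If f had no zero in the square of radius e on the line through y, then by the
    maximum principle 1 / f would be bounded at y by its values on the boundary of the
    square, which are bounded uniformly in y near y1, whereas f y tends to 0. *)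
Lemma hurwitz e : 0 < e -> e <= s -> f y1 = 0 ->
  \forall y \near y1, exists2 z : C, mx z < e & f (y + z *: v) = 0.
Proof.
move=> e0 es f0; have [m0 m00 h] := box_far e0.
have cf1 : {for y1, continuous f}.
  by rewrite -[y1]addr0 -(scale0r v); apply: cf; rewrite mx0 ltW// (box_s B).
have [d d0 hd] := (contP _ _).1 cf1 _ m00.
near=> y; apply: contrapT => nex.
have hy : nm (y - y1) < d by near: y; exact: near_nm.
have far : forall z, e <= mx z <= s -> m0 <= nm (f (y + z *: v)) by near: y.
have ghy : forall z, mx z <= s -> mhol f (y + z *: v) /\ nm (f (y + z *: v)) <= M.
  by near: y; exact: (box_hol B).
have nz z : mx z <= e -> f (y + z *: v) != 0.
  move=> hz; have [ze|ze] := ltP (mx z) e.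
    by apply/eqP => fz; apply: nex; exists z.
  by rewrite -nm_gt0 (lt_le_trans m00)// far// ze (le_trans hz).
have : nm ((f (y + 0 *: v))^-1) <= m0^-1.
  apply: (@maxmod_sq R (fun z => (f (y + z *: v))^-1) 0 e).
  - move=> z; rewrite subr0 => hz; apply: holV; last exact: nz.
    exact: (mhol_line (ghy z (le_trans hz es)).1).
  - move=> z; rewrite subr0 => hz; rewrite nmV lef_pV2 ?posrE// ?nm_gt0 ?nz ?hz//.
    by apply: far; rewrite hz lexx.
  - by rewrite subr0 mx0.
have f0' : f (y + 0 *: v) != 0 by apply: nz; rewrite mx0 ltW.
rewrite nmV lef_pV2 ?posrE ?nm_gt0// leNgt scale0r addr0.
by have := hd y hy; rewrite f0 subr0 => ->.
Unshelve. all: end_near. Qed.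

(** With more than m factors, all the points of L being within e of 0, |f| is at most a
    constant times e ^ (m + 1) at distance e, while it is close to f on the line through
    y1, where it is at least c0 e ^ m. *)
Lemma mult_upper : \forall y \near y1, forall (L : seq C) (h : C -> C),
  (forall l, l \in L -> mx l <= s) -> (forall z, mx z <= s -> hol h z) ->
  (forall z, mx z <= s -> f (y + z *: v) = \prod_(l <- L) (z - l) * h z) -> (size L <= m)%N.
Proof.
have s0 := box_s B; have s4 := box_s4 B; have c00 := box_c0 B; have M0 := box_M B.
(* K bounds the cofactor of m + 1 of the linear factors, whose zeros are within s / 2 of 0;
   D and e are chosen so that (4 e) ^ (m + 1) K <= c0 e ^ m / 4 *)
pose K := M / (s / 2) ^+ m.+1.
have K0 : 0 < K by rewrite divr_gt0 ?exprn_gt0 ?divr_gt0.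
pose D := 4 * (4 ^+ m.+1 * K).
have D0 : 0 < D by apply: mulr_gt0 => //; apply: mulr_gt0 => //; exact: exprn_gt0.
pose e := Num.min (s / 2) (c0 / D).
have e0 : 0 < e by rewrite lt_min !divr_gt0.
have [e1 e2] : e <= s / 2 /\ e <= c0 / D by rewrite /e !ge_min !lexx ?orbT.
clearbody e.
have ke : 0 < c0 * e ^+ m / 2 by apply: divr_gt0 => //; apply: mulr_gt0 => //; exact: exprn_gt0.
near=> y => L h hL hh hE; rewrite leqNgt; apply/negP => mL.
have close : forall z, mx z <= s -> nm (f (y + z *: v) - f (y1 + z *: v)) < c0 * e ^+ m / 2.
  by near: y; exact: box_close.
have small : forall z, mx z <= s -> f (y + z *: v) = 0 -> mx z < e by near: y; exact: box_zero.
have ghy : forall z, mx z <= s -> mhol f (y + z *: v) /\ nm (f (y + z *: v)) <= M.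
  by near: y; exact: (box_hol B).
have hLe l : l \in L -> mx l < e.
  move=> lL; apply: small; first exact: hL.
  rewrite hE ?hL//; have -> : \prod_(k <- L) (l - k) = 0; last by rewrite mul0r.
  by apply/eqP; rewrite prodf_seq_eq0; apply/hasP; exists l => //=; rewrite subrr.
pose L1 := take m.+1 L; pose L2 := drop m.+1 L.
have sL1 : size L1 = m.+1 by rewrite size_take_min (minn_idPl mL).
pose h' z := \prod_(l <- L2) (z - l) * h z.
have hE' z : mx z <= s -> f (y + z *: v) = \prod_(l <- L1) (z - l) * h' z.
  by move=> hz; rewrite hE// /h' mulrA -big_cat /L1 /L2 cat_take_drop.
have L1e l : l \in L1 -> mx l < e by move=> /mem_take; exact: hLe.
have prod_le (A : R) (z : C) : (forall l, l \in L1 -> nm (z - l) <= A) ->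
    nm (\prod_(l <- L1) (z - l)) <= A ^+ m.+1.
  rewrite -sL1; elim: (L1) => [|l T IH] hT; first by rewrite big_nil nm1 expr0.
  rewrite big_cons nmM /= exprS; apply: ler_pM; rewrite ?nm_ge0//.
    by apply: hT; rewrite mem_head.
  by apply: IH => k kT; apply: hT; rewrite inE kT orbT.
have prod_ge (A : R) (z : C) : 0 <= A -> (forall l, l \in L1 -> A <= nm (z - l)) ->
    A ^+ m.+1 <= nm (\prod_(l <- L1) (z - l)).
  rewrite -sL1 => A0; elim: (L1) => [|l T IH] hT; first by rewrite big_nil nm1 expr0.
  rewrite big_cons nmM /= exprS; apply: ler_pM; rewrite ?exprn_ge0//.
    by apply: hT; rewrite mem_head.
  by apply: IH => k kT; apply: hT; rewrite inE kT orbT.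
have hK z : mx z < s -> nm (h' z) <= K.
  rewrite -[X in mx X < s]subr0; apply: maxmod_sq => w; rewrite subr0 => hw.
    apply: (@holM _ (fun w => \prod_(l <- L2) (w - l)) h); last exact: hh.
    by apply: hol_prod => l _; exact: hol_subc.
  have := (ghy w _).2; rewrite hw lexx => /(_ isT); rewrite hE' ?hw// nmM => h1.
  have : (s / 2) ^+ m.+1 <= nm (\prod_(l <- L1) (w - l)).
    apply: prod_ge; first by rewrite divr_ge0// ltW.
    move=> l /L1e le; apply: le_trans (mx_nm _).
    by have := mxD (w - l) l; rewrite subrK hw; lra.
  move=> h2; rewrite /K ler_pdivlMr ?exprn_gt0 ?divr_gt0//; apply: le_trans h1.
  by rewrite mulrC; apply: ler_wpM2r => //; exact: nm_ge0.
have mxe : mx (ofR e : C) = e.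
  by rewrite /mx /= normr0 ger0_norm ?ltW// max_l// ltW.
have nme : nm (ofR e : C) = e by rewrite nm_ofR ger0_norm// ltW.
have es : e < s by lra.
have u1 : nm (f (y + ofR e *: v)) <= (4 * e) ^+ m.+1 * K.
  rewrite hE' ?mxe ?(ltW es)// nmM; apply: ler_pM; rewrite ?nm_ge0//.
    apply: prod_le => l /L1e le; apply: (le_trans (nmB _ _)).
    by have := nm_mx l; rewrite nme; lra.
  by apply: hK; rewrite mxe.
have l1 : c0 * e ^+ m <= nm (f (y1 + ofR e *: v)).
  by have := box_lo B (z := ofR e); rewrite mxe nme (ltW es) => /(_ isT).
have cl : nm (f (y + ofR e *: v) - f (y1 + ofR e *: v)) < c0 * e ^+ m / 2.
  by apply: close; rewrite mxe ltW.
have := nmBge (f (y1 + ofR e *: v)) (f (y + ofR e *: v)); rewrite [nm (f (y1 + _) - _)]nmC => tri.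
have em : 0 < e ^+ m by rewrite exprn_gt0.
have : c0 * e ^+ m / 2 < (4 * e) ^+ m.+1 * K by lra.
have -> : (4 * e) ^+ m.+1 * K = e ^+ m * (e * D / 4) by rewrite /D exprMn !exprS; field.
have -> : c0 * e ^+ m / 2 = e ^+ m * (c0 / 2) by ring.
rewrite ltr_pM2l// => lt.
by move: e2; rewrite ler_pdivlMr//; lra.
Unshelve. all: end_near. Qed.

(** With a single zero, of multiplicity j < m, |f| is at least a constant times e ^ j at
    distance 2 e, while it is close to f on the line through y1, where it is of order e
    ^ m. *)
Lemma mult_lower : \forall y \near y1, forall (l : C) (j : nat) (h : C -> C), mx l <= s ->
  (forall z, mx z <= s -> hol h z /\ h z != 0) ->
  (forall z, mx z <= s -> f (y + z *: v) = (z - l) ^+ j * h z) -> (0 < j)%N -> (m <= j)%N.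
Proof.
have s0 := box_s B; have s4 := box_s4 B; have c00 := box_c0 B; have c10 := box_c1 B.
have [ms ms0 hfar] := box_far s0.
pose D := c1 * (2 ^+ m + 1).
have D0 : 0 < D by rewrite mulr_gt0// ltr_wpDl// exprn_ge0.
pose e := Num.min (s / 4) (ms / (2 * D)).
have e0 : 0 < e by rewrite lt_min !divr_gt0// mulr_gt0.
have [e1 e2] : e <= s / 4 /\ e <= ms / (2 * D) by rewrite /e !ge_min !lexx ?orbT.
clearbody e.
have ke : 0 < c1 * e ^+ m by rewrite mulr_gt0 ?exprn_gt0.
near=> y => l j h hl hh hE j0; rewrite leqNgt; apply/negP => jm.
have close : forall z, mx z <= s -> nm (f (y + z *: v) - f (y1 + z *: v)) < c1 * e ^+ m.
  by near: y; exact: box_close.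
have small : forall z, mx z <= s -> f (y + z *: v) = 0 -> mx z < e by near: y; exact: box_zero.
have far : forall z, s <= mx z <= s -> ms <= nm (f (y + z *: v)) by near: y.
have le : mx l < e.
  by apply: small => //; rewrite hE// subrr expr0n; case: (j) j0 => //= k _; rewrite mul0r.
have hK z : mx z < s -> ms <= nm (h z).
  move=> hz; have [_ hz0] := hh z (ltW hz).
  suff : nm ((h z)^-1) <= ms^-1 by rewrite nmV lef_pV2 ?posrE ?nm_gt0.
  move: hz; rewrite -[X in mx X < s]subr0.
  apply: (@maxmod_sq R (fun z => (h z)^-1)) => w; rewrite subr0 => hw.
    by have [? ?] := hh w hw; exact: holV.
  have hws : mx w <= s by rewrite hw.
  have [_ hw0'] := hh w hws.
  rewrite nmV lef_pV2 ?posrE ?nm_gt0//; apply: le_trans (far w _) _; first by rewrite hw lexx.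
  rewrite hE ?hw// nmM nmX -[X in _ <= X]mul1r ler_wpM2r ?nm_ge0//.
  apply: exprn_ile1; first exact: nm_ge0.
  have := nmB w l; have := nm_mx w; have := nm_mx l; rewrite hw; lra.
have mxe : mx (ofR (2 * e) : C) = 2 * e.
  by rewrite /mx /= normr0 ger0_norm ?max_l// mulr_ge0// ltW.
have nme : nm (ofR (2 * e) : C) = 2 * e by rewrite nm_ofR ger0_norm// mulr_ge0// ltW.
have es : 2 * e < s by lra.
have u1 : e ^+ j * ms <= nm (f (y + ofR (2 * e) *: v)).
  rewrite hE ?mxe ?(ltW es)// nmM nmX; apply: ler_pM.
  - by rewrite exprn_ge0 ?(ltW e0).
  - exact: ltW.
  - apply: lerXn2r; rewrite ?nnegrE ?nm_ge0 ?(ltW e0)//.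
    apply: le_trans (mx_nm _); have := mxD (ofR (2 * e) - l) l; rewrite subrK mxe; lra.
  - by rewrite hK// mxe.
have l1 : nm (f (y1 + ofR (2 * e) *: v)) <= c1 * (2 * e) ^+ m.
  by have := box_hi B (z := ofR (2 * e)); rewrite mxe nme (ltW es) => /(_ isT).
have cl : nm (f (y + ofR (2 * e) *: v) - f (y1 + ofR (2 * e) *: v)) < c1 * e ^+ m.
  by apply: close; rewrite mxe ltW.
have := nmBge (f (y + ofR (2 * e) *: v)) (f (y1 + ofR (2 * e) *: v)) => tri.
have le1 : e ^+ m.-1 <= e ^+ j.
  by apply: ler_wiXn2l; [exact: ltW|lra|rewrite -ltnS prednK// (leq_trans _ jm)].
have em : 0 < e ^+ m.-1 by rewrite exprn_gt0.
have : e ^+ m.-1 * ms < c1 * (2 * e) ^+ m + c1 * e ^+ m.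
  apply: le_lt_trans (_ : e ^+ j * ms < _); first by rewrite ler_pM2r.
  by lra.
have -> : c1 * (2 * e) ^+ m + c1 * e ^+ m = e ^+ m.-1 * (e * D).
  rewrite /D exprMn; have -> : e ^+ m = e ^+ m.-1 * e by rewrite -exprSr prednK// (leq_trans _ jm).
  by ring.
rewrite ltr_pM2l// => lt.
by move: e2; rewrite ler_pdivlMr ?mulr_gt0//; lra.
Unshelve. all: end_near. Qed.

End Box.
End LocalZeros.

(** * Zeros as holomorphic functions of the line *)

Section Sheets.
Variable R : realType.
Local Notation C := (Cx R).
Variable V : normedModType C.
Implicit Types (f F : V -> C) (x y u v c : V) (r : R) (z : C).

Lemma dq_unif f c r v y0 : mholb f c r -> nm (y0 - c) < r -> exists d s K : R,
  [/\ 0 < d, 0 < s, 0 < K & forall y, nm (y - y0) < d -> forall w : C, mx w < s ->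
     nm (dq (fun t : C => f (y + t *: v)) 0 w - Dv v f y) <= K * nm w].
Proof.
move=> hf hy0; have [d [M [d0 M0 hd]]] := mhol_bounded hf hy0.
have v1 : 0 < nm v + 1 by rewrite ltr_wpDl ?nm_ge0.
pose s := d / (8 * (nm v + 1)).
have s0 : 0 < s by rewrite divr_gt0// mulr_gt0.
have sE : s * (nm v + 1) <= d / 8.
  by rewrite le_eqVlt; apply/orP; left; apply/eqP; rewrite /s; field; rewrite gt_eqF.
exists (d / 2), s, (4 * M / (s * s)); split => //; first by rewrite divr_gt0.
  by apply: divr_gt0; apply: mulr_gt0.
move=> y hy w hw.
have hh (t : C) : mx (t - 0) <= s -> hol (fun t => f (y + t *: v)) t /\ nm (f (y + t *: v)) <= M.
  rewrite subr0 => ht; have [h1 h2] := hd _ (nm_shift hy ht sE).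
  by split => //; exact: mhol_line.
have [_ h] := @cauchy_der R (fun t => f (y + t *: v)) 0 s M s0 (fun z hz => (hh z hz).1)
  (fun z hz => (hh z hz).2).
by have := h w; rewrite subr0 => /(_ hw).
Qed.

Lemma line_cont_at (x u : V) (t0 : C) : {for t0, continuous (fun t : C => x + t *: u)}.
Proof.
apply/contP => e e0; have u1 : 0 < nm u + 1 by rewrite ltr_wpDl ?nm_ge0.
exists (e / (nm u + 1)); first by rewrite divr_gt0.
move=> t; rewrite opprD addrACA subrr add0r -scalerBl nmZ ltr_pdivlMr// => h.
by apply: le_lt_trans h; apply: ler_wpM2l; [exact: nm_ge0|rewrite lerDl].
Qed.
Lemma line_cont (x u : V) : {for (0 : C), continuous (fun t : C => x + t *: u)}.
Proof. exact: line_cont_at. Qed.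
Arguments line_cont_at : clear implicits.
Arguments line_cont : clear implicits.

(** The first order expansion of F along the graph of sg over a line. As q 0 is the
    derivative of F along v, this serves both for the chain rule and for the implicit
    function theorem. *)
Lemma curve_expand F y2 u v r (sg : V -> C) : mholb F (y2 + sg y2 *: v) r -> 0 < r ->
  {for (0 : C), continuous (fun t : C => sg (y2 + t *: u))} ->
  exists kap q : C -> C, [/\ {for 0, continuous kap}, {for 0, continuous q},
    q 0 = Dv v F (y2 + sg y2 *: v) &
    forall t : C, F (y2 + t *: u + sg (y2 + t *: u) *: v) =
      F (y2 + sg y2 *: v) + t * kap t + (sg (y2 + t *: u) - sg y2) * q t].
Proof.
move=> hF r0 csl; set s2 := sg y2; set w2 := y2 + s2 *: v in hF *.
have w20 : nm (w2 - w2) < r by rewrite subrr nm0.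
have [d [s [K [d0 s0 K0 hq]]]] := dq_unif v hF w20.
have [_ /(_ u) hu] := hF w2 w20.
pose kap := dq (fun t : C => F (w2 + t *: u)) 0.
have ckap : {for 0, continuous kap} by exact: hol_dq_cont.
pose q (t : C) := dq (fun z : C => F (w2 + t *: u + z *: v)) 0 (sg (y2 + t *: u) - s2).
have cD : {for (0 : C), continuous (fun t : C => Dv v F (w2 + t *: u))}.
  apply: continuous_comp (line_cont w2 u) _; have [cD _] := mholb_D v hF w20.
  by rewrite /prop_for /continuous_at scale0r addr0; exact: cD.
have q0 : q 0 = Dv v F w2 by rewrite /q !scale0r !addr0 subrr /dq eqxx.
have cq : {for 0, continuous q}.
  apply/contP => e e0; have e2 : 0 < e / 2 by rewrite divr_gt0.
  have [d1 d10 h1] := (contP _ _).1 cD _ e2.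
  have m0 : 0 < Num.min s (e / (2 * K)) by rewrite lt_min s0 divr_gt0// mulr_gt0.
  have [d2 d20 h2] := (contP _ _).1 csl _ m0.
  have [d3 d30 h3] := (contP _ _).1 (line_cont w2 u) _ d0.
  exists (Num.min d1 (Num.min d2 d3)); first by rewrite !lt_min d10 d20.
  move=> t; rewrite !lt_min => /and3P[/h1 t1 /h2 t2 /h3 t3].
  rewrite q0; rewrite scale0r addr0 in t1; rewrite scale0r addr0 in t2; rewrite scale0r addr0 in t3.
  move: t2; rewrite lt_min => /andP[t2 t2'].
  have t2m : mx (sg (y2 + t *: u) - s2) < s by apply: le_lt_trans t2; exact: mx_nm.
  have := hq _ t3 (sg (y2 + t *: u) - s2) t2m.
  rewrite -/(q t) => t4.
  apply: le_lt_trans (nm_tri _ (Dv v F (w2 + t *: u)) _) _.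
  rewrite (splitr e); apply: ltrD; last exact: t1.
  apply: le_lt_trans t4 _.
  rewrite mulrC -ltr_pdivlMr//; apply: lt_le_trans t2' _.
  by rewrite le_eqVlt; apply/orP; left; apply/eqP; field; rewrite gt_eqF.
exists kap, q; split => // t.
have e1 : F (w2 + t *: u) = F w2 + t * kap t.
  by have := dqE (fun t : C => F (w2 + t *: u)) 0 t; rewrite scale0r addr0 subr0.
have e2 := dqE (fun z : C => F (w2 + t *: u + z *: v)) 0 (sg (y2 + t *: u) - s2).
rewrite -/(q t) subr0 scale0r addr0 e1 in e2.
rewrite -e2; congr F.
have comb (a b c k : V) : a + b + c + (k - b) = a + c + k.
  by rewrite [a + b + c]addrAC -[LHS]addrA [b + (k - b)]addrC subrK.
by rewrite scalerBl /w2 comb.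
Qed.

Lemma mhol_curve F y2 u v r (sg : V -> C) : mholb F (y2 + sg y2 *: v) r -> 0 < r ->
  hol (fun t : C => sg (y2 + t *: u)) 0 ->
  hol (fun t : C => F (y2 + t *: u + sg (y2 + t *: u) *: v)) 0.
Proof.
move=> hF r0 hsg; have csl := hol_cont hsg.
have [kap [q [ckap cq _ E]]] := curve_expand hF r0 csl.
have [g cg gE] := hsg.
apply: (@hol_near_ex _ _ _ (fun t => kap t + g t * q t)).
  exact: (contD ckap (contM cg cq)).
apply: filterE => t; rewrite E (gE t) !scale0r !addr0 subr0 [_ + _ - sg y2]addrAC subrr add0r.
by rewrite mulrDr mulrA addrA.
Qed.

(** At a simple zero the coefficient q of the expansion is invertible, and the vanishing
    of F along the graph can be solved for the increment of sg. *)
Lemma implicit F y2 u v r (sg : V -> C) : 0 < r -> mholb F (y2 + sg y2 *: v) r ->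
  {for y2, continuous sg} -> (\forall y \near y2, F (y + sg y *: v) = 0) ->
  Dv v F (y2 + sg y2 *: v) != 0 -> hol (fun t : C => sg (y2 + t *: u)) 0.
Proof.
move=> r0 hF csg F0 D0.
have csl : {for (0 : C), continuous (fun t : C => sg (y2 + t *: u))}.
  apply: continuous_comp (line_cont y2 u) _.
  by rewrite /prop_for /continuous_at scale0r addr0; exact: csg.
have [kap [q [ckap cq q0 E]]] := curve_expand hF r0 csl.
have q00 : q 0 != 0 by rewrite q0.
apply: (@hol_near_ex _ _ _ (fun t => - kap t * (q t)^-1)).
  exact: (contM (contN ckap) (contV cq q00)).
have F2 : F (y2 + sg y2 *: v) = 0 by have := nbhs_singleton F0.
have near1 : \forall t \near (0 : C), F (y2 + t *: u + sg (y2 + t *: u) *: v) = 0.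
  have h : nbhs (y2 + (0 : C) *: u) [set y | F (y + sg y *: v) = 0] by rewrite scale0r addr0.
  exact: (line_cont y2 u _ h).
apply: filterS (filterI near1 (cont_neq0 cq q00)) => t [Ft qt].
rewrite subr0 scale0r addr0.
have := E t; rewrite Ft F2 add0r => e2.
have -> : sg (y2 + t *: u) = sg y2 + (sg (y2 + t *: u) - sg y2) by rewrite [sg y2 + _]addrC subrK.
congr (_ + _).
have : (sg (y2 + t *: u) - sg y2) * q t = - (t * kap t) by apply/eqP; rewrite -addr_eq0 addrC -e2.
by move=> /(canRL (mulfK qt)) ->; ring.
Qed.

Lemma der_uniq_near (f g : C -> C) z : {for z, continuous g} ->
  (\forall w \near z, f w = f z + (w - z) * g w) -> der f z = g z.
Proof.
move=> cg fE.
(* gg is g corrected so that the identity holds everywhere *)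
pose gg w := if w == z then g z else (f w - f z) / (w - z).
have cgg : {for z, continuous gg}.
  apply: (cont_near _ cg); apply: filterS fE => w fE; rewrite /gg; case: eqVneq => [->//|wz].
  by rewrite fE addrAC subrr add0r mulrAC divff ?mul1r// subr_eq0.
have eg w : f w = f z + (w - z) * gg w.
  rewrite /gg; case: eqVneq => [->|wz]; first by rewrite subrr mul0r addr0.
  by rewrite mulrCA divff ?subr_eq0// mulr1 addrC subrK.
by rewrite (der_uniq cgg eg) /gg eqxx.
Qed.

Lemma der_shift (h : C -> C) (y : C) : hol h y -> der (fun t => h (y + t)) 0 = der h y.
Proof.
move=> hy; have ca : {for (0 : C), continuous (fun t : C => y + t)} :=
  contD (cont_cst y (0 : C)) (cont_id (0 : C)).
have cg : {for (0 : C), continuous (fun t => dq h y (y + t))}.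
  by apply: (continuous_comp ca); rewrite addr0; exact: hol_dq_cont.
have eg w : h (y + w) = h (y + 0) + (w - 0) * dq h y (y + w).
  by rewrite {1}(dqE h y (y + w)) addr0 subr0 [y + w - y]addrAC subrr add0r.
by rewrite (@der_uniq R (fun t => h (y + t)) _ 0 cg eg) addr0 /dq eqxx.
Qed.

Lemma hol_der (h : C -> C) a : (\forall z \near a, hol h z) -> hol (der h) a.
Proof.
move=> /nbhs_nm[r r0 hr].
have g : @mholb R C h a r.
  move=> y hy0; have hy := hr y hy0; split; first exact: (hol_cont hy).
  move=> w; have hl : hol (fun t : C => y + t * w) 0.
    by apply: holD; [exact: hol_cst|apply: holM; [exact: hol_id|exact: hol_cst]].
  by apply: (hol_comp hl); rewrite mul0r addr0.
have aa : nm (a - a) < r by rewrite subrr nm0.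
have [_ h1] := mholb_D (1 : C) g aa.
have eqn : \forall t \near (0 : C), der h (a + t) = @Dv R C (1 : C) h (a + t *: (1 : C)).
  apply/nbhs_nm; exists r; first exact: r0.
  move=> t; rewrite subr0 => ht.
  have hat : hol h (a + t) by apply: hr; rewrite addrAC subrr add0r.
  have sc1 (k : C) : k *: (1 : C) = k by exact: mulr1.
  have e1 := der_shift hat.
  rewrite /Dv sc1.
  have -> : (fun z : C => h (a + t + z *: (1 : C))) = (fun z => h (a + t + z)).
    by apply/funext => z; rewrite sc1.
  exact (esym e1).
have h2' := hol_near eqn (h1 (1 : C)).
have h2 : hol (fun t : C => der h (a + t)) (a - a) by rewrite subrr.
apply: (hol_near _ (hol_comp (hol_subc a a) h2)).
by apply: filterE => w; rewrite addrC subrK.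
Qed.

Lemma order_drop f x v r (j : nat) (h : C -> C) : 0 < r -> mholb f x r ->
  (\forall z \near (0 : C), hol h z) -> h 0 != 0 ->
  (\forall z \near (0 : C), f (x + z *: v) = z ^+ j.+1 * h z) ->
  exists h', [/\ \forall z \near (0 : C), hol h' z, h' 0 != 0 &
    \forall z \near (0 : C), Dv v f (x + z *: v) = z ^+ j * h' z].
Proof.
move=> r0 hf hh h0 fE.
exists (fun z => j.+1%:R * h z + z * der h z); split.
- have /nbhs_nm[r1 r10 hr] := hh.
  have h1 : nm (0 - 0 : C) < r1 by rewrite subrr nm0.
  apply: filterS (ball_near h1) => z hz.
  have hd : hol (der h) z.
    by apply: hol_der; apply: filterS (ball_near hz) => w; exact: hr.
  by apply: holD; apply: holM => //; [exact: hol_cst|exact: hr|exact: hol_id].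
- by rewrite mul0r addr0 mulf_neq0// pnatr_eq0.
have [r1 r10 hr] := (nbhs_nm _ _).1 (filterI hh fE).
apply/nbhs_nm; exists r1 => // z hz.
have [hz1 _] := hr z hz.
have fEz (w : C) : nm w < r1 - nm z -> f (x + z *: v + w *: v) = (z + w) ^+ j.+1 * h (z + w).
  rewrite subr0 in hz => hw; rewrite -addrA -scalerDl; apply: (hr (z + w) _).2; rewrite subr0.
  by apply: le_lt_trans (nmD _ _) _; rewrite -ltrBrDl.
have p1 : 0 < r1 - nm z by rewrite subr_gt0 -[z]subr0.
have chz : {for (0 : C), continuous (fun w : C => z + w)}.
  exact: (contD (cont_cst z 0) (cont_id (0 : C))).
have hcomp : hol (fun w : C => h (z + w)) 0.
  have hl : hol (fun w : C => z + w) 0 by apply: holD; [exact: hol_cst|exact: hol_id].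
  by apply: (hol_comp hl); rewrite addr0.
pose P (w : C) := \sum_(i < j.+1) (z + w) ^+ (j - i) * z ^+ i.
have PE (w : C) : (z + w) ^+ j.+1 - z ^+ j.+1 = w * P w.
  by rewrite subrXX addrAC subrr add0r.
have cP : {for (0 : C), continuous P}.
  apply/hol_cont/hol_sum => i; apply: holM; last exact: hol_cst.
  by apply: holX; apply: holD; [exact: hol_cst|exact: hol_id].
have P0 : P 0 = j.+1%:R * z ^+ j.
  rewrite /P addr0 (eq_bigr (fun=> z ^+ j)); last first.
    by move=> i _; rewrite -exprD subnK// -ltnS.
  by rewrite sumr_const card_ord mulr_natl.
have e0 : f (x + z *: v + 0 *: v) = z ^+ j.+1 * h z by rewrite fEz ?nm0// addr0.
pose g w := P w * h z + (z + w) ^+ j.+1 * dq h z (z + w).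
have -> : Dv v f (x + z *: v) = g 0.
  apply: (@der_uniq_near _ g).
    apply: (contD (contM cP (cont_cst (h z) (0 : C)))).
    apply: (contM (contX j.+1 chz)); apply: (continuous_comp chz).
    by rewrite addr0; apply: hol_dq_cont.
  apply: filterS (near_nm (0 : C) p1) => w; rewrite subr0 => hw.
  rewrite fEz// e0 /g {1}(dqE h z (z + w)) addrAC subrr add0r.
  rewrite mulrDr [w * (_ + _)]mulrDr [w * (P w * _)]mulrA -PE; ring.
by rewrite /g addr0 P0 /dq eqxx exprS; move: (j.+1%:R : C) (z ^+ j) (h z) (der h z) => *; ring.
Qed.

End Sheets.

Arguments line_cont {R V} x u.
Arguments line_cont_at {R V} x u t0.

Section SheetHol.
Variable R : realType.
Local Notation C := (Cx R).
Variable V : normedModType C.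
Implicit Types (f F : V -> C) (x y u v c w : V) (r : R).

Lemma mholb_shrink f c r w : mholb f c r -> nm (w - c) < r -> mholb f w (r - nm (w - c)).
Proof.
move=> hf hw y hy; apply: hf; apply: le_lt_trans (nm_tri _ w _) _.
by rewrite -ltrBrDr.
Qed.

Lemma mholb_iterD f c r v i : mholb f c r -> mholb (iter i (Dv v) f) c r.
Proof. by move=> hf; elim: i => //= i IH; exact: mholb_D. Qed.

Lemma iter_drop f x v r (m : nat) (h : C -> C) : 0 < r -> mholb f x r ->
  (\forall z \near (0 : C), hol h z) -> h 0 != 0 ->
  (\forall z \near (0 : C), f (x + z *: v) = z ^+ m * h z) ->
  forall i, (i <= m)%N -> exists h', [/\ \forall z \near (0 : C), hol h' z, h' 0 != 0 &
    \forall z \near (0 : C), iter i (Dv v) f (x + z *: v) = z ^+ (m - i) * h' z].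
Proof.
move=> r0 hf hh h0 fE; elim=> [|i IH] im; first by exists h; rewrite subn0.
have [h1 [a1 a2 a3]] := IH (ltnW im).
rewrite -(prednK (_ : 0 < m - i)%N) ?subn_gt0// in a3.
have [h2 [b1 b2 b3]] := order_drop r0 (mholb_iterD v i hf) a1 a2 a3.
by exists h2; split=> //; rewrite subnS.
Qed.

Lemma near_transl (w : V) y (P : set V) :
  (\forall x \near y + w, P x) -> \forall x \near y, P (x + w).
Proof.
move=> /nbhs_nm[e e0 he]; apply/nbhs_nm; exists e => // x hx.
by apply: he; rewrite opprD addrACA subrr addr0.
Qed.

(** By the two multiplicity estimates the order m + 1 of the unique zero sg y is locally
    constant. Hence sg y is a simple zero of the m-th derivative of f along v, to which
    the implicit function theorem applies. *)
Lemma sheet_hol f c r v y1 rho (z1 : C) e0 (sg : V -> C) : mholb f c r -> 0 < rho ->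
  (forall y z, nm (y - y1) < rho -> mx (z - z1) < e0 -> nm (y + z *: v - c) < r) ->
  (forall y, nm (y - y1) < rho -> [/\ mx (sg y - z1) < e0, f (y + sg y *: v) = 0 &
     forall z, mx (z - z1) < e0 -> f (y + z *: v) = 0 -> z = sg y]) ->
  forall y2, nm (y2 - y1) < rho ->
    {for y2, continuous sg} /\ forall u, hol (fun t : C => sg (y2 + t *: u)) 0.
Proof.
move=> hf rho0 dom hsg y2 hy2.
(* the order is finite, as sg y is the only zero near z1, and it is positive *)
have ord y : nm (y - y1) < rho -> exists m g rr, [/\ 0 < rr, rr = e0 - mx (sg y - z1),
    holb g 0 rr, g 0 != 0 & (forall z : C, f (y + sg y *: v + z *: v) = z ^+ m.+1 * g z)].
  move=> hy; have [a1 a2 a3] := hsg y hy.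
  pose rr := e0 - mx (sg y - z1); have rr0 : 0 < rr by rewrite subr_gt0.
  have inr (z : C) : nm z < rr -> mx (sg y + z - z1) < e0.
    move=> hz; rewrite addrAC; apply: le_lt_trans (mxD _ _) _.
    by rewrite -ltrBrDl; apply: le_lt_trans (mx_nm z) _.
  have hh : holb (fun z : C => f (y + sg y *: v + z *: v)) 0 rr.
    move=> z; rewrite subr0 => hz; apply: mhol_line; apply: hf.
    by rewrite -(addrA y) -scalerDl; apply: dom => //; exact: inr.
  have [hz|[m [g [g1 g2 g3]]]] := finite_order rr0 hh.
    have p0 : 0 < rr / 4 by rewrite divr_gt0.
    have nq : nm (ofR (rr / 4) : C) = rr / 4 by rewrite nm_ofR ger0_norm// ltW.
    have := a3 (sg y + ofR (rr / 4)); rewrite scalerDl addrA hz; last by rewrite subr0 nq; lra.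
    have -> : mx (sg y + ofR (rr / 4) - z1) < e0 by apply: inr; rewrite nq; lra.
    move=> /(_ isT erefl) /eqP; rewrite -subr_eq0 addrAC subrr add0r => /eqP h.
    by move: p0; rewrite -nq h nm0 ltxx.
  case: m g3 => [|m] g3.
    have := g3 0; rewrite scale0r addr0 a2 expr0 mul1r => /esym/eqP.
    by rewrite (negbTE g2).
  by exists m, g, rr; split => // z; rewrite g3 subr0.
have [a1 a2 a3] := hsg y2 hy2.
have [m [g [rr [rr0 rrE hg g0 fE]]]] := ord y2 hy2.
set w2 := y2 + sg y2 *: v in fE.
have hw2 : nm (w2 - c) < r by exact: dom.
have hf2 := mholb_shrink hf hw2.
have r20 : 0 < r - nm (w2 - c) by rewrite subr_gt0.
have [s [c0 [c1 [M [s1 B]]]]] := box_exists r20 hf2 rr0 hg g0 fE (divr_gt0 rr0 (ltr0n _ 4)).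
have s0 := box_s B.
have inr (z : C) : mx z <= s -> mx (sg y2 + z - z1) < e0.
  move=> hz; rewrite addrAC; apply: le_lt_trans (mxD _ _) _.
  by rewrite -ltrBrDl -rrE; lra.
have fw2 : f w2 = 0 by [].
have inball : \forall y \near y2, nm (y - y1) < rho by exact: ball_near.
have csg : {for y2, continuous sg}.
  apply/contP => e ee0.
  pose e' := Num.min (e / 2) s.
  have e'0 : 0 < e' by rewrite lt_min s0 divr_gt0.
  have [e'1 e'2] : e' <= e / 2 /\ e' <= s by rewrite /e' !ge_min !lexx ?orbT.
  have hz := near_transl (hurwitz B e'0 e'2 fw2).
  have [d d0 hd] := (nbhs_nm _ _).1 (filterI inball hz).
  exists d => // y hy; have [yb [z mz fz]] := hd y hy.
  have [b1 b2 b3] := hsg y yb.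
  have -> : sg y = sg y2 + z.
    apply/esym/b3; first by apply: inr; rewrite (le_trans (ltW mz)).
    by rewrite scalerDl addrA.
  rewrite addrAC subrr add0r; apply: le_lt_trans (nm_mx z) _; lra.
split => // u.
have nup := near_transl (mult_upper B).
have nlo := near_transl (mult_lower B).
have nsg : \forall y \near y2, nm (sg y - sg y2) < s.
  have [d d0 hd] := (contP _ _).1 csg _ s0.
  by apply/nbhs_nm; exists d.
apply: (@implicit R V (iter m (Dv v) f) y2 u v (r - nm (w2 - c)) sg r20 (mholb_iterD v m hf2) csg).
- near=> y.
  have yb : nm (y - y1) < rho by near: y.
  have [b1 b2 b3] := hsg y yb.
  have [m' [g' [rr' [rr'0 rr'E hg' g'0 fE']]]] := ord y yb.
  have nl : nm (sg y - sg y2) < s by near: y.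
  set l := sg y - sg y2 in nl.
  have ml : mx l <= s by apply: le_trans (mx_nm _) _; exact: ltW.
  have eqf (z : C) : f (y + sg y2 *: v + z *: v) = (z - l) ^+ m'.+1 * g' (z - l).
    rewrite -fE' -!addrA -!scalerDl; congr (f (_ + _ *: _)).
    by rewrite /l; ring.
  have hh (z : C) : mx z <= s -> hol (fun z => g' (z - l)) z /\ g' (z - l) != 0.
    move=> hz; have [->|zl] := eqVneq z l.
      rewrite subrr; split => //; apply: (hol_comp (hol_subc l l)).
      by apply: hg'; rewrite !subrr nm0.
    have fz0 : f (y + sg y2 *: v + z *: v) != 0.
      apply: contraNneq zl; rewrite -(addrA y) -scalerDl => /(b3 _ (inr z hz)) e.
      by rewrite /l -e [sg y2 + z]addrC addrK.
    have zl0 : z - l != 0 by rewrite subr_eq0.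
    have zlp : (z - l) ^+ m'.+1 != 0 by rewrite expf_neq0.
    split; last by apply: contraNneq fz0 => h; rewrite eqf h mulr0.
    have hfz : hol (fun z : C => f (y + sg y2 *: v + z *: v)) z.
      apply: mhol_line; apply: hf; rewrite -(addrA y) -scalerDl.
      by apply: dom => //; exact: inr.
    apply: (hol_near _ (holM hfz (holV (@holX _ _ m'.+1 _ (hol_subc l z)) zlp))).
    apply: filterS (neq_near zl) => t tl.
    by rewrite eqf mulrAC divff ?mul1r// expf_neq0// subr_eq0.
  have le1 : (m'.+1 <= m.+1)%N.
    have nup' : forall (L : seq C) (h : C -> C),
      (forall l, l \in L -> mx l <= s) -> (forall z, mx z <= s -> hol h z) ->
      (forall z, mx z <= s -> f (y + sg y2 *: v + z *: v) = \prod_(l <- L) (z - l) * h z) ->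
      (size L <= m.+1)%N by near: y.
    rewrite -[m'.+1](size_nseq _ l); apply: (nup' _ (fun z => g' (z - l))).
    - by move=> k; rewrite mem_nseq => /= /eqP ->.
    - by move=> z /hh[].
    - by move=> z _; rewrite eqf big_nseq iter_mulr_1.
  have le2 : (m.+1 <= m'.+1)%N.
    have nlo' : forall (l : C) (j : nat) (h : C -> C), mx l <= s ->
      (forall z, mx z <= s -> hol h z /\ h z != 0) ->
      (forall z, mx z <= s -> f (y + sg y2 *: v + z *: v) = (z - l) ^+ j * h z) ->
      (0 < j)%N -> (m.+1 <= j)%N by near: y.
    exact: (nlo' l m'.+1 (fun z => g' (z - l))).
  have mm : m' = m by apply/eqP; rewrite eqn_leq -ltnS le1 -ltnS le2.
  rewrite mm in fE'.
  have yc : nm (y + sg y *: v - c) < r by exact: dom.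
  have yc0 : 0 < r - nm (y + sg y *: v - c) by rewrite subr_gt0.
  have n1 : \forall z \near (0 : C), hol g' z by apply/nbhs_nm; exists rr'.
  have n2 : \forall z \near (0 : C), f (y + sg y *: v + z *: v) = z ^+ m.+1 * g' z.
    by apply: filterE.
  have [h' [_ _ /nbhs_singleton]] := iter_drop yc0 (mholb_shrink hf yc) n1 g'0 n2 (leqnSn m).
  by rewrite scale0r addr0 subSn// subnn expr1 mul0r.
- have n1 : \forall z \near (0 : C), hol g z by apply/nbhs_nm; exists rr.
  have n2 : \forall z \near (0 : C), f (w2 + z *: v) = z ^+ m.+1 * g z by apply: filterE.
  have [h' [_ h0 /nbhs_singleton]] := iter_drop r20 hf2 n1 g0 n2 (leqnn m.+1).
  by rewrite scale0r addr0 subnn expr0 mul1r /= -/w2 => ->.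
Unshelve. all: end_near. Qed.

End SheetHol.

(** * Fibers of the zero set over a ball *)

Section ZeroLists.
Variable R : realType.
Local Notation C := (Cx R).
Variable V : normedModType C.
Implicit Types (f : V -> C) (x y u v c p w : V) (r s rho : R) (z : C).

Lemma factor_zeros (phi : C -> C) s (L : seq C) : (forall z, mx z <= s -> hol phi z) -> uniq L ->
  (forall l, l \in L -> mx l < s /\ phi l = 0) ->
  exists2 h, (forall z, mx z <= s -> hol h z) & forall z, phi z = \prod_(l <- L) (z - l) * h z.
Proof.
move=> hphi; elim: L => [|l L IH] /=.
  by move=> _ _; exists phi => // z; rewrite big_nil mul1r.
move=> /andP[lL uL] hL.
have [|h hh hE] := IH uL; first by move=> k kL; apply: hL; rewrite inE kL orbT.
have [ls pl] := hL l (mem_head _ _).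
have hl : h l = 0.
  have := hE l; rewrite pl => /esym/eqP; rewrite mulf_eq0 => /orP[|/eqP//].
  by rewrite prodf_seq_eq0 => /hasP[k kL /=]; rewrite subr_eq0 => /eqP e; rewrite e kL in lL.
exists (dq h l).
  move=> z hz; have [->|zl] := eqVneq z l; last by apply: hol_dq_off => //; exact: hh.
  apply: hol_dq; apply/nbhs_nm; exists (s - mx l); first by rewrite subr_gt0.
  move=> w hw; apply: hh; rewrite -(subrK l w).
  by apply: (le_trans (mxD _ _)); rewrite -lerBrDr (le_trans (mx_nm _)) ?ltW.
by move=> z; rewrite hE big_cons {1}(dqE h l z) hl add0r mulrA [(z - l) * _]mulrC.
Qed.

Lemma fin_min (T : eqType) (L : seq T) (phi : T -> R) : (forall l, l \in L -> 0 < phi l) ->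
  exists2 e : R, 0 < e & forall l, l \in L -> e <= phi l.
Proof.
elim: L => [|l L IH] hL; first by exists 1.
have [|e e0 he] := IH; first by move=> k kL; apply: hL; rewrite inE kL orbT.
exists (Num.min e (phi l)); first by rewrite lt_min e0 hL// mem_head.
move=> k; rewrite inE => /predU1P[->|/he]; first by rewrite ge_min lexx orbT.
by move=> h; rewrite ge_min h.
Qed.

Lemma near_all (T : topologicalType) (I : eqType) (L : seq I) (P : I -> T -> Prop) (x : T) :
  (forall i, i \in L -> \forall y \near x, P i y) -> \forall y \near x, forall i, i \in L -> P i y.
Proof.
elim: L => [|i L IH] h; first by apply: filterE.
have h1 : \forall y \near x, P i y by apply: h; rewrite mem_head.
have h2 : \forall y \near x, forall i, i \in L -> P i y.
  by apply: IH => j jL; apply: h; rewrite inE jL orbT.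
apply: filterS (filterI h1 h2) => y [a b] j; rewrite inE => /predU1P[->//|].
exact: b.
Qed.

(** The setting of Weierstrass' preparation theorem: for y in the ball of radius rho, z
    -> f (y + z v) has at most m zeros in the square of radius s, and none on its
    boundary. *)
Record weierstrass f c r v p s rho (m : nat) : Prop := Weier {
  w_s : 0 < s; w_rho : 0 < rho; w_f : mholb f c r;
  w_dom : forall y z, nm (y - p) < rho -> mx z <= s -> nm (y + z *: v - c) < r;
  w_bd : forall y z, nm (y - p) < rho -> mx z = s -> f (y + z *: v) != 0;
  w_cnt : forall y (L : seq C), nm (y - p) < rho -> uniq L ->
    (forall l, l \in L -> mx l <= s /\ f (y + l *: v) = 0) -> (size L <= m)%N }.

Lemma box_nz f p r v : 0 < r -> mholb f p r ->
  (forall e : R, 0 < e -> exists2 z : C, nm z < e & f (p + z *: v) != 0) ->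
  forall e0 : R, 0 < e0 -> exists m s (c0 c1 M : R), s <= e0 /\ box f p v m s c0 c1 M.
Proof.
move=> r0 hf nz e0 e00.
have v1 : 0 < nm v + 1 by rewrite ltr_wpDl ?nm_ge0.
pose r1 := r / (nm v + 1).
have r10 : 0 < r1 by rewrite divr_gt0.
have hh : holb (fun z : C => f (p + z *: v)) 0 r1.
  move=> z; rewrite subr0 => hz; apply: mhol_line; apply: hf.
  rewrite addrAC subrr add0r nmZ; move: hz; rewrite ltr_pdivlMr//; apply: le_lt_trans.
  by apply: ler_wpM2l; [exact: nm_ge0|rewrite lerDl].
have [hz|[m [g [g1 g2 g3]]]] := finite_order r10 hh.
  have [z hz1] := nz _ (divr_gt0 r10 (ltr0n _ 2)).
  by rewrite hz ?eqxx// subr0.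
have g3' z : f (p + z *: v) = z ^+ m * g z by rewrite g3 subr0.
by exists m; apply: (box_exists r0 hf r10 g1 g2 g3' e00).
Qed.

(** The boundary condition on the line through p persists on nearby lines by
    compactness, and the order of the zero at p bounds the number of zeros. *)
Lemma weierstrass_exists f p r v : 0 < r -> mholb f p r ->
  (forall e : R, 0 < e -> exists2 z : C, nm z < e & f (p + z *: v) != 0) ->
  forall e0 : R, 0 < e0 -> exists s rho m, [/\ s <= e0, weierstrass f p r v p s rho m &
    forall z, mx z <= s -> f (p + z *: v) = 0 -> z = 0].
Proof.
move=> r0 hf nz e0 e00.
have v1 : 0 < nm v + 1 by rewrite ltr_wpDl ?nm_ge0.
have e1 : 0 < Num.min e0 (r / (8 * (nm v + 1))) by rewrite lt_min e00 divr_gt0// mulr_gt0.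
have [m [s [c0 [c1 [M [s1 B]]]]]] := box_nz r0 hf nz e1.
have s0 := box_s B.
have [s2 s3] : s <= e0 /\ s <= r / (8 * (nm v + 1)) by move: s1; rewrite le_min => /andP.
have [ms ms0 hfar] := box_far B s0.
have r2 : 0 < r / 2 by rewrite divr_gt0.
have [rho rho0 hrho] := (nbhs_nm _ _).1 (filterI (near_nm p r2) (filterI hfar (mult_upper B))).
have dom y z : nm (y - p) < rho -> mx z <= s -> nm (y + z *: v - p) < r.
  move=> hy hz; apply: (nm_shift (hrho y hy).1 hz).
  by move: s3; rewrite ler_pdivlMr ?mulr_gt0//; lra.
have bd y z : nm (y - p) < rho -> mx z = s -> f (y + z *: v) != 0.
  move=> hy hz; have [_ [h _]] := hrho y hy.
  by rewrite -nm_gt0 (lt_le_trans ms0)// h// hz lexx.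
exists s, rho, m; split => //; last first.
  move=> z hz fz; have := box_lo B hz; rewrite fz nm0 => h; apply: nm_eq0; apply/eqP.
  have := le_trans h (lexx 0); rewrite pmulr_rle0 ?(box_c0 B)// => h'.
  rewrite eq_le nm_ge0 andbT leNgt; apply/negP => n0.
  by move: h'; rewrite leNgt exprn_gt0.
split => // y L hy uL hL.
have [_ [_ h]] := hrho y hy.
have hphi z : mx z <= s -> hol (fun z => f (y + z *: v)) z.
  by move=> hz; apply: mhol_line; apply: hf; exact: dom.
have [|h' h1 h2] := factor_zeros hphi uL.
  move=> l lL; have [l1 l2] := hL l lL; split => //.
  by rewrite lt_neqAle l1 andbT; apply/eqP => e; have := bd y l hy e; rewrite l2 eqxx.
by apply: (h L h') => // l /hL[].
Qed.

Definition is_zero f v s y z := mx z <= s /\ f (y + z *: v) = 0.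
(** Chosen by xget among the enumerations of the zeros in the square of radius s; over
    the ball of a Weierstrass setting such an enumeration exists, since the number of
    zeros is bounded. *)
Definition zero_list f v s y : seq C := xget [::] [set L : seq C | uniq L /\ forall z, z \in L <-> is_zero f v s y z].

Section Weier.
Variables (f : V -> C) (c : V) (r : R) (v p : V) (s rho : R) (m : nat).
Hypothesis W : weierstrass f c r v p s rho m.
Let Z := zero_list f v s.

Lemma zero_listP y : nm (y - p) < rho -> uniq (Z y) /\ forall z, z \in Z y <-> is_zero f v s y z.
Proof.
move=> hy.
pose P n := `[< exists L : seq C, [/\ uniq L, size L = n & forall z, z \in L -> is_zero f v s y z] >].
have P0 : exists n, P n by exists 0%N; apply/asboolP; exists [::].
have Pm n : P n -> (n <= m)%N.
  by move=> /asboolP[L [uL <- hL]]; apply: (w_cnt W hy uL).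
case: (ex_maxnP P0 Pm) => n /asboolP[L [uL sL hL]] hn.
suff hex : exists L : seq C, uniq L /\ forall z, z \in L <-> is_zero f v s y z.
  exact: (@xgetPex _ [::] [set L : seq C | uniq L /\ forall z, z \in L <-> is_zero f v s y z]).
exists L; split => // z; split; first exact: hL.
move=> hz; apply: contrapT => /negP zL.
have /hn : P n.+1.
  apply/asboolP; exists (z :: L); split => //=; [by rewrite zL|by rewrite sL|].
  by move=> w; rewrite inE => /predU1P[->|/hL].
by rewrite ltnn.
Qed.

Lemma mem_zero_list y z : nm (y - p) < rho -> (z \in Z y) <-> is_zero f v s y z.
Proof. by move=> /zero_listP[_]. Qed.
Lemma zero_list_uniq y : nm (y - p) < rho -> uniq (Z y).
Proof. by move=> /zero_listP[]. Qed.
Lemma zero_list_lt y z : nm (y - p) < rho -> z \in Z y -> mx z < s.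
Proof.
move=> hy /(mem_zero_list _ hy)[h1 h2]; rewrite lt_neqAle h1 andbT; apply/eqP => e.
by have := w_bd W hy e; rewrite h2 eqxx.
Qed.

Let phol y z : nm (y - p) < rho -> mx z <= s -> mhol f (y + z *: v).
Proof. by move=> hy hz; apply: (w_f W); exact: (w_dom W). Qed.

Lemma zero_list_confine y1 (e : R) : nm (y1 - p) < rho -> 0 < e ->
  \forall y \near y1, forall z, z \in Z y -> exists2 l, l \in Z y1 & mx (z - l) < e.
Proof.
move=> hy1 e0.
pose K := [set z : C | mx z <= s /\ forall l, l \in Z y1 -> e <= mx (z - l)].
have cK : compact K.
  apply: (subclosed_compact _ (@compact_sq R 0 s)); last by move=> z [] /=; rewrite subr0.
  rewrite (_ : K = [set z | mx z <= s] `&` \bigcap_(l in [set l | l \in Z y1]) [set z | e <= mx (z - l)]).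
    apply: closedI.
      by have -> : [set z : C | mx z <= s] = [set z | mx (z - 0) <= s];
        [apply/seteqP; split => z /=; rewrite subr0|exact: compact_closed (@norm_hausdorff _ _) (@compact_sq R 0 s)].
    apply: closed_bigI => l _.
    have -> : [set z : C | e <= mx (z - l)] = (fun z => z - l) @^-1` [set z | e <= mx z] by [].
    by apply: closed_comp; [move=> z _; exact/hol_cont/hol_subc|exact: mx_closed_ge].
  by apply/seteqP; split => z [h1 h2].
have cf z : K z -> {for y1 + z *: v, continuous f} by move=> [hz _]; have [] := phol hy1 hz.
have cl z : K z -> {for z, continuous (fun z => f (y1 + z *: v))}.
  by move=> [hz _]; apply/hol_cont/mhol_line/phol.
have nz z : K z -> f (y1 + z *: v) != 0.
  move=> [hz hl]; apply/eqP => fz; have zz : z \in Z y1 by apply/mem_zero_list.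
  by have := hl z zz; rewrite subrr mx0 leNgt e0.
have [m0 m00 hm] := compact_min cK cl nz.
have h := cont_tube cK cf m00.
apply: filterS (filterI h (ball_near hy1)) => y [hy yb] z /(mem_zero_list _ yb)[zero_list fz].
apply: contrapT => nex.
have Kz : K z.
  by split => // l lZ; rewrite leNgt; apply/negP => lt; apply: nex; exists l.
by have := hy z Kz; rewrite fz sub0r nmN ltNge hm.
Qed.

Lemma zero_list_isolated y1 (z1 : C) : nm (y1 - p) < rho -> z1 \in Z y1 ->
  forall e' : R, 0 < e' -> exists2 z : C, nm z < e' & f (y1 + z1 *: v + z *: v) != 0.
Proof.
move=> hy1 z1Z; have z1s := zero_list_lt hy1 z1Z.
have d0 : 0 < s - mx z1 by rewrite subr_gt0.
move=> e' e'0.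
have [|e1 e10 he1] := @fin_min _ [seq l <- Z y1 | l != z1] (fun l => nm (l - z1)).
  by move=> l; rewrite mem_filter nm_gt0 subr_eq0 => /andP[].
pose t := Num.min (Num.min e' e1) (s - mx z1) / 2.
have m0 : 0 < Num.min (Num.min e' e1) (s - mx z1) by rewrite !lt_min e'0 e10.
have t0 : 0 < t by rewrite divr_gt0.
have : t < Num.min (Num.min e' e1) (s - mx z1) by rewrite /t; lra.
rewrite !lt_min => /andP[/andP[t1 t2] t3]; clearbody t.
have nt : nm (ofR t : C) = t by rewrite nm_ofR ger0_norm// ltW.
exists (ofR t); first by rewrite nt.
rewrite -(addrA y1) -scalerDl; apply/eqP => fz.
have zz : z1 + ofR t \in Z y1.
  apply/mem_zero_list => //; split => //; apply: (le_trans (mxD _ _)); rewrite -lerBrDl.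
  by apply: (le_trans (mx_nm _)); rewrite nt ltW.
have := he1 (z1 + ofR t); rewrite mem_filter zz andbT addrAC subrr add0r nt.
rewrite -subr_eq0 addrAC subrr add0r -nm_gt0 nt t0 => /(_ isT).
by rewrite leNgt t2.
Qed.

Lemma zero_list_hurwitz y1 (z1 : C) (e : R) : nm (y1 - p) < rho -> z1 \in Z y1 -> 0 < e ->
  \forall y \near y1, exists2 z, z \in Z y & mx (z - z1) < e.
Proof.
move=> hy1 z1Z e0; have z1s := zero_list_lt hy1 z1Z; have [_ fz1] := (mem_zero_list z1 hy1).1 z1Z.
pose w := y1 + z1 *: v.
have hw : nm (w - c) < r by apply: (w_dom W) => //; exact: ltW.
have hfw := mholb_shrink (w_f W) hw.
have r20 : 0 < r - nm (w - c) by rewrite subr_gt0.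
have d0 : 0 < s - mx z1 by rewrite subr_gt0.
have nz := zero_list_isolated hy1 z1Z.
have fw : f w = 0 by [].
have e20 : 0 < Num.min e (s - mx z1) by rewrite lt_min e0.
have [m' [s' [c0 [c1 [M [s1 B]]]]]] := box_nz r20 hfw nz e20.
have [s2 s3] : s' <= e /\ s' <= s - mx z1 by move: s1; rewrite le_min => /andP.
have h := near_transl (hurwitz B (box_s B) (lexx s') fw).
apply: filterS (filterI h (ball_near hy1)) => y [[z mz fz] yb].
exists (z1 + z); last by rewrite addrAC subrr add0r (lt_le_trans mz).
apply/mem_zero_list => //; split; last by rewrite scalerDl addrA.
apply: (le_trans (mxD _ _)); rewrite -lerBrDl; exact: le_trans (ltW mz) s3.
Qed.

(** A fiber near that over y1 has a zero near each of the k zeros over y1, and it has at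
    most k zeros: so it has exactly one near each of them. *)
Lemma good_sheets k y1 : (forall y, nm (y - p) < rho -> (size (Z y) <= k)%N) ->
  nm (y1 - p) < rho -> size (Z y1) = k -> exists rho1 (sg : C -> V -> C), [/\ 0 < rho1,
   forall y, nm (y - y1) < rho1 -> [/\ nm (y - p) < rho, size (Z y) = k &
     perm_eq (Z y) [seq sg l y | l <- Z y1]] ,
   (forall l, l \in Z y1 -> sg l y1 = l) /\ (exists2 e0 : R, 0 < e0 &
     forall l y z, l \in Z y1 -> nm (y - y1) < rho1 -> mx (z - l) < e0 -> z \in Z y -> z = sg l y) &
   forall l, l \in Z y1 -> forall y2, nm (y2 - y1) < rho1 ->
     {for y2, continuous (sg l)} /\ forall u, hol (fun t : C => sg l (y2 + t *: u)) 0].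
Proof.
move=> hk hy1 sk.
pose pairs := [seq q <- [seq (a, b) | a <- Z y1, b <- Z y1] | q.1 != q.2].
have [|ea ea0 hea] := @fin_min _ pairs (fun q => mx (q.1 - q.2)).
  move=> [a b]; rewrite mem_filter /= => /andP[ab _].
  rewrite lt_neqAle mx_ge0 andbT eq_sym; apply: contraNneq ab => e.
  rewrite -subr_eq0 -[_ == _]negbK -nm_gt0 -leNgt; apply: (le_trans (nm_mx _)).
  by rewrite e mulr0.
have [|eb eb0 heb] := @fin_min _ (Z y1) (fun l => s - mx l).
  by move=> l lZ; rewrite subr_gt0; exact: (zero_list_lt hy1 lZ).
pose e0 := Num.min (ea / 2) eb.
have e00 : 0 < e0 by rewrite lt_min eb0 divr_gt0.
have [e01 e02] : e0 <= ea / 2 /\ e0 <= eb by rewrite /e0 !ge_min !lexx ?orbT.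
clearbody e0.
have sep a b z : a \in Z y1 -> b \in Z y1 -> mx (z - a) < e0 -> mx (z - b) < e0 -> a = b.
  move=> aZ bZ ha hb; apply: contrapT => /eqP ab.
  have : (a, b) \in pairs by rewrite mem_filter /= ab; apply/allpairsP; exists (a, b).
  move=> /hea /=; rewrite leNgt => /negP; apply.
  have -> : a - b = - (z - a) + (z - b) by ring.
  apply: le_lt_trans (mxD _ _) _.
  have -> : mx (- (z - a)) = mx (z - a).
    by case: (z - a) => x y; rewrite /mx /= !normrN.
  lra.
have ins l z : l \in Z y1 -> mx (z - l) < e0 -> mx z <= s.
  move=> /heb hl hz; rewrite -(subrK l z); apply: (le_trans (mxD _ _)).
  lra.
pose sg l y := xget 0 [set z | z \in Z y /\ mx (z - l) < e0].
have hn : \forall y \near y1, forall l, l \in Z y1 -> exists2 z, z \in Z y & mx (z - l) < e0.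
  by apply: near_all => l lZ; exact: zero_list_hurwitz.
have [rho1 rho10 hrho] := (nbhs_nm _ _).1 (filterI hn (ball_near hy1)).
have sgP l y : l \in Z y1 -> nm (y - y1) < rho1 -> sg l y \in Z y /\ mx (sg l y - l) < e0.
  move=> lZ /hrho[h _]; have [z zZ hz] := h l lZ.
  by apply: (@xgetPex _ 0 [set z | z \in Z y /\ mx (z - l) < e0]); exists z.
have main y : nm (y - y1) < rho1 -> [/\ nm (y - p) < rho, size (Z y) = k &
     perm_eq (Z y) [seq sg l y | l <- Z y1]].
  move=> hy; have [_ yb] := hrho y hy.
  have inj : {in Z y1 &, injective (sg^~ y)}.
    move=> a b aZ bZ /= ab; have [_ ha] := sgP a y aZ hy; have [_ hb] := sgP b y bZ hy.
    by apply: (sep a b (sg a y)) => //; rewrite ab.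
  have um : uniq [seq sg l y | l <- Z y1] by rewrite map_inj_in_uniq// zero_list_uniq.
  have sub : {subset [seq sg l y | l <- Z y1] <= Z y}.
    by move=> _ /mapP[l lZ ->]; have [] := sgP l y lZ hy.
  have le : (size (Z y) <= size [seq sg l y | l <- Z y1])%N by rewrite size_map sk hk.
  have [s1 s2] := uniq_min_size um sub le.
  split => //; first by rewrite -s1 size_map.
  by apply: (uniq_perm (zero_list_uniq yb) um) => z; rewrite s2.
have uniqz l y z : l \in Z y1 -> nm (y - y1) < rho1 -> mx (z - l) < e0 ->
    f (y + z *: v) = 0 -> z = sg l y.
  move=> lZ hy hz fz; have [yb _ pe] := main y hy.
  have zZ : z \in Z y by apply/mem_zero_list => //; split => //; exact: (ins l).
  move: (zZ); rewrite (perm_mem pe) => /mapP[l' lZ' e].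
  have [_ h'] := sgP l' y lZ' hy.
  by rewrite e; congr (sg _ y); apply: (sep l' l (sg l' y)) => //; rewrite -e.
exists rho1, sg; split => //.
  split; last first.
    exists e0 => // l y z lZ hy hz zZ; apply: uniqz => //.
    by have [yb _ _] := main y hy; have [] := (mem_zero_list z yb).1 zZ.
  move=> l lZ; apply/esym; apply: uniqz => //; rewrite ?subrr ?nm0 ?mx0//.
  by have [] := (mem_zero_list l hy1).1 lZ.
move=> l lZ; apply: (@sheet_hol R V f c r v y1 rho1 l e0 (sg l) (w_f W) rho10).
  move=> y z /hrho[_ yb] hz; apply: (w_dom W yb); exact: (ins l).
move=> y hy; have [yb _ _] := main y hy; have [h1 h2] := sgP l y lZ hy; split => //.
  by have [] := (mem_zero_list (sg l y) yb).1 h1.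
by move=> z; exact: uniqz.
Qed.

End Weier.
End ZeroLists.

(** * The discriminant as a barrier function *)

Section Discriminant.
Variable R : realType.
Local Notation C := (Cx R).

(** The factors with b = a are replaced by 1, so that the product is never 0; for a
    sequence without repetition it is the discriminant up to sign. *)
Definition disc (L : seq C) : C := \prod_(a <- L) \prod_(b <- L) (if b == a then 1 else b - a).

Lemma disc_perm L L' : perm_eq L L' -> disc L = disc L'.
Proof.
by move=> h; rewrite /disc (perm_big _ h); apply: eq_bigr => a _; rewrite (perm_big _ h).
Qed.

Lemma disc_neq0 L : disc L != 0.
Proof.
rewrite prodf_seq_neq0; apply/allP => a _ /=; rewrite prodf_seq_neq0; apply/allP => b _ /=.
by case: ifPn => [_|ba]; [exact: oner_neq0|rewrite subr_eq0].
Qed.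

Lemma prod_small (I : eqType) (s : seq I) (F : I -> C) (A e : R) j : 1 <= A -> j \in s ->
  (forall i, i \in s -> nm (F i) <= A) -> nm (F j) <= e ->
  nm (\prod_(i <- s) F i) <= e * A ^+ size s.
Proof.
move=> A1 js hA je; have A0 : 0 <= A by exact: le_trans A1.
have e0 : 0 <= e by exact: le_trans (nm_ge0 _) je.
rewrite (perm_big _ (perm_to_rem js)) big_cons nmM; apply: ler_pM; rewrite ?nm_ge0//.
have -> : size s = (size (rem j s)).+1 by rewrite size_rem// prednK//; case: (s) js.
have sub : {subset rem j s <= s} by exact: mem_rem.
elim: (rem j s) sub => [|i t IH] sub.
  by rewrite big_nil nm1 expr1.
rewrite big_cons nmM exprS; apply: ler_pM; rewrite ?nm_ge0//.
  by apply: hA; apply: sub; rewrite mem_head.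
by apply: IH => k kt; apply: sub; rewrite inE kt orbT.
Qed.

Lemma disc_small L (A e : R) a b : 1 <= A -> (forall x y, x \in L -> y \in L -> nm (x - y) <= A) ->
  a \in L -> b \in L -> a != b -> nm (b - a) <= e ->
  nm (disc L) <= e * A ^+ size L * (A ^+ size L) ^+ size L.
Proof.
move=> A1 hA aL bL ab hab.
have fac x y : x \in L -> y \in L -> nm (if y == x then 1 else y - x) <= A.
  by move=> xL yL; case: ifP => _; [rewrite nm1|exact: hA].
have inner x : x \in L -> nm (\prod_(y <- L) (if y == x then 1 else y - x)) <= A ^+ size L.
  move=> xL; have A0 : 0 <= A by exact: le_trans A1.
  have : {subset L <= L} by [].
  elim: {1 3 4}L => [|y t IH] sub; first by rewrite big_nil nm1 expr0.
  rewrite big_cons nmM exprS; apply: ler_pM; rewrite ?nm_ge0//.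
    by apply: fac => //; apply: sub; rewrite mem_head.
  by apply: IH => k kt; apply: sub; rewrite inE kt orbT.
apply: (@prod_small _ L (fun x => \prod_(y <- L) (if y == x then 1 else y - x)) _ _ a) => //.
  exact: exprn_ege1.
apply: (@prod_small _ L (fun y => if y == a then 1 else y - a) A e b) => //.
  by move=> i iL; exact: fac.
by rewrite eq_sym (negbTE ab).
Qed.

(** The branch of the square root is the one with values in the closed upper half plane;
    it is cut along the nonnegative reals. *)
Lemma Im_sqrtC_ge0 (w : C) : 0 <= complex.Im (sqrtC w).
Proof.
have := Im_rootC_ge0 w (ltnSn 1).
by rewrite -complexIm ler0c.
Qed.

Lemma Im_sqrtC_eq0 (w : C) : complex.Im (sqrtC w) = 0 -> exists2 t : R, 0 <= t & w = ofR t.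
Proof.
move=> h; exists (complex.Re (sqrtC w) ^+ 2); first exact: sqr_ge0.
rewrite -[LHS](sqrtCK w); case: (sqrtC w) h => a b /= ->.
by rewrite !expr2 -ofRM.
Qed.

Lemma nm_sqrtC (w : C) : nm (sqrtC w) ^+ 2 = nm w.
Proof. by rewrite -nmX sqrtCK. Qed.

(** The difference quotient of the square root is 1 / (sqrtC w + sqrtC w0), and the
    denominator stays away from 0 as both imaginary parts are nonnegative. *)
Lemma hol_sqrtC (w0 : C) : 0 < complex.Im (sqrtC w0) -> hol sqrtC w0.
Proof.
move=> I0; set r0 := sqrtC w0 in I0 *.
have den w : complex.Im r0 <= nm (sqrtC w + r0).
  apply: le_trans (nm_Im _); rewrite ImD; apply: le_trans (ler_norm _).
  by rewrite lerDr Im_sqrtC_ge0.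
have den0 w : sqrtC w + r0 != 0 by rewrite -nm_gt0 (lt_le_trans I0).
have E w : sqrtC w = r0 + (w - w0) * (sqrtC w + r0)^-1.
  have -> : w - w0 = (sqrtC w - r0) * (sqrtC w + r0) by rewrite -subr_sqr !sqrtCK.
  by rewrite mulfK// addrC subrK.
have cs : {for w0, continuous sqrtC}.
  apply/contP => e e0; exists (e * complex.Im r0); first by rewrite mulr_gt0.
  move=> w hw; rewrite -/r0 [sqrtC w]E [r0 + _]addrC addrK nmM nmV.
  by rewrite ltr_pdivrMr ?(lt_le_trans I0)// (lt_le_trans hw)// ler_pM2l.
exists (fun w => (sqrtC w + r0)^-1); last exact: E.
exact: (contV (contD cs (cont_cst r0 w0)) (den0 w0)).
Qed.

End Discriminant.

Section Barrier.
Variable R : realType.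
Local Notation C := (Cx R).
Variable V : normedModType C.
Variables (f : V -> C) (c : V) (r : R) (v p : V) (s rho : R) (m k : nat).
Hypothesis W : weierstrass f c r v p s rho m.
Let Z := zero_list f v s.
Hypothesis hk : forall y, nm (y - p) < rho -> (size (Z y) <= k)%N.
Hypothesis hdens : forall e : R, 0 < e -> exists y : V, [/\ nm (y - p) < e, nm (y - p) < rho & size (Z y) = k].
Implicit Types (x y u w : V) (X : V -> Prop) (G : V -> C).

(** The points over which the fiber has the largest possible number of points; the
    hypothesis hdens says that they accumulate at p. *)
Definition good y := nm (y - p) < rho /\ size (Z y) = k.

Lemma good_near y : good y -> \forall x \near y, good x.
Proof.
move=> [yb sy]; have [rho1 [sg [r1 h _ _]]] := good_sheets W hk yb sy.
by apply/nbhs_nm; exists rho1 => // x /h[].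
Qed.

(** What is needed of G for the maximum principle and the identity theorem of Rado type
    on every line. *)
Definition barrier G := forall y u, nm (y - p) < rho ->
  {for (0 : C), continuous (fun t : C => G (y + t *: u))} /\
  (G y != 0 -> hol (fun t : C => G (y + t *: u)) 0).

Definition sheet_disc X y : C := if `[< good y /\ X y >] then disc (Z y) else 0.

Definition locconst X := forall y, good y -> \forall x \near y, (X x <-> X y).

Lemma near_line y u (P : V -> Prop) : (\forall x \near y, P x) -> \forall t \near (0 : C), P (y + t *: u).
Proof.
move=> h; have h' : nbhs (y + (0 : C) *: u) P by rewrite scale0r addr0.
exact: (line_cont y u _ h').
Qed.

Lemma sheet_disc_neq0 X y : (sheet_disc X y != 0) <-> good y /\ X y.
Proof.
rewrite /sheet_disc; case: asboolP => h; split => //; first by move=> _; exact: disc_neq0.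
by rewrite eqxx.
Qed.

(** Where two points of the fiber merge, the discriminant of the nearby good fibers
    tends to 0; where X is false at a good point, it is false nearby. So the extension
    by 0 is continuous. *)
Lemma sheet_disc_barrier X : locconst X -> barrier (sheet_disc X).
Proof.
move=> lX y u yb.
have [[gy Xy]|ngy] := pselect (good y /\ X y).
  have [_ sy] := gy.
  have [rho1 [sg [r1 hsg [sg1 _] hsh]]] := good_sheets W hk yb sy.
  have ny : \forall x \near y, nm (x - y) < rho1 /\ (X x <-> X y).
    by apply: filterI; [exact: near_nm|exact: lX].
  have H : hol (fun t : C => sheet_disc X (y + t *: u)) 0.
    apply: (@hol_near _ (fun t : C => \prod_(a <- Z y) \prod_(b <- Z y)
      (if b == a then 1 else sg b (y + t *: u) - sg a (y + t *: u)))); last first.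
      have yy : nm (y - y) < rho1 by rewrite subrr nm0.
      apply: hol_prod => a aZ; apply: hol_prod => b bZ.
      case: eqVneq => _; first exact: hol_cst.
      apply: holB; first by have [_] := hsh b bZ y yy.
      by have [_] := hsh a aZ y yy.
    apply: filterS (near_line u ny) => t [hx Xx].
    have [xb sx pe] := hsg _ hx.
    rewrite /sheet_disc; case: asboolP => [_|[]]; last by split => //; apply/Xx.
    rewrite (disc_perm pe) /disc big_map; apply: eq_big_seq => a aZ.
    rewrite big_map; apply: eq_big_seq => b bZ.
    have um : uniq [seq sg l (y + t *: u) | l <- Z y].
      by rewrite -(perm_uniq pe); exact: (zero_list_uniq W xb).
    have [->|ba] := eqVneq b a; first by rewrite eqxx.
    case: eqVneq => // e; exfalso; move/negP: ba; apply; apply/eqP.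
    have uz := zero_list_uniq W yb.
    have ia : (index a (Z y) < size (Z y))%N by rewrite index_mem.
    have ib : (index b (Z y) < size (Z y))%N by rewrite index_mem.
    have := nth_uniq 0 _ _ um; rewrite !size_map => /(_ _ _ ib ia).
    rewrite !(nth_map 0)// !nth_index// e eqxx => /esym/eqP h.
    by rewrite -(nth_index 0 bZ) h nth_index.
  by split; first exact: hol_cont.
have d0 : sheet_disc X y = 0 by rewrite /sheet_disc; case: asboolP.
split; last by rewrite d0 eqxx.
(* near a bad point, or a good one at which X fails, the function is small *)
suff small (e : R) : 0 < e -> \forall x \near y, nm (sheet_disc X x) < e.
  apply/contP => e e0; have /nbhs_nm[d dd0 hd] := near_line u (small e e0).
  exists d => // t ht; rewrite [sheet_disc X (y + 0 *: u)](_ : _ = 0) ?subr0; first exact: hd.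
  by rewrite scale0r addr0.
move=> e0.
have [gy|ngy'] := pselect (good y).
  have nX : ~ X y by move=> Xy; exact: ngy.
  apply: filterS (lX y gy) => x Xx; rewrite /sheet_disc; case: asboolP => [[_ /Xx//]|_].
  by rewrite nm0.
have sz : (size (Z y) < k)%N.
  by rewrite ltn_neqAle hk// andbT; apply/eqP => sk; apply: ngy'.
pose A := Num.max 1 (4 * s).
have A1 : 1 <= A by rewrite le_max lexx.
have A4 : 4 * s <= A by rewrite le_max lexx orbT.
pose D := A ^+ k * (A ^+ k) ^+ k.
have A0 : 0 < A by exact: lt_le_trans A1.
have D0 : 0 < D by rewrite mulr_gt0// !exprn_gt0.
pose e' := e / (8 * D).
have e'0 : 0 < e' by rewrite divr_gt0// mulr_gt0.
have hz := zero_list_confine W yb e'0.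
apply: filterS hz => x hx; rewrite /sheet_disc; case: asboolP => [[[xb sx] _]|_]; last by rewrite nm0.
pose g z := xget 0 [set l | l \in Z y /\ mx (z - l) < e'].
have gP z : z \in Z x -> g z \in Z y /\ mx (z - g z) < e'.
  move=> zZ; have [l lZ hl] := hx z zZ.
  by apply: (@xgetPex _ 0 [set l | l \in Z y /\ mx (z - l) < e']); exists l.
(* pigeonhole: the fiber over x has more points than the fiber over y to which they are close *)
have [a [b [aZ bZ ab gab]]] : exists a b, [/\ a \in Z x, b \in Z x, a != b & g a = g b].
  apply: contrapT => nex.
  have inj : {in Z x &, injective g}.
    move=> a b aZ bZ gab; apply: contrapT => /eqP ab; apply: nex.
    by exists a, b.
  have um : uniq (map g (Z x)) by rewrite map_inj_in_uniq//; exact: (zero_list_uniq W xb).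
  have := uniq_leq_size um (s2 := Z y); rewrite size_map -/Z sx leqNgt sz => /(_ _)/negP; case => //.
  by move=> _ /mapP[z zZ ->]; have [] := gP z zZ.
have mxN (z : C) : mx (- z) = mx z by case: z => ? ?; rewrite /mx /= !normrN.
have hab : nm (b - a) <= 4 * e'.
  have [_ h1] := gP a aZ; have [_ h2] := gP b bZ; rewrite gab in h1.
  apply: (le_trans (nm_mx _)).
  have -> : b - a = (b - g b) + (- (a - g b)) by ring.
  have := mxD (b - g b) (- (a - g b)); rewrite mxN; lra.
have hA (z w : C) : z \in Z x -> w \in Z x -> nm (z - w) <= A.
  move=> /(zero_list_lt W xb) h1 /(zero_list_lt W xb) h2; apply: le_trans A4; apply: (le_trans (nm_mx _)).
  have := mxD z (- w); rewrite mxN; lra.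
apply: le_lt_trans (disc_small A1 hA aZ bZ ab hab) _.
rewrite sx -mulrA -/D.
have -> : 4 * e' * D = e / 2 by rewrite /e'; field; rewrite gt_eqF.
by rewrite ltr_pdivrMr// mulr_natr mulr2n ltrDl.
Qed.

Lemma line_shift (t0 : C) y u (G : V -> C) :
  ({for (0 : C), continuous (fun t : C => G (y + t0 *: u + t *: u))} ->
   {for t0, continuous (fun t : C => G (y + t *: u))}) /\
  (hol (fun t : C => G (y + t0 *: u + t *: u)) 0 -> hol (fun t : C => G (y + t *: u)) t0).
Proof.
have E (t : C) : y + t0 *: u + (t - t0) *: u = y + t *: u.
  by rewrite -addrA -scalerDl [t0 + _]addrC subrK.
split=> h.
  have h' : {for (t0 - t0), continuous (fun t : C => G (y + t0 *: u + t *: u))} by rewrite subrr.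
  apply: (cont_near _ (continuous_comp (hol_cont (hol_subc t0 t0)) h')).
  by apply: filterE => t; rewrite /= E.
have h' : hol (fun t : C => G (y + t0 *: u + t *: u)) (t0 - t0) by rewrite subrr.
by apply: (hol_near _ (hol_comp (hol_subc t0 t0) h')); apply: filterE => t; rewrite E.
Qed.

Lemma barrier_line G w u (t : C) : barrier G -> nm (w + t *: u - p) < rho ->
  {for t, continuous (fun t : C => G (w + t *: u))} /\
  (G (w + t *: u) != 0 -> hol (fun t : C => G (w + t *: u)) t).
Proof.
move=> bG ht; have [h1 h2] := bG _ u ht; split; first exact: (line_shift t w u G).1.
by move=> G0; apply: (line_shift t w u G).2; exact: h2.
Qed.

Lemma line_in w y (t : C) : nm (w - p) < rho / 8 -> nm (y - p) < rho / 8 -> nm t <= 3 ->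
  nm (w + t *: (y - w) - p) < rho.
Proof.
move=> hw hy ht; rewrite addrAC; apply: le_lt_trans (nmD _ _) _; rewrite nmZ.
have h : nm (y - w) <= rho / 4.
  apply: (le_trans (nm_tri _ p _)); rewrite [nm (p - w)]nmC; lra.
have : nm t * nm (y - w) <= 3 * (rho / 4) by apply: ler_pM; rewrite ?nm_ge0.
have := w_rho W; lra.
Qed.

Lemma line_end w y : w + (1 : C) *: (y - w) = y.
Proof. by rewrite scale1r addrC subrK. Qed.

(** The identity theorem on the complex line joining w to y. *)
Lemma barrier_identity G w y : barrier G -> nm (w - p) < rho / 8 -> nm (y - p) < rho / 8 ->
  (\forall x \near w, G x = 0) -> G y = 0.
Proof.
move=> bG hw hy G0; rewrite -(line_end w y).
have le3 (z : C) : nm (z - 0) <= 2 -> nm z <= 3 by rewrite subr0; lra.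
apply: (@identity_rado R (fun t => G (w + t *: (y - w))) 0 2) => //.
- by move=> z hz; have [] := barrier_line bG (line_in hw hy (le3 z hz)).
- by move=> z hz; have [_] := barrier_line bG (line_in hw hy (le3 z (ltW hz))).
- exact: (near_line (y - w) G0).
- by rewrite subr0 nm1 ltr1n.
Qed.

(** Otherwise the discriminant of the good fibers would vanish near w, hence at all
    points near p, although good points accumulate at p. *)
Lemma good_dense w (e : R) : nm (w - p) < rho / 8 -> 0 < e -> exists2 y, good y & nm (y - w) < e.
Proof.
move=> hw e0; apply: contrapT => nex.
have lT : locconst (fun _ => True) by move=> y _; apply: filterE.
have near0 : \forall x \near w, sheet_disc (fun=> True) x = 0.
  apply: filterS (near_nm w e0) => x hx; apply: contrapT => /eqP /sheet_disc_neq0[gx _].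
  by apply: nex; exists x.
have r8 : 0 < rho / 8 by rewrite divr_gt0// (w_rho W).
have [y [y1 y2 y3]] := hdens r8.
have := barrier_identity (sheet_disc_barrier lT) hw y1 near0.
by apply/eqP/sheet_disc_neq0.
Qed.

(** A Schwarz-Pick estimate. On the line through y1 and y2, the map T = (S - S y1) / (S
    - conj (S y1)) is bounded by 1 and vanishes at the parameter 0. The function T t / t
    is holomorphic only at the good points, but its N-th power times the discriminant,
    extended by 0, is holomorphic off its zeros; on the disc of radius 3 the maximum
    principle gives |T| <= 1 / 3 at y2, once the discriminant is absorbed by letting N
    grow. *)
Lemma harnack (S : V -> C) y1 y2 :
  (forall y, nm (y - p) < rho -> 0 < complex.Im (S y)) ->
  (forall y u, good y -> hol (fun t : C => S (y + t *: u)) 0) ->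
  good y1 -> good y2 -> nm (y1 - p) < rho / 8 -> nm (y2 - p) < rho / 8 ->
  nm (S y2) <= 2 * nm (S y1).
Proof.
move=> IS hS g1 g2 h1 h2.
set u := y2 - y1.
pose x (t : C) := y1 + t *: u.
have xin (t : C) : nm t <= 3 -> nm (x t - p) < rho by move=> ht; exact: line_in.
set s1 := S y1.
pose cj : C := conjc (s1 : R[i]).
have den y : nm (y - p) < rho -> S y - cj != 0.
  move=> hy; apply/eqP => /eqP; rewrite subr_eq0 => /eqP e.
  have := IS y hy; have := IS y1 (proj1 g1); rewrite -/s1 e /cj; case: (s1) => a b /=; lra.
pose T0 y := (S y - s1) / (S y - cj).
have T01 y : nm (y - p) < rho -> nm (T0 y) <= 1.
  move=> hy; rewrite nmM nmV ler_pdivrMr ?nm_gt0 ?den// mul1r.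
  have := IS y hy; have := IS y1 (proj1 g1); rewrite -/s1 => b10 b0.
  have nsq (z : C) : nm z ^+ 2 = complex.Re z ^+ 2 + complex.Im z ^+ 2.
    by rewrite /nm normc_def /= sqr_sqrtr// addr_ge0 ?sqr_ge0.
  have [cR cint] : complex.Re cj = complex.Re s1 /\ complex.Im cj = - complex.Im s1.
    by rewrite /cj; case: (s1).
  rewrite -(@ler_pXn2r _ 2) ?nnegrE ?nm_ge0// !nsq !ReB !ImB cR cint opprK lerD2l.
  have : 0 <= complex.Im (S y) * complex.Im s1 by rewrite mulr_ge0 ?ltW.
  nra.
have hT y : good y -> hol (fun t : C => T0 (y + t *: u)) 0.
  move=> gy; have yb := proj1 gy.
  have d0 : S (y + 0 *: u) - cj != 0 by rewrite scale0r addr0 den.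
  have h := hS y u gy.
  exact: (holM (holB h (hol_cst s1 0)) (holV (holB h (hol_cst cj 0)) d0)).
pose T (t : C) := T0 (x t).
have hTt (t : C) : good (x t) -> hol T t.
  by move=> gt; apply: (line_shift t y1 u T0).2; exact: hT.
have T00 : T 0 = 0 by rewrite /T /x scale0r addr0 /T0 subrr mul0r.
have gx0 : good (x 0) by rewrite /x scale0r addr0.
have goodn (t : C) : good (x t) -> \forall t' \near t, good (x t').
  move=> gt; exact: (line_cont_at y1 u t _ (good_near gt)).
have lT : locconst (fun _ => True) by move=> y _; apply: filterE.
(* the factor dl makes the powers of T t / t extend by 0 to the bad points of the line *)
pose dl := sheet_disc (fun=> True).
have bl : barrier dl by exact: sheet_disc_barrier.
have hq (t : C) : good (x t) -> hol (dq T 0) t.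
  move=> gt; have [->|t0] := eqVneq t 0.
    by apply: hol_dq; apply: filterS (goodn 0 gx0) => t'; exact: hTt.
  by apply: hol_dq_off => //; exact: hTt.
have cdl (t : C) : nm t <= 3 -> {for t, continuous (fun t => dl (x t))}.
  by move=> ht; have [] := barrier_line (u := u) bl (xin t ht).
have [D D0 hD] : exists2 D : R, 0 < D & forall t : C, nm (t - 0) <= 3 -> nm (dl (x t)) <= D.
  by apply: (compact_bd (@compact_disc R 0 3)) => t /=; rewrite subr0; exact: cdl.
have dl2 : dl y2 != 0 by apply/sheet_disc_neq0.
have nl2 : 0 < nm (dl y2) by rewrite nm_gt0.
have x1 : x 1 = y2 by rewrite /x /u line_end.
have bad (t : C) : ~ good (x t) -> dl (x t) = 0.
  by move=> ng; apply: contrapT => /eqP /sheet_disc_neq0[].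
have T1 : nm (T 1) <= 1 / 3.
  apply: (@power_trick _ _ D _ _ nl2) => // N; rewrite mulrC.
  have q1 : dq T 0 1 = T 1 by rewrite dq_neq ?oner_neq0// T00 !subr0 divr1.
  rewrite -q1 -x1 -nmX -nmM.
  apply: (@maxmod_rado R (fun t => dq T 0 t ^+ N * dl (x t)) 0 3) => //.
  - move=> t; rewrite subr0 => ht.
    have [gt|ng] := pselect (good (x t)).
      exact: (contM (contX N (hol_cont (hq t gt))) (cdl t ht)).
    have t0 : t != 0 by apply: contra_not_neq ng => ->.
    have nt : 0 < nm t by rewrite nm_gt0.
    apply/contP => e e0.
    pose K := (2 / nm t) ^+ N.
    have K0 : 0 < K by rewrite exprn_gt0// divr_gt0.
    have eK : 0 < e / K by rewrite divr_gt0.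
    have [d d0 hd] := (contP _ _).1 (cdl t ht) _ eK.
    have xb := xin t ht.
    have nx : \forall t' \near t, nm (x t' - p) < rho.
      exact: (line_cont_at y1 u t _ (ball_near xb)).
    have [d' d'0 hd'] := (nbhs_nm _ _).1 nx.
    exists (Num.min (Num.min d d') (nm t / 2)); first by rewrite !lt_min d0 d'0 divr_gt0.
    move=> t'; rewrite !lt_min => /andP[/andP[/hd a1 /hd' a2] a3].
    rewrite (bad t ng) mulr0 subr0 nmM nmX.
    rewrite (bad t ng) subr0 in a1.
    have t'h : nm t / 2 <= nm t'.
      by have := nmBge t t'; rewrite [nm (t - t')]nmC; lra.
    have t'0 : t' != 0 by rewrite -nm_gt0; apply: lt_le_trans t'h; rewrite divr_gt0.
    have b1 : nm (dq T 0 t') <= 2 / nm t.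
      rewrite dq_neq// T00 !subr0 nmM nmV; apply: (@le_trans _ _ ((nm t')^-1)).
        by rewrite ler_piMl ?invr_ge0 ?nm_ge0// T01.
      by rewrite -[2 / _]invf_div lef_pV2 ?posrE ?nm_gt0// divr_gt0.
    apply: (@le_lt_trans _ _ (K * nm (dl (x t')))).
      apply: ler_wpM2r; first exact: nm_ge0.
      by apply: lerXn2r => //; rewrite nnegrE ?nm_ge0// divr_ge0// nm_ge0.
    by rewrite mulrC -ltr_pdivlMr.
  - move=> t; rewrite subr0 => ht; rewrite mulf_eq0 negb_or => /andP[_ /sheet_disc_neq0[gt _]].
    apply: (holM (@holX _ _ N _ (hq t gt))).
    have [_ h] := barrier_line (u := u) bl (xin t (ltW ht)).
    by apply: h; apply/sheet_disc_neq0.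
  - move=> t; rewrite subr0 => ht; rewrite nmM nmX mulrC.
    have t0 : t != 0 by rewrite -nm_gt0 ht.
    apply: ler_pM; rewrite ?nm_ge0 ?exprn_ge0 ?nm_ge0//; first by apply: hD; rewrite subr0 ht.
    apply: lerXn2r; rewrite ?nnegrE ?nm_ge0 ?divr_ge0//.
    rewrite dq_neq// T00 !subr0 nmM nmV ht ler_pM2r ?invr_gt0//.
    by apply: T01; apply: xin; rewrite ht.
  - by rewrite subr0 nm1 ler1n.
have b2 := proj1 g2.
move: T1; rewrite /T x1 /T0 nmM nmV ler_pdivrMr ?nm_gt0 ?den// => le.
have cjn : nm cj = nm s1.
  by rewrite /cj /nm !normc_def; case: (s1) => a b /=; rewrite sqrrN.
have := nmBge (S y2) s1; have := nmB (S y2) cj; rewrite cjn.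
lra.
Qed.

End Barrier.

(** * Two hypersurfaces separated along a direction *)

Section AnalyticSets.
Variable R : realType.
Local Notation C := (Cx R).
Variable V : normedModType C.
Implicit Types (A B : V -> Prop) (x y u w : V) (z l : C).

Definition hyp_at A b := exists (e : R) (h : V -> C), [/\ 0 < e, mholb h b e &
  forall y, nm (y - b) < e -> (A y <-> h y = 0)].

Definition eqs_at A a := exists (e : R) (J : Type) (F : J -> V -> C), [/\ 0 < e,
  forall j, mholb (F j) a e & forall y, nm (y - a) < e -> (A y <-> forall j, F j y = 0)].

(** What the argument uses of a hypersurface A in a ball: near each point it is given by
    holomorphic equations, near the points of a dense subset by a single one, and f
    vanishes on it. A fixed f of which A may be only a part is needed because A and its
    companion B are studied through one common equation. *)
Record hyperset (f : V -> C) A (p : V) (r : R) : Prop := Hyperset {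
  h_sub : forall y, nm (y - p) < r -> A y -> f y = 0;
  h_eqs : forall a, nm (a - p) < r -> eqs_at A a;
  h_dense : forall a, nm (a - p) < r -> A a -> forall e : R, 0 < e ->
    exists b, [/\ nm (b - a) < e, A b & hyp_at A b] }.

Lemma curve_near (sg : V -> C) y v (e : R) : {for y, continuous sg} -> 0 < e ->
  \forall x \near y, nm (x + sg x *: v - (y + sg y *: v)) < e.
Proof.
move=> csg e0; have v1 : 0 < nm v + 1 by rewrite ltr_wpDl ?nm_ge0.
have e2 : 0 < e / 2 by rewrite divr_gt0.
have e3 : 0 < e / 2 / (nm v + 1) by rewrite divr_gt0.
have [d d0 hd] := (contP _ _).1 csg _ e3.
have n1 : \forall x \near y, nm (sg x - sg y) < e / 2 / (nm v + 1) by apply/nbhs_nm; exists d.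
apply: filterS (filterI (near_nm y e2) n1) => x [h1 h2].
rewrite opprD addrACA -scalerBl; apply: le_lt_trans (nmD _ _) _.
rewrite (splitr e); apply: ltrD => //; rewrite nmZ.
move: h2; rewrite ltr_pdivlMr//; apply: le_lt_trans.
by apply: ler_wpM2l; [exact: nm_ge0|rewrite lerDl].
Qed.

Section Main.
Variables (f : V -> C) (r : R) (v p : V) (s rho : R) (m k : nat).
Hypothesis W : weierstrass f p r v p s rho m.
Let Z := zero_list f v s.
Hypothesis hk : forall y, nm (y - p) < rho -> (size (Z y) <= k)%N.
Hypothesis hdens : forall e : R, 0 < e -> exists y : V, [/\ nm (y - p) < e, nm (y - p) < rho & size (Z y) = k].
Let good := good f v p s rho k.

(** By Hurwitz' theorem a zero of a single equation of A persists on nearby lines. *)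
Lemma A_persist A y l (e : R) : hyperset f A p r -> nm (y - p) < rho -> l \in Z y ->
  A (y + l *: v) -> hyp_at A (y + l *: v) -> 0 < e ->
  \forall x \near y, exists2 z, mx (z - l) < e & z \in Z x /\ A (x + z *: v).
Proof.
move=> HA yb lZ Ab [e' [h [e'0 hh hA]]] e0.
set b := y + l *: v in hh hA.
have ls := zero_list_lt W yb lZ.
have d0 : 0 < s - mx l by rewrite subr_gt0.
have v1 : 0 < nm v + 1 by rewrite ltr_wpDl ?nm_ge0.
have q0 : 0 < e' / (8 * (nm v + 1)) by rewrite divr_gt0// mulr_gt0.
have ins z : mx z <= s - mx l -> mx (l + z) <= s.
  by move=> hz; apply: (le_trans (mxD _ _)); rewrite -lerBrDl.
have bb : nm (b - b) < e' / 2 by rewrite subrr nm0 divr_gt0.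
have shift x z : nm (x - b) < e' / 2 -> mx z <= e' / (8 * (nm v + 1)) -> nm (x + z *: v - b) < e'.
  move=> hx hz; apply: (nm_shift hx hz).
  by rewrite le_eqVlt; apply/orP; left; apply/eqP; field; rewrite gt_eqF.
have nz (e1 : R) : 0 < e1 -> exists2 z : C, nm z < e1 & h (b + z *: v) != 0.
  move=> e10.
  have m0 : 0 < Num.min e1 (Num.min (s - mx l) (e' / (8 * (nm v + 1)))).
    by rewrite !lt_min e10 d0.
  have [z] := zero_list_isolated W yb lZ m0; rewrite !lt_min => /and3P[z1 z2 z3] fz.
  exists z => //; apply: contraNneq fz => hz.
  have zm : mx z <= s - mx l by apply: le_trans (mx_nm z) (ltW z2).
  have az : A (b + z *: v).
    by apply/hA => //; apply: shift => //; apply: le_trans (mx_nm z) (ltW z3).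
  apply/eqP; apply: (h_sub HA) => //; rewrite -(addrA y) -scalerDl.
  by apply: (w_dom W yb); exact: ins.
pose e1 := Num.min e (Num.min (s - mx l) (e' / (8 * (nm v + 1)))).
have e10 : 0 < e1 by rewrite !lt_min e0 d0.
have [m' [s' [c0 [c1 [M [s1 Bx]]]]]] := box_nz e'0 hh nz e10.
have [s2 [s3 s4]] : s' <= e /\ s' <= s - mx l /\ s' <= e' / (8 * (nm v + 1)).
  by move: s1; rewrite !le_min => /and3P[].
have hb : h b = 0 by apply/hA => //; rewrite subrr nm0.
have hur := near_transl (hurwitz Bx (box_s Bx) (lexx s') hb).
have e2 : 0 < e' / 2 by rewrite divr_gt0.
have nb : \forall x \near y, nm (x + l *: v - b) < e' / 2.
  by apply: filterS (near_nm y e2) => x hx; rewrite opprD addrACA subrr addr0.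
apply: filterS (filterI hur (filterI nb (ball_near yb))) => x [[z mz hz] [xb xp]].
have zm : mx z <= s - mx l by apply: le_trans (ltW mz) s3.
have az : A (x + (l + z) *: v).
  rewrite scalerDl addrA; apply/hA => //; apply: shift => //.
  exact: le_trans (ltW mz) s4.
exists (l + z); first by rewrite addrAC subrr add0r (lt_le_trans mz).
split => //; apply/(mem_zero_list W) => //; split; first exact: ins.
apply: (h_sub HA) => //; apply: (w_dom W xp); exact: ins.
Qed.

(** Points of A at which it is a hypersurface are dense; near them the sheet stays in A,
    because the fiber has only one point there and A persists. The equations of A,
    restricted to the sheet, then vanish on an open set, and the identity theorem
    applies along segments. Near a point outside A, some equation of A does not vanish.
    *)
Lemma A_sheet A y1 rho1 (sg : C -> V -> C) : hyperset f A p r -> nm (y1 - p) < rho -> 0 < rho1 ->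
  (forall y, nm (y - y1) < rho1 -> nm (y - p) < rho) ->
  (forall l, l \in Z y1 -> sg l y1 = l) ->
  (exists2 e0 : R, 0 < e0 &
     forall l y z, l \in Z y1 -> nm (y - y1) < rho1 -> mx (z - l) < e0 -> z \in Z y -> z = sg l y) ->
  (forall l, l \in Z y1 -> forall y2, nm (y2 - y1) < rho1 ->
     {for y2, continuous (sg l)} /\ forall u, hol (fun t : C => sg l (y2 + t *: u)) 0) ->
  forall l, l \in Z y1 -> \forall y \near y1, (A (y + sg l y *: v) <-> A (y1 + l *: v)).
Proof.
move=> HA yb r10 inb sg1 [e0 e00 uq] shol l lZ.
have ls := zero_list_lt W yb lZ.
have yy : nm (y1 - y1) < rho1 by rewrite subrr nm0.
have [csg _] := shol l lZ y1 yy.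
set a := y1 + l *: v.
have ar : nm (a - p) < r by apply: (w_dom W yb); exact: ltW.
have [e [J [F [ee0 hF hA]]]] := h_eqs HA ar.
have cn := curve_near v csg ee0; rewrite sg1// -/a in cn.
have aa : nm (a - a) < e by rewrite subrr nm0.
have [Aa|nAa] := pselect (A a); last first.
  have [j Fj] : exists j, F j a != 0.
    apply: contrapT => nex; apply: nAa; apply/hA => // j.
    by apply: contrapT => /eqP Fj; apply: nex; exists j.
  have [cF _] := hF j a aa.
  have [d d0 hd] := (nbhs_nm _ _).1 (cont_neq0 cF Fj).
  have cn' := curve_near v csg d0; rewrite sg1// -/a in cn'.
  apply: filterS (filterI cn cn') => y [h1 /hd h2]; split => // /hA hy.
  by move: h2; rewrite hy// eqxx.
have [rho2 rho20 hrho2] : exists2 rho2 : R, 0 < rho2 & forall y, nm (y - y1) < rho2 ->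
    nm (y - y1) < rho1 /\ nm (y + sg l y *: v - a) < e.
  by have [d d0 hd] := (nbhs_nm _ _).1 (filterI (near_nm y1 r10) cn); exists d.
suff key y3 : nm (y3 - y1) < rho2 / 4 -> A (y3 + sg l y3 *: v).
  apply/nbhs_nm; exists (rho2 / 4); first by rewrite divr_gt0.
  by move=> y /key.
move=> hy3.
have e4 : 0 < Num.min (rho2 / 4) e by rewrite lt_min ee0 divr_gt0.
have [b [hb Ab Hb]] := h_dense HA ar Aa e4.
move: hb; rewrite lt_min => /andP[hb1 hb2].
pose yb0 := b - l *: v.
have bE : b = yb0 + l *: v by rewrite subrK.
have hyb : nm (yb0 - y1) < rho2 / 4 by rewrite /yb0 addrAC -addrA -opprD.
have hyb2 : nm (yb0 - y1) < rho2 by apply: lt_le_trans hyb _; rewrite ler_pdivrMr// ler_pMr// ler1n.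
have [hyb1 _] := hrho2 _ hyb2.
have ybp := inb _ hyb1.
have br : nm (b - p) < r by rewrite bE; apply: (w_dom W ybp); exact: ltW.
have lZb : l \in Z yb0.
  apply/(mem_zero_list W) => //; split; first exact: ltW.
  by rewrite -bE; exact: (h_sub HA).
have sgb : sg l yb0 = l by apply/esym/uq => //; rewrite subrr mx0.
rewrite bE in Ab Hb.
have pers := A_persist HA ybp lZb Ab Hb e00.
have near_b : \forall x \near yb0, A (x + sg l x *: v).
  apply: filterS (filterI pers (ball_near hyb1)) => x [[z hz [zZ Az]] hx].
  by rewrite -(uq l x z).
(* identity theorem along the segment from yb0 to y3 *)
set u := y3 - yb0.
have nu : nm u <= rho2 / 2.
  apply: (le_trans (nm_tri _ y1 _)); rewrite [nm (y1 - _)]nmC; lra.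
have xin (t : C) : nm (t - 0) <= 3 / 2 -> nm (yb0 + t *: u - y1) < rho2.
  rewrite subr0 => ht; rewrite addrAC; apply: le_lt_trans (nmD _ _) _; rewrite nmZ.
  have : nm t * nm u <= 3 / 2 * (rho2 / 2) by apply: ler_pM; rewrite ?nm_ge0.
  lra.
have y3E : y3 = yb0 + (1 : C) *: u by rewrite /u scale1r addrC subrK.
have in1 : nm ((1 : C) - 0) < 3 / 2 by rewrite subr0 nm1; lra.
have ay3 : nm (y3 + sg l y3 *: v - a) < e.
  by apply: (hrho2 y3 _).2; rewrite [X in nm (X - y1)]y3E; apply: xin; exact: ltW.
apply/hA => // j.
have holF (t : C) : nm (t - 0) <= 3 / 2 ->
    hol (fun t : C => F j (yb0 + t *: u + sg l (yb0 + t *: u) *: v)) t.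
  move=> ht; have hx := xin t ht; have [hx1 hx2] := hrho2 _ hx.
  have [_ hs] := shol l lZ _ hx1.
  have hFx := mholb_shrink (hF j) hx2.
  have rx : 0 < e - nm (yb0 + t *: u + sg l (yb0 + t *: u) *: v - a) by rewrite subr_gt0.
  have := mhol_curve hFx rx (hs u).
  exact: (line_shift t yb0 u (fun y => F j (y + sg l y *: v))).2.
have F0 : \forall t \near (0 : C), F j (yb0 + t *: u + sg l (yb0 + t *: u) *: v) = 0.
  have nb2 : \forall x \near yb0, nm (x - y1) < rho2 by exact: ball_near.
  apply: filterS (near_line u (filterI near_b nb2)) => t [At xt].
  by have [_ h] := hrho2 _ xt; exact: ((hA _ h).1 At j).
have p32 : 0 < (3 / 2 : R) by rewrite divr_gt0.
have := @identity_rado R (fun t => F j (yb0 + t *: u + sg l (yb0 + t *: u) *: v)) 0 (3 / 2) p32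
  (fun z hz => hol_cont (holF z hz)) (fun z hz _ => holF z (ltW hz)) F0 1 in1.
by rewrite -y3E.
Qed.

Lemma Z0 y : nm (y - p) < rho -> f y = 0 -> 0 \in Z y.
Proof.
move=> yb fy; apply/(mem_zero_list W) => //; split; first by rewrite mx0 ltW// (w_s W).
by rewrite scale0r addr0.
Qed.

Lemma in_r y : nm (y - p) < rho -> nm (y - p) < r.
Proof.
move=> yb; have := w_dom W yb (z := 0); rewrite scale0r addr0; apply.
by rewrite mx0 ltW// (w_s W).
Qed.

(** That a fiber avoids A is locally constant on the good locus. If it occurred at one
    good point near p, the discriminant of the good fibers that avoid A would be a
    barrier that is not identically 0, whereas it vanishes near some good points close
    to p, where A is met. *)
Lemma fiber_nonempty A : hyperset f A p r -> A p -> forall y, good y -> nm (y - p) < rho / 8 ->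
  exists2 a, a \in Z y & A (y + a *: v).
Proof.
move=> HA Ap y gy hy.
pose X y := ~ exists2 a, a \in Z y & A (y + a *: v).
have lX : locconst f v p s rho k X.
  move=> y1 [y1b sy1]; have [rho1 [sg [r10 hsg [sg1 uq] hsh]]] := good_sheets W hk y1b sy1.
  have inb x : nm (x - y1) < rho1 -> nm (x - p) < rho by move=> /hsg[].
  have hA := near_all (fun l lZ => A_sheet HA y1b r10 inb sg1 uq hsh (l := l) lZ).
  apply: filterS (filterI hA (near_nm y1 r10)) => x [hx xr].
  have [xb sx pe] := hsg x xr.
  suff E : (exists2 a, a \in Z x & A (x + a *: v)) <-> (exists2 a, a \in Z y1 & A (y1 + a *: v)).
    by split=> h1 h2; apply: h1; apply/E.
  split=> [[z]|[l lZ Al]].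
    by rewrite (perm_mem pe) => /mapP[l lZ ->] /(hx l lZ) Al; exists l.
  exists (sg l x); last exact/hx.
  by rewrite (perm_mem pe); apply/mapP; exists l.
have rho0 := w_rho W.
have pp : nm (p - p) < r by apply: in_r; rewrite subrr nm0.
have r16 : 0 < rho / 16 by rewrite divr_gt0.
have [b [hb Ab Hb]] := h_dense HA pp Ap r16.
have bb : nm (b - p) < rho by lra.
have bb8 : nm (b - p) < rho / 8 by lra.
have fb : f b = 0 by apply: (h_sub HA) => //; exact: in_r.
have bz : b + 0 *: v = b by rewrite scale0r addr0.
have Ab' : A (b + (0 : C) *: v) by rewrite bz.
have Hb' : hyp_at A (b + (0 : C) *: v) by rewrite bz.
have pers := A_persist HA bb (Z0 bb fb) Ab' Hb' ltr01.
have [d d0 hd] := (nbhs_nm _ _).1 pers.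
have e0 : 0 < Num.min d (rho / 16) by rewrite lt_min d0.
have [y1 gy1] := good_dense W hk hdens bb8 e0.
rewrite lt_min => /andP[/hd[z _ [zZ Az]] y1b].
have y18 : nm (y1 - p) < rho / 8.
  apply: le_lt_trans (nm_tri _ b _) _; lra.
have nX1 : ~ X y1 by apply; exists z.
have near0 : \forall x \near y1, sheet_disc f v p s rho k X x = 0.
  apply: filterS (lX y1 gy1) => x hx; apply: contrapT => /eqP /sheet_disc_neq0[_ /hx].
  exact: nX1.
have d0y := barrier_identity W (sheet_disc_barrier W hk lX) y18 hy near0.
apply: contrapT => Xy.
by have /sheet_disc_neq0 : good y /\ X y by []; rewrite d0y eqxx.
Qed.

Lemma Im_sum_ge0 (I : eqType) (t : seq I) (F : I -> C) :
  (forall i, i \in t -> 0 <= complex.Im (F i)) -> 0 <= complex.Im (\sum_(i <- t) F i) /\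
  (complex.Im (\sum_(i <- t) F i) = 0 -> forall i, i \in t -> complex.Im (F i) = 0).
Proof.
elim: t => [|i t IH] h; first by rewrite big_nil.
have [h1 h2] : 0 <= complex.Im (\sum_(i <- t) F i) /\
  (complex.Im (\sum_(i <- t) F i) = 0 -> forall i, i \in t -> complex.Im (F i) = 0).
  by apply: IH => j jt; apply: h; rewrite inE jt orbT.
have h0 := h i (mem_head _ _).
rewrite big_cons ImD; split; first exact: addr_ge0.
move=> /eqP; rewrite paddr_eq0// => /andP[/eqP e1 /eqP e2] j.
by rewrite inE => /predU1P[->//|]; exact: h2.
Qed.

Lemma nm_sum (I : eqType) (t : seq I) (F : I -> C) (M : R) :
  (forall i, i \in t -> nm (F i) <= M) -> nm (\sum_(i <- t) F i) <= (size t)%:R * M.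
Proof.
elim: t => [|i t IH] h; first by rewrite big_nil nm0 mul0r.
rewrite big_cons; apply: (le_trans (nmD _ _)); rewrite [size _]/= -natr1 mulrDl mul1r addrC.
by apply: lerD; [apply: IH => j jt; apply: h; rewrite inE jt orbT|apply: h; rewrite mem_head].
Qed.

Variables (A B : V -> Prop).
Hypotheses (HA : hyperset f A p r) (HB : hyperset f B p r).
Hypotheses (Ap : A p) (Bp : B p).
Hypothesis Zp : forall z, mx z <= s -> f (p + z *: v) = 0 -> z = 0.
Hypothesis sep : forall y (a b : C) (t : R), nm (y - p) < rho -> mx a <= s -> mx b <= s ->
  A (y + a *: v) -> B (y + b *: v) -> b - a = ofR t -> t <= 0.

(** Summing over all pairs makes this a function of y, although the points of the fiber
    have no global labelling; sqrtC is the branch with nonnegative imaginary part, so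
    that nothing cancels in the imaginary part of the sum. *)
Definition root_sum y : C := \sum_(a <- Z y) \sum_(b <- Z y)
  (if `[< A (y + a *: v) >] && `[< B (y + b *: v) >] then sqrtC (b - a) else 0).

Lemma Im_root_sum y : 0 <= complex.Im (root_sum y) /\ (complex.Im (root_sum y) = 0 -> forall a b : C, a \in Z y -> b \in Z y ->
  A (y + a *: v) -> B (y + b *: v) -> complex.Im (sqrtC (b - a)) = 0).
Proof.
pose F (a b : C) : C := if `[< A (y + a *: v) >] && `[< B (y + b *: v) >] then sqrtC (b - a) else 0.
have F0 (a b : C) : 0 <= complex.Im (F a b).
  by rewrite /F; case: ifP => // _; exact: Im_sqrtC_ge0.
have G0 (a : C) : 0 <= complex.Im (\sum_(b <- Z y) F a b) /\ (complex.Im (\sum_(b <- Z y) F a b) = 0 ->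
    forall b, b \in Z y -> complex.Im (F a b) = 0).
  by apply: Im_sum_ge0 => b _.
have [h1 h2] : 0 <= complex.Im (root_sum y) /\ (complex.Im (root_sum y) = 0 -> forall a, a \in Z y ->
    complex.Im (\sum_(b <- Z y) F a b) = 0).
  by apply: Im_sum_ge0 => a _; have [] := G0 a.
split => // e a b aZ bZ Aa Bb.
have := (G0 a).2 (h2 e a aZ) b bZ; rewrite /F.
by rewrite (asboolT Aa) (asboolT Bb).
Qed.

(** On the sheets the difference b - a never is a positive real, so the square root is
    holomorphic along it, except that a pair with a = b contributes the constant 0. *)
Lemma root_sum_hol y u : good y -> hol (fun t : C => root_sum (y + t *: u)) 0.
Proof.
move=> [yb sy]; have [rho1 [sg [r10 hsg [sg1 uq] hsh]]] := good_sheets W hk yb sy.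
have inb x : nm (x - y) < rho1 -> nm (x - p) < rho by move=> /hsg[].
have hA := near_all (fun l lZ => A_sheet HA yb r10 inb sg1 uq hsh (l := l) lZ).
have hB := near_all (fun l lZ => A_sheet HB yb r10 inb sg1 uq hsh (l := l) lZ).
have yy : nm (y - y) < rho1 by rewrite subrr nm0.
pose S' (t : C) : C := \sum_(a <- Z y) \sum_(b <- Z y)
  (if `[< A (y + a *: v) >] && `[< B (y + b *: v) >] then
     sqrtC (sg b (y + t *: u) - sg a (y + t *: u)) else 0).
apply: (@hol_near _ S').
  apply: filterS (near_line u (filterI (filterI hA hB) (near_nm y r10))) => t [[hxA hxB] xr].
  have [xb sx pe] := hsg _ xr.
  rewrite /root_sum (perm_big _ pe) big_map; apply: eq_big_seq => a aZ.
  rewrite (perm_big _ pe) big_map; apply: eq_big_seq => b bZ.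
  by rewrite (asbool_equiv_eq (hxA a aZ)) (asbool_equiv_eq (hxB b bZ)).
have sum_hol (t : seq C) (F : C -> C -> C) : (forall i, i \in t -> hol (F i) 0) ->
    hol (fun z => \sum_(i <- t) F i z) 0.
  elim: t => [|i t IH] h.
    by apply: (hol_near _ (hol_cst 0 0)); apply: filterE => z; rewrite big_nil.
  have h1 : hol (F i) 0 by apply: h; rewrite mem_head.
  have h2 : hol (fun z => \sum_(j <- t) F j z) 0.
    by apply: IH => j jt; apply: h; rewrite inE jt orbT.
  by apply: (hol_near _ (holD h1 h2)); apply: filterE => z; rewrite big_cons.
apply: (sum_hol) => a aZ; apply: (sum_hol) => b bZ.
case: (asboolP (A _)) => [Aa|_] /=; last exact: hol_cst.
case: (asboolP (B _)) => [Bb|_] /=; last exact: hol_cst.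
have [->|ba] := eqVneq b a.
  by apply: (hol_near _ (hol_cst (sqrtC 0) 0)); apply: filterE => t; rewrite subrr.
have [_ ha] := hsh a aZ y yy; have [_ hb] := hsh b bZ y yy.
apply: (hol_comp (holB (hb u) (ha u))); apply: hol_sqrtC.
rewrite scale0r addr0 !sg1// lt_neqAle Im_sqrtC_ge0 andbT eq_sym; apply/eqP => I0.
have [t t0 bat] := Im_sqrtC_eq0 I0.
have as' := ltW (zero_list_lt W yb aZ); have bs' := ltW (zero_list_lt W yb bZ).
have := sep yb as' bs' Aa Bb bat => t0'.
have tt : t = 0 by apply/eqP; rewrite eq_le t0' t0.
by move/eqP: bat; rewrite tt subr_eq0 (negbTE ba).
Qed.

(** The fiber over p being reduced to 0, root_sum is small at good points near p, and
    the Schwarz-Pick estimate carries this to y. The summand i e makes the imaginary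
    part positive. *)
Lemma root_sum_eq0 y : good y -> nm (y - p) < rho / 8 -> root_sum y = 0.
Proof.
move=> gy hy; pose K : R := 2 * (k%:R * (k%:R * 1) + 1) + 1.
have K0 : 0 < K by rewrite /K; have : 0 <= (k%:R : R) * (k%:R * 1) by rewrite mulr1 mulr_ge0.
suff key (e : R) : 0 < e -> nm (root_sum y) <= K * e.
  apply: nm_eq0; apply/eqP; rewrite eq_le nm_ge0 andbT leNgt; apply/negP => S0.
  have := key (nm (root_sum y) / (2 * K)).
  rewrite divr_gt0// ?mulr_gt0// => /(_ isT).
  have -> : K * (nm (root_sum y) / (2 * K)) = nm (root_sum y) / 2 by field; rewrite gt_eqF.
  lra.
move=> e0.
have eta0 : 0 < e ^+ 2 / 4 by rewrite divr_gt0// exprn_gt0.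
have pp : nm (p - p) < rho by rewrite subrr nm0 (w_rho W).
have [d d0 hd] := (nbhs_nm _ _).1 (zero_list_confine W pp eta0).
have m0 : 0 < Num.min d (rho / 8) by rewrite lt_min d0 divr_gt0// (w_rho W).
have [y1 [hy1 y1b sy1]] := hdens m0.
move: hy1; rewrite lt_min => /andP[/hd hz y18].
have gy1 : good y1 by [].
have small (a : C) : a \in Z y1 -> mx a < e ^+ 2 / 4.
  move=> /hz[l lZ]; have [ls fl] := (mem_zero_list W l pp).1 lZ.
  by rewrite (Zp ls fl) subr0.
have nS : nm (root_sum y1) <= k%:R * (k%:R * e).
  rewrite -sy1; apply: nm_sum => a aZ; apply: nm_sum => b bZ.
  case: ifP => _; last by rewrite nm0 ltW.
  rewrite -(@ler_pXn2r _ 2) ?nnegrE ?nm_ge0 ?(ltW e0)// nm_sqrtC.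
  apply: (le_trans (nmB _ _)); have := nm_mx a; have := nm_mx b.
  have := small a aZ; have := small b bZ; lra.
pose S' y := root_sum y + ('i)%C * ofR e.
have ni : nm ((('i)%C : C) * ofR e) = e by rewrite nmM nm_i mul1r nm_ofR ger0_norm// ltW.
have h := @harnack R V f p r v p s rho m k W hk S' y1 y.
have : nm (S' y) <= 2 * nm (S' y1).
  apply: h => //.
  - move=> x _; rewrite /S' ImD /= mul0r mul1r add0r; have [I0 _] := Im_root_sum x; lra.
  - by move=> x u gx; apply: (holD (root_sum_hol u gx)); exact: hol_cst.
have := nmB (S' y) (('i)%C * ofR e); have := nmD (root_sum y1) (('i)%C * ofR e).
rewrite -/(S' y1) /S' addrK ni => h1 h2 h3.
have -> : K * e = 2 * (k%:R * (k%:R * e) + e) + e by rewrite /K; ring.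
lra.
Qed.

(** The sum of the nonnegative imaginary parts is 0, so each square root is real and b -
    a is a nonnegative real; the separation hypothesis leaves only 0. *)
Lemma same_fiber y (a b : C) : good y -> nm (y - p) < rho / 8 -> a \in Z y -> b \in Z y ->
  A (y + a *: v) -> B (y + b *: v) -> a = b.
Proof.
move=> gy hy aZ bZ Aa Bb; have [_ h] := Im_root_sum y.
have I0 : complex.Im (sqrtC (b - a)) = 0.
  by apply: h => //; rewrite root_sum_eq0.
have [t t0 bat] := Im_sqrtC_eq0 I0.
have yb := proj1 gy.
have as' := ltW (zero_list_lt W yb aZ); have bs' := ltW (zero_list_lt W yb bZ).
have := sep yb as' bs' Aa Bb bat => t0'.
have tt : t = 0 by apply/eqP; rewrite eq_le t0' t0.
by move/eqP: bat; rewrite tt subr_eq0 => /eqP ->.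
Qed.

(** If a point x of A1 were not in B1, a neighbourhood of x would avoid B1; but near x
    there are good fibers meeting A1, hence B1. *)
Lemma incl_of_fibers A1 B1 : hyperset f A1 p r -> hyperset f B1 p r ->
  (forall y a, good y -> nm (y - p) < rho / 8 -> a \in Z y -> A1 (y + a *: v) -> B1 (y + a *: v)) ->
  forall x, nm (x - p) < rho / 16 -> A1 x -> B1 x.
Proof.
move=> H1 H2 inc x hx Ax; have rho0 := w_rho W.
have xb : nm (x - p) < rho by lra.
have xr := in_r xb.
have [e [J [F [e0 hF hB]]]] := h_eqs H2 xr.
have xx : nm (x - x) < e by rewrite subrr nm0.
apply/hB => // j; apply: contrapT => /eqP Fj.
have [cF _] := hF j x xx.
have [d d0 hd] := (nbhs_nm _ _).1 (cont_neq0 cF Fj).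
pose e' := Num.min (Num.min d e) (rho / 16).
have e'0 : 0 < e' by rewrite !lt_min d0 e0 divr_gt0.
have [[e1 e2] e3] : (e' <= d /\ e' <= e) /\ e' <= rho / 16.
  by rewrite /e' !ge_min !lexx ?orbT.
clearbody e'.
have noB y : nm (y - x) < e' -> ~ B1 y.
  move=> hy /(hB y (lt_le_trans hy e2)) /(_ j) Fy.
  by have := hd y (lt_le_trans hy e1); rewrite /= Fy eqxx.
have e'4 : 0 < e' / 4 by rewrite divr_gt0.
have [b [hb Ab Hb]] := h_dense H1 xr Ax e'4.
have bp : nm (b - p) < rho / 8 by apply: le_lt_trans (nm_tri _ x _) _; lra.
have bb : nm (b - p) < rho by lra.
have fb : f b = 0 by apply: (h_sub H1) => //; exact: in_r.
have bz : b + 0 *: v = b by rewrite scale0r addr0.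
have Ab' : A1 (b + (0 : C) *: v) by rewrite bz.
have Hb' : hyp_at A1 (b + (0 : C) *: v) by rewrite bz.
have v1 : 0 < nm v + 1 by rewrite ltr_wpDl ?nm_ge0.
pose q := e' / (8 * (nm v + 1)).
have q0 : 0 < q by rewrite divr_gt0// mulr_gt0.
have pers := A_persist H1 bb (Z0 bb fb) Ab' Hb' q0.
have [d1 d10 hd1] := (nbhs_nm _ _).1 pers.
have m0 : 0 < Num.min d1 (Num.min (e' / 4) (rho / 8 - nm (b - p))).
  by rewrite !lt_min d10 e'4 subr_gt0.
have [y gy] := good_dense W hk hdens bp m0.
rewrite !lt_min => /andP[/hd1[z zq [zZ Az]] /andP[yb1 yb2]].
rewrite subr0 in zq.
have yp : nm (y - p) < rho / 8.
  by apply: le_lt_trans (nm_tri _ b _) _; rewrite -ltrBrDr.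
apply: (noB (y + z *: v)); last exact: inc.
have yx : nm (y - x) < e' / 2 by apply: le_lt_trans (nm_tri _ b _) _; lra.
apply: (nm_shift yx (ltW zq)).
by rewrite le_eqVlt; apply/orP; left; apply/eqP; rewrite /q; field; rewrite gt_eqF.
Qed.

Theorem coincide x : nm (x - p) < rho / 16 -> (A x <-> B x).
Proof.
move=> hx; split.
- apply: (incl_of_fibers HA HB _ hx) => y a gy hy aZ Aa.
  have [b bZ Bb] := fiber_nonempty HB Bp gy hy.
  by rewrite (same_fiber gy hy aZ bZ Aa Bb).
- apply: (incl_of_fibers HB HA _ hx) => y b gy hy bZ Bb.
  have [a aZ Aa] := fiber_nonempty HA Ap gy hy.
  by rewrite -(same_fiber gy hy aZ bZ Aa Bb).
Qed.

End Main.
End AnalyticSets.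

Section Germs.
Variable R : realType.
Local Notation C := (Cx R).

Section Abstract.
Variable V : normedModType C.
Implicit Types (A B : V -> Prop) (x y u w : V) (f g : V -> C).

Lemma weierstrass_shrink f c r v p s rho rho' m : 0 < rho' -> rho' <= rho ->
  weierstrass f c r v p s rho m -> weierstrass f c r v p s rho' m.
Proof.
move=> h1 h2 [a1 a2 a3 a4 a5 a6].
have le y : nm (y - p) < rho' -> nm (y - p) < rho by move=> h; exact: lt_le_trans h2.
split=> //.
- by move=> y z /le; exact: a4.
- by move=> y z /le; exact: a5.
- by move=> y L /le; exact: a6.
Qed.

(** For k take the largest number of zeros that is attained arbitrarily close to p, and
    then shrink the ball until no fiber has more. *)
Lemma max_fiber f r v p s rho m : weierstrass f p r v p s rho m -> exists rho' k,
  [/\ 0 < rho', rho' <= rho, (forall y, nm (y - p) < rho' -> (size (zero_list f v s y) <= k)%N) &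
   forall e : R, 0 < e -> exists y : V, [/\ nm (y - p) < e, nm (y - p) < rho' & size (zero_list f v s y) = k]].
Proof.
move=> W; have rho0 := w_rho W.
pose P n := `[< forall e : R, 0 < e -> exists y : V, [/\ nm (y - p) < e, nm (y - p) < rho & (n <= size (zero_list f v s y))%N] >].
have P0 : exists n, P n.
  by exists 0%N; apply/asboolP => e e0; exists p; rewrite subrr nm0.
have Pm n : P n -> (n <= m)%N.
  move=> /asboolP/(_ 1 ltr01)[y [_ yb h]]; apply: (leq_trans h).
  apply: (w_cnt W yb (zero_list_uniq W yb)) => l lZ.
  exact: (mem_zero_list W l yb).1.
case: (ex_maxnP P0 Pm) => k /asboolP hk1 hk2.
have [e e0 he] : exists2 e : R, 0 < e & forall y, nm (y - p) < e -> nm (y - p) < rho -> (size (zero_list f v s y) <= k)%N.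
  apply: contrapT => nex; have /hk2 : P k.+1; last by rewrite ltnn.
  apply/asboolP => e e0; apply: contrapT => nex2; apply: nex; exists e => // y h1 h2.
  by rewrite leqNgt; apply/negP => h3; apply: nex2; exists y.
exists (Num.min e rho), k; split.
- by rewrite lt_min e0.
- by rewrite ge_min lexx orbT.
- by move=> y; rewrite lt_min => /andP[]; exact: he.
- move=> e1 e10; have m0 : 0 < Num.min e1 (Num.min e rho) by rewrite !lt_min e10 e0.
  have [y [h1 h2 h3]] := hk1 _ m0.
  move: h1; rewrite !lt_min => /and3P[h4 h5 h6].
  exists y; split => //; first by rewrite lt_min h5.
  by apply/eqP; rewrite eqn_leq h3 he.
Qed.

(** The ball is shrunk so that the good points, those with the maximal number of zeros,
    accumulate at p. *)
Theorem coincide_near f A B p v (r : R) : 0 < r -> mholb f p r ->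
  (forall e : R, 0 < e -> exists2 z : C, nm z < e & f (p + z *: v) != 0) ->
  hyperset f A p r -> hyperset f B p r -> A p -> B p ->
  (forall x (t : R), nm (x - p) < r -> nm (x + ofR t *: v - p) < r -> A x -> B (x + ofR t *: v) -> t <= 0) ->
  \forall x \near p, A x <-> B x.
Proof.
move=> r0 hf nz HA HB Ap Bp sep.
have [s [rho [m [s1 W0 Zp]]]] := weierstrass_exists r0 hf nz ltr01.
have [rho' [k [r'0 r'1 hk hd]]] := max_fiber W0.
have W := weierstrass_shrink r'0 r'1 W0.
apply/nbhs_nm; exists (rho' / 16); first by rewrite divr_gt0.
move=> x; apply: (coincide W hk hd HA HB Ap Bp Zp) => y a b t yb a1 b1 Aa Bb e.
have E : y + b *: v = y + a *: v + ofR t *: v.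
  by rewrite -addrA -scalerDl -e [a + _]addrC subrK.
rewrite E in Bb; apply: (sep (y + a *: v)) => //; first exact: (w_dom W yb).
by rewrite -E; exact: (w_dom W yb).
Qed.

(** A function of one variable that does not vanish identically near 0 has only isolated
    zeros. *)
Lemma line_nz f p v (r : R) (t : C) : 0 < r -> mholb f p r -> nm t * (nm v + 1) < r / 2 ->
  f (p + t *: v) != 0 -> exists2 d : R, 0 < d & forall z : C, z != 0 -> nm z < d -> f (p + z *: v) != 0.
Proof.
move=> r0 hf ht ft.
have v1 : 0 < nm v + 1 by rewrite ltr_wpDl ?nm_ge0.
pose r1 := r / (nm v + 1).
have r10 : 0 < r1 by rewrite divr_gt0.
have hh : holb (fun z : C => f (p + z *: v)) 0 r1.
  move=> z; rewrite subr0 => hz; apply: mhol_line; apply: hf.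
  rewrite addrAC subrr add0r nmZ; move: hz; rewrite ltr_pdivlMr//; apply: le_lt_trans.
  by apply: ler_wpM2l; [exact: nm_ge0|rewrite lerDl].
have [hz|[m [g [g1 g2 g3]]]] := finite_order r10 hh.
  by move: ft; rewrite hz ?eqxx// subr0 /r1 mulrAC ltr_pdivlMr.
have g0 := g1 0; rewrite subr0 nm0 in g0.
have [d d0 hd] := (nbhs_nm _ _).1 (cont_neq0 (hol_cont (g0 r10)) g2).
exists d => // z z0 hz; rewrite g3 subr0 mulf_neq0 ?expf_neq0//.
by apply: hd; rewrite subr0.
Qed.

End Abstract.
End Germs.

(** * Germs of hypersurfaces *)

Section HypersurfaceGerms.
Variables (R : realType) (n : nat).
Local Notation C := (Cx R).
Local Notation V := 'rV[C]_n.+1.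
Implicit Types (A B U W : set V) (p y v : V).

Lemma mhol_coord d (F : V -> 'rV[C]_d) y j : differentiable F y -> mhol (fun x => F x 0 j) y.
Proof.
move=> dF; split.
  exact: (continuous_comp (differentiable_continuous dF) (@coord_continuous C 1 d 0 j (F y))).
move=> u.
have /cvg_ex[l hl] : derivable F y u by exact: diff_derivable.
have hc := cvg_comp _ _ hl (@coord_continuous C 1 d 0 j l).
exists (fun t : C => if t == 0 then l 0 j else (F (y + t *: u) 0 j - F y 0 j) / t); last first.
  move=> t; rewrite scale0r addr0 subr0; case: eqVneq => [->|t0].
    by rewrite scale0r addr0 mul0r addr0.
  by rewrite [t * _]mulrC divfK// addrCA subrr addr0.
apply/contP => e e0.
have nl : nbhs (l 0 j : C) [set z : C | nm (z - l 0 j : C) < e] by exact: (near_nm (l 0 j : C) e0).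
have [d' d0 hd] := (nbhs_nm (0 : C) _).1 (hc _ nl); exists d' => // t ht; rewrite eqxx.
case: eqVneq => [_|t0]; first by rewrite subrr nm0.
have := hd t ht t0 => /=; rewrite [t *: u + y]addrC !mxE [t^-1 * _]mulrC.
exact.
Qed.

Lemma open_ball U p : open U -> U p -> exists2 r : R, 0 < r & forall y, nm (y - p) < r -> U y.
Proof. by move=> oU Up; apply/nbhs_nm; exact: open_nbhs_nbhs. Qed.

Lemma analytic_eqs U A a : analytic_subset U A -> U a ->
  exists2 e : R, 0 < e & exists m (F : V -> 'rV[C]_m), (forall j, mholb (fun y => F y 0 j) a e) /\
    forall y, nm (y - a) < e -> (A y <-> forall j, F y 0 j = 0).
Proof.
move=> [_ h] /h[W [m [F [oW Wa _ hF AE]]]].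
have [e e0 he] := open_ball oW Wa; exists e => //; exists m, F; split.
  by move=> j y /he/hF; exact: mhol_coord.
move=> y /he Wy; have := congr1 (fun S : set V => S y) AE => /= E; split.
  move=> Ay j; have [_ ->] : W y /\ F y = 0 by rewrite -E.
  by rewrite mxE.
move=> Fy; suff [] : A y /\ W y by [].
by rewrite E; split => //; apply/rowP => j; rewrite Fy mxE.
Qed.

(** Near a regular point of dimension n the equation of A has a single component, since
    n + d = n + 1. Regular points are dense by the definition of the dimension. *)
Lemma pure_hyperset f A p : complex_hypersurface_germ p A -> exists U, [/\ open U, U p & 
   forall r : R, (forall y, nm (y - p) < r -> U y) -> 
   (forall y, nm (y - p) < r -> A y -> f y = 0) -> hyperset f A p r].
Proof.
move=> [Ap [U [oU Up anA pdA]]]; exists U; split => // r rU fA.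
have AU b : U b -> \forall y \near b, A y <-> (A `&` U) y.
  move=> Ub; have nU : nbhs b U by exact: open_nbhs_nbhs.
  by apply: filterS nU => y Uy; split => [|[]].
split=> //.
- move=> a /rU Ua; have [e e0 [m [F [hF hA]]]] := analytic_eqs anA Ua.
  have [e' e'0 he'] := open_ball oU Ua.
  exists (Num.min e e'), 'I_m, (fun j y => F y 0 j); split.
  + by rewrite lt_min e0.
  + by move=> j y; rewrite lt_min => /andP[h _]; exact: hF.
  + move=> y; rewrite lt_min => /andP[h1 /he' h2]; rewrite -hA//.
    by split => [|[]].
- move=> a /rU Ua Aa e e0.
  have [_ cl] := pdA a (conj Aa Ua).
  have nb : nbhs a [set y | nm (y - a) < e] by apply/nbhs_nm; exists e.
  have [b [[[Ab Ub] [d [W [F [nd [oW Wb] hF _ AE]]]]] /= hb]] := cl _ nb.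
  exists b; split => //.
  have d1 : d = 1%N by move: nd; rewrite -addn1 => /addnI.
  subst d.
  have [e1 e10 he1] := open_ball oW Wb.
  have [e' e'0 he'] := open_ball oU Ub.
  exists (Num.min e1 e'), (fun y => F y 0 0); split.
  + by rewrite lt_min e10.
  + by move=> y; rewrite lt_min => /andP[/he1/hF h _]; exact: mhol_coord.
  + move=> y; rewrite lt_min => /andP[/he1 Wy /he' Uy].
    have := congr1 (fun S : set V => S y) AE => /= E; split.
      move=> Ay; have [_ ->] : W y /\ F y = 0 by rewrite -E.
      by rewrite mxE.
    move=> Fy; suff [[]] : (A y /\ U y) /\ W y by [].
    by rewrite E; split => //; apply/rowP => j; rewrite ord1 Fy mxE.
Qed.

(** Since the line leaves A arbitrarily close to p, some component of the equations of A
    near p does not vanish identically on it. *)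
Lemma line_equation A p v : complex_hypersurface_germ p A ->
  (forall e : R, 0 < e -> exists2 t : C, nm t < e & ~ A (p + t *: v)) ->
  exists f (r d : R), [/\ 0 < r /\ mholb f p r, forall y, nm (y - p) < r -> A y -> f y = 0,
    0 < d & forall z : C, z != 0 -> nm z < d -> f (p + z *: v) != 0].
Proof.
move=> [Ap [U [oU Up anA _]]] hv.
have [e e0 [m [F [hF hA]]]] := analytic_eqs anA Up.
have [e' e'0 he'] := open_ball oU Up.
pose r := Num.min e e'.
have r0 : 0 < r by rewrite lt_min e0.
have [r1 r2] : r <= e /\ r <= e' by rewrite /r !ge_min !lexx orbT.
have v1 : 0 < nm v + 1 by rewrite ltr_wpDl ?nm_ge0.
have e1 : 0 < r / 2 / (nm v + 1) by rewrite !divr_gt0.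
have [t ht nA] := hv _ e1.
rewrite ltr_pdivlMr// in ht.
have tb : nm (p + t *: v - p) < r.
  rewrite addrAC subrr add0r nmZ; apply: (@le_lt_trans _ _ (nm t * (nm v + 1))).
    by apply: ler_wpM2l; [exact: nm_ge0|rewrite lerDl].
  by apply: lt_trans ht _; rewrite ltr_pdivrMr// ltr_pMr// ltr1n.
have [j Fj] : exists j, F (p + t *: v) 0 j != 0.
  apply: contrapT => nex; apply: nA.
  suff [] : (A `&` U) (p + t *: v) by [].
  apply/hA; first exact: lt_le_trans r1.
  by move=> j; apply: contrapT => /eqP h; apply: nex; exists j.
have hf : mholb (fun y => F y 0 j) p r.
  by move=> y hy; apply: hF; exact: lt_le_trans r1.
have [d d0 hd] := line_nz r0 hf ht Fj.
exists (fun y => F y 0 j), r, d; split => // y hy Ay.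
suff : (A `&` U) y by move=> /(hA y (lt_le_trans hy r1)); apply.
by split => //; apply: he'; exact: lt_le_trans r2.
Qed.

(** The germs lie on either side of the zero set of sg, and sg increases along v: hence
    the line p + C v leaves A through p - t v and B through p + t v, and no point of B
    is above a point of A. *)
Theorem two_sided_coincide A B p v (r0 : R) (sg : V -> R) : 0 < r0 ->
  complex_hypersurface_germ p A -> complex_hypersurface_germ p B ->
  (forall x (t : R), nm (x - p) < r0 -> nm (x + ofR t *: v - p) < r0 -> 0 < t ->
     sg x < sg (x + ofR t *: v)) ->
  sg p = 0 ->
  (forall x, nm (x - p) < r0 -> A x -> 0 <= sg x) ->
  (forall x, nm (x - p) < r0 -> B x -> sg x <= 0) ->
  \forall x \near p, A x <-> B x.
Proof.
move=> r00 hA hB mono sp hAs hBs.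
have v1 : 0 < nm v + 1 by rewrite ltr_wpDl ?nm_ge0.
have pp : nm (p - p) < r0 by rewrite subrr nm0.
have small (e : R) : 0 < e -> exists t : R, [/\ 0 < t, t < e, nm (p + ofR t *: v - p) < r0 &
    nm (p + ofR (- t) *: v - p) < r0].
  move=> e0; pose t := Num.min e (r0 / (nm v + 1)) / 2.
  have m0 : 0 < Num.min e (r0 / (nm v + 1)) by rewrite lt_min e0 divr_gt0.
  have t0 : 0 < t by rewrite divr_gt0.
  have : t < Num.min e (r0 / (nm v + 1)) by rewrite /t; lra.
  rewrite lt_min ltr_pdivlMr// => /andP[t1 t2]; exists t.
  have h : t * nm v < r0.
    by apply: le_lt_trans t2; apply: ler_wpM2l; [exact: ltW|rewrite lerDl].
  split => //; rewrite addrAC subrr add0r nmZ nm_ofR ?normrN ger0_norm//; exact: ltW.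
have offA (e : R) : 0 < e -> exists2 t : C, nm t < e & ~ A (p + t *: v).
  move=> /small[t [t0 te h1 h2]]; exists (ofR (- t)).
    by rewrite nm_ofR normrN ger0_norm// ltW.
  move: h2; have : p + ofR (- t) *: v + ofR t *: v = p.
    by rewrite -addrA -scalerDl -ofRD addNr ofR0 scale0r addr0.
  move: (p + ofR (- t) *: v) => q E h2 Aq.
  have h3 : nm (q + ofR t *: v - p) < r0 by rewrite E.
  have := mono _ _ h2 h3 t0; rewrite E sp ltNge => /negP; apply; exact: hAs.
have offB (e : R) : 0 < e -> exists2 t : C, nm t < e & ~ B (p + t *: v).
  move=> /small[t [t0 te h1 h2]]; exists (ofR t).
    by rewrite nm_ofR ger0_norm// ltW.
  by move=> /(hBs _ h1); apply/negP; rewrite -ltNge -sp; exact: (mono _ _ pp h1 t0).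
have [f [rA [dA [[rA0 hf] fA dA0 nA]]]] := line_equation hA offA.
have [g [rB [dB [[rB0 hg] gB dB0 nB]]]] := line_equation hB offB.
pose h y := f y * g y.
have [UA [oA UAp HA]] := pure_hyperset h hA.
have [UB [oB UBp HB]] := pure_hyperset h hB.
have [sA sA0 hsA] := open_ball oA UAp.
have [sB sB0 hsB] := open_ball oB UBp.
pose r := Num.min r0 (Num.min (Num.min rA rB) (Num.min sA sB)).
have r_gt0 : 0 < r by rewrite !lt_min r00 rA0 rB0 sA0.
have [q0 [q1 [q2 [q3 q4]]]] : r <= r0 /\ r <= rA /\ r <= rB /\ r <= sA /\ r <= sB.
  by rewrite /r !ge_min !lexx !orbT.
clearbody r.
have w y (q : R) : r <= q -> nm (y - p) < r -> nm (y - p) < q by move=> h1 h2; exact: lt_le_trans h1.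
have hh : mholb h p r by move=> y hy; apply: mholM; [apply: hf|apply: hg]; exact: w hy.
apply: (@coincide_near R V h A B p v r) => //.
- move=> e e0; pose t := Num.min e (Num.min dA dB) / 2.
  have m0 : 0 < Num.min e (Num.min dA dB) by rewrite !lt_min e0 dA0.
  have t0 : 0 < t by rewrite divr_gt0.
  have : t < Num.min e (Num.min dA dB) by rewrite /t; lra.
  rewrite !lt_min => /and3P[t1 t2 t3].
  have nt : nm (ofR t : C) = t by rewrite nm_ofR ger0_norm// ltW.
  have tn : (ofR t : C) != 0 by rewrite -nm_gt0 nt.
  by exists (ofR t); rewrite ?nt// mulf_neq0// ?nA ?nB ?nt.
- apply: HA => y hy; first exact: (hsA y (w y _ q3 hy)).
  by move=> Ay; rewrite /h fA ?mul0r//; exact: w hy.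
- apply: HB => y hy; first exact: (hsB y (w y _ q4 hy)).
  by move=> By; rewrite /h gB ?mulr0//; exact: w hy.
- by have [] := hA.
- by have [] := hB.
- move=> x t hx ht Ax Bx; rewrite leNgt; apply/negP => t0.
  have x1 := w x _ q0 hx; have x2 := w _ _ q0 ht.
  have := lt_le_trans (le_lt_trans (hAs x x1 Ax) (mono x t x1 x2 t0)) (hBs _ x2 Bx).
  by rewrite ltxx.
Qed.

End HypersurfaceGerms.

(** * Real hypersurfaces as zero sets of increasing functions *)

Section Heights.
Variables (R : realType) (n : nat).
Local Notation C := (Cx R).
Local Notation V := 'rV[C]_n.+1.
Implicit Types (M : set V) (p v : V).

Lemma mx_cont (X T : topologicalType) (a b : nat) (F : X -> 'M[T]_(a, b)) x :
  (forall i j, {for x, continuous (fun y => F y i j)}) -> {for x, continuous F}.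
Proof.
move=> h P /= [Q hQ QP]; apply: filterS QP _.
have : \forall y \near x, forall i j, Q i j (F y i j).
  apply: filter_forall => i; apply: filter_forall => j.
  exact: (h i j _ (hQ i j)).
exact.
Qed.

Lemma real_coords_cont m (x : 'rV[C]_m) : {for x, continuous (@real_coords R m)}.
Proof.
have h1 : {for x, continuous (fun y : 'rV[C]_m => map_mx (@complex.Re R) y)}.
  apply: mx_cont => i j.
  rewrite (_ : (fun y => _) = (@complex.Re R : C -> R) \o (fun y : 'rV[C]_m => y i j)).
    exact: (continuous_comp (@coord_continuous C 1 m i j x) (@Re_cont R _)).
  by apply/funext => y; rewrite mxE.
have h2 : {for x, continuous (fun y : 'rV[C]_m => map_mx (@complex.Im R) y)}.
  apply: mx_cont => i j.
  rewrite (_ : (fun y => _) = (@complex.Im R : C -> R) \o (fun y : 'rV[C]_m => y i j)).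
    exact: (continuous_comp (@coord_continuous C 1 m i j x) (@Im_cont R _)).
  by apply/funext => y; rewrite mxE.
exact: (cvg_pair h1 h2).
Qed.

Lemma real_coords_near (x : V) (Q : _ -> Prop) : nbhs (real_coords x) Q ->
  exists2 r : R, 0 < r & forall z, nm (z - x) < r -> Q (real_coords z).
Proof.
move=> hQ; have h := @real_coords_cont n.+1 x Q hQ.
by apply: (nbhs_nm x _).1; exact: h.
Qed.

(** A function whose zero set is M near p, and which increases in the direction v; it
    plays the role of the coordinate transverse to M. *)
Record height M p v (r : R) (sg : V -> R) : Prop := Height {
  ht_pos : 0 < r;
  ht_cont : forall x, nm (x - p) < r -> {for x, continuous sg};
  ht_mono : forall x (t : R), nm (x - p) < r -> nm (x + ofR t *: v - p) < r -> 0 < t ->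
    sg x < sg (x + ofR t *: v);
  ht_zero : forall x, nm (x - p) < r -> (M x <-> sg x = 0) }.

Lemma affine_cont m (T : 'M[C]_(n.+1, m)) (b : 'rV[C]_m) (x : V) :
  {for x, continuous (fun z : V => z *m T + b)}.
Proof.
apply: mx_cont => i j; rewrite ord1.
rewrite (_ : (fun y => _) = (fun y : V => \sum_k y 0 k * T k j + b 0 j)); last first.
  by apply/funext => y; rewrite !mxE.
apply: (contD _ (cont_cst (b 0 j) x)).
have [s] := ubnP (size (index_enum 'I_n.+1)).
elim: (index_enum _) => [|k t IH] in s *; first by move=> _; apply: (cont_near _ (cont_cst (0 : C) x)); apply: filterE => y; rewrite big_nil.
move=> _; apply: (cont_near _ (contD (contM (@coord_continuous C 1 n.+1 0 k x) (cont_cst (T k j) x)) (IH (size t).+1 (ltnSn _)))).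
by apply: filterE => y; rewrite big_cons.
Qed.

Lemma graph_base_cont (x : V) : {for x, continuous (@graph_base R n)}.
Proof.
have h1 : {for x, continuous (fun z : V => real_coords (col' ord_max z))}.
  apply: (@continuous_comp _ _ _ (fun z : V => col' ord_max z) (@real_coords R n)); last exact: real_coords_cont.
  apply: mx_cont => i j.
  rewrite (_ : (fun y => _) = (fun y : V => y i (lift ord_max j))); first exact: coord_continuous.
  by apply/funext => y; rewrite mxE.
have h2 : {for x, continuous (fun z : V => complex.Re (z 0 ord_max))}.
  exact: (continuous_comp (@coord_continuous C 1 n.+1 0 ord_max x) (@Re_cont R _)).
exact: (cvg_pair h1 h2).
Qed.

(** In the given coordinates the function y_n - g increases at unit speed along the y_n
    axis, along which g is constant. *)
Lemma lipschitz_height M p : locally_lipschitz_graph M -> M p -> exists v r sg, height M p v r sg.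
Proof.
move=> hM /hM[U [T [b [g [[oU Up] uT lg MU]]]]].
have [r r0 hr] := open_ball oU Up.
pose w (z : V) := z *m T + b.
pose v : V := (('i)%C : C) *: delta_mx 0 ord_max *m invmx T.
have wv x (t : R) : w (x + ofR t *: v) = w x + (ofR t * ('i)%C) *: delta_mx 0 ord_max.
  rewrite /w mulmxDl addrAC; congr (_ + _).
  by rewrite -scalemxAl /v mulmxKV// scalerA.
have rint (t : R) : complex.Re (ofR t * ('i)%C : C) = 0 /\ complex.Im (ofR t * ('i)%C : C) = t.
  by rewrite /=; split; ring.
have base x (t : R) : graph_base (w (x + ofR t *: v)) = graph_base (w x).
  rewrite wv /graph_base; congr (_, _).
    congr (real_coords _); apply/rowP => j.
    by rewrite !mxE eq_sym (negbTE (neq_lift _ _)) andbF mulr0 addr0.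
  by have [h _] := rint t; rewrite !mxE !eqxx mulr1 ReD h addr0.
exists v, r, (fun z => complex.Im (w z 0 ord_max) - g (graph_base (w z))).
split=> //.
- move=> x /hr Ux.
  have h1 : {for x, continuous (fun z => complex.Im (w z 0 ord_max))}.
    have hw : {for x, continuous (fun z => w z 0 ord_max)}.
      by apply: (@continuous_comp _ _ _ w (fun z : V => z 0 ord_max)); [exact: affine_cont|exact: coord_continuous].
    exact: (continuous_comp hw (@Im_cont R _)).
  have h2 : {for x, continuous (fun z => g (graph_base (w z)))}.
    have hw : {for x, continuous (fun z => graph_base (w z))}.
      by apply: (@continuous_comp _ _ _ w (@graph_base R n)); [exact: affine_cont|exact: graph_base_cont].
    have [K K0 hK] := pinfty_ex_gt0 lg.
    apply: ((@cvgrPdist_lt R R V (nbhs x) (nbhs_filter x) (fun z => g (graph_base (w z))) (g (graph_base (w x)))).2).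
    move=> e e0; have eK : 0 < e / K by rewrite divr_gt0.
    have nU : nbhs x U by exact: open_nbhs_nbhs.
    have hn : \forall z \near x, `|graph_base (w x) - graph_base (w z)| < e / K := (@cvgrPdist_lt R _ V (nbhs x) (nbhs_filter x) (fun z => graph_base (w z)) (graph_base (w x))).1 hw _ eK.
    have hnU : \forall z \near x, U z /\ `|graph_base (w x) - graph_base (w z)| < e / K.
      exact: (filterI nU hn).
    rewrite near_simpl; apply: filterS hnU => z [Uz]; rewrite ltr_pdivlMr// mulrC; apply: le_lt_trans.
    by apply: (hK (graph_base (w x), graph_base (w z))); split; [exists x|exists z].
  exact: (cvgB h1 h2).
- move=> x t hx ht t0; rewrite base ltrD2r wv.
  by have [_ h] := rint t; rewrite [in X in _ < X]mxE ImD ltrDl !mxE !eqxx mulr1 h.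
- move=> x /hr Ux; rewrite MU//; split => [->|/eqP]; first by rewrite subrr.
  by rewrite subr_eq0 => /eqP.
Qed.

End Heights.

Section C1.
Variables (R : realType) (n : nat).
Local Notation C := (Cx R).
Local Notation V := 'rV[C]_n.+1.
Implicit Types (M : set V) (p v : V).

Lemma ball_segment (U : normedModType C) (x p v : U) (r s t : R) : 0 <= s <= t -> 0 < t ->
  nm (x - p) < r -> nm (x + ofR t *: v - p) < r -> nm (x + ofR s *: v - p) < r.
Proof.
move=> /andP[s0 st] t0 h1 h2; pose q := s / t.
have [q0 q1] : 0 <= q /\ q <= 1 by rewrite divr_ge0 ?(ltW t0)// ler_pdivrMr// mul1r.
have E : x + ofR s *: v - p = ofR (1 - q) *: (x - p) + ofR q *: (x + ofR t *: v - p).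
  rewrite [x + _ - p]addrAC [x + _ - p]addrAC [ofR q *: _]scalerDr addrA -scalerDl -ofRD subrK ofR1 scale1r.
  by rewrite scalerA -ofRM /q divfK ?gt_eqF.
rewrite E; apply: le_lt_trans (nmD _ _) _; rewrite !nmZ !nm_ofR !ger0_norm ?subr_ge0//.
have [->|qn] := eqVneq q 0; first by rewrite subr0 mul1r mul0r addr0.
have qp : 0 < q by rewrite lt_neqAle eq_sym qn.
have e1 : (1 - q) * nm (x - p) <= (1 - q) * r by apply: ler_wpM2l; rewrite ?subr_ge0// ltW.
have e2 : q * nm (x + ofR t *: v - p) < q * r by rewrite ltr_pM2l.
apply: lt_le_trans (ler_ltD e1 e2) _; rewrite -mulrDl subrK mul1r.
exact: lexx.
Qed.

Lemma pos_of_close (a b : R) : `|a - b| < a -> 0 < b.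
Proof. by move=> /ltr_normlW; rewrite ltrBlDr ltrDl. Qed.

(** A defining function of M has at p a nonzero differential; on a vector where it is
    positive it remains so near p, and the mean value theorem gives monotonicity. *)
Lemma C1_height M p : C1_hypersurface M -> M p -> exists v r sg, height M p v r sg.
Proof.
move=> hM Mp; have [W [rho [[oW Wp] drho crho nz MW]]] := hM p Mp.
set q0 := real_coords p in Wp.
have rp : rho q0 = 0 by apply/MW.
have [w dw] : exists w, 0 < 'd rho q0 w.
  have [w0 w0n] := nz q0 Wp rp.
  have [h|h] := ltP 0 ('d rho q0 w0); first by exists w0.
  by exists (- w0); rewrite linearN oppr_gt0 lt_neqAle w0n.
pose v : V := \row_j ((w.1 0 j +i* w.2 0 j)%C : C).
have rc x (t : R) : real_coords (x + ofR t *: v) = real_coords x + t *: w.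
  case: w {dw} @v => w1 w2 v; rewrite /real_coords; congr (_, _); apply/rowP => j; rewrite !mxE /=.
    by rewrite ReD /=; ring.
  by rewrite ImD /=; ring.
have nW : nbhs q0 W by exact: open_nbhs_nbhs.
have nd : nbhs q0 [set y | 0 < 'd rho y w].
  have h : \forall y \near q0, `|'d rho q0 w - 'd rho y w| < 'd rho q0 w :=
    (@cvgrPdist_lt R R _ (nbhs q0) (nbhs_filter q0) (fun y => 'd rho y w) ('d rho q0 w)).1 (crho q0 w Wp) _ dw.
  apply: filterS h => y h; exact: (pos_of_close h).
pose Q y := W y /\ 0 < 'd rho y w.
have nQ : nbhs q0 Q by exact: filterI.
have [r r0 hr] := real_coords_near nQ.
exists v, r, (rho \o @real_coords R n.+1); split => //.
- move=> x /hr[Wx _].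
  exact: (continuous_comp (@real_coords_cont R _ x) (differentiable_continuous (drho _ Wx))).
- move=> x t hx ht t0 /=; rewrite rc.
  set q := real_coords x.
  have seg (s : R) : s \in `[0, t]%R -> W (q + s *: w) /\ 0 < 'd rho (q + s *: w) w.
    rewrite in_itv /= => hs; rewrite -rc; apply: hr.
    exact: (ball_segment hs).
  have der (s : R) : W (q + s *: w) -> is_derive s 1 (fun s => rho (q + s *: w)) ('d rho (q + s *: w) w).
    move=> /drho ds.
    have E : (fun h : R => h^-1 *: (((fun s => rho (q + s *: w)) \o shift s) (h *: 1) - rho (q + s *: w))) =
       (fun h : R => h^-1 *: ((rho \o shift (q + s *: w)) (h *: w) - rho (q + s *: w))).
      apply/funext => h /=; congr (_ *: (rho _ - _)).
      by rewrite [h *: 1]mulr1 scalerDl addrCA.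
    apply: DeriveDef.
      by rewrite /derivable E; exact: diff_derivable.
    by rewrite /derive E; exact: deriveE.
  have [|||c hc e] := @MVT R (fun s => rho (q + s *: w)) (fun s => 'd rho (q + s *: w) w) 0 t.
  + exact: t0.
  + move=> s hs; apply: der; apply: (seg s _).1.
    by apply: subset_itv_oo_cc hs.
  + apply: derivable_within_continuous => s hs.
    by have [h _] := der s (seg s hs).1.
  + have hc' : c \in `[0, t]%R by exact: subset_itv_oo_cc hc.
    have [_ dc] := seg c hc'.
    rewrite -subr_gt0 -[X in _ - rho X]addr0 -(scale0r w) e subr0.
    exact: mulr_gt0.
- by move=> x /hr[Wx _]; exact: MW.
Qed.

End C1.

Section Sides.
Variables (R : realType) (n : nat).
Local Notation C := (Cx R).
Local Notation V := 'rV[C]_n.+1.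
Implicit Types (M D : set V) (p v x z : V).

Lemma segment_component D z v (t : R) : 0 <= t ->
  (forall s : R, 0 <= s <= t -> D (z + ofR s *: v)) -> connected_component D z (z + ofR t *: v).
Proof.
move=> t0 h; have cS : connected ((fun s : R => z + ofR s *: v) @` `[0, t]).
  apply: connected_continuous_connected; first exact: segment_connected.
  apply: continuous_subspaceT => s.
  have v1 : 0 < nm v + 1 by rewrite ltr_wpDl ?nm_ge0.
  move=> P /nbhs_nm[e e0 he].
  have e1 : 0 < e / (nm v + 1) by rewrite divr_gt0.
  apply/nbhs_normP; exists (e / (nm v + 1)) => // s' /= hs; apply: he.
  rewrite opprD addrACA subrr add0r -scalerBl -ofRB nmZ nm_ofR.
  move: hs; rewrite distrC ltr_pdivlMr//; apply: le_lt_trans.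
  by apply: ler_wpM2l; [exact: normr_ge0|rewrite lerDl].
apply: (connected_component_max _ _ cS).
- by exists 0; [rewrite /= in_itv /= lexx|rewrite ofR0 scale0r addr0].
- by move=> _ [s hs <-]; apply: h; move: hs; rewrite /= in_itv.
- by exists t => //; rewrite /= in_itv /= lexx t0.
Qed.

Lemma height_opp M p v (r : R) (sg : V -> R) : height M p v r sg ->
  height M p (- v) r (fun x => - sg x).
Proof.
move=> [r0 csg mono MZ]; split; first exact: r0.
- move=> x hx; exact: (cvgN (csg x hx)).
- move=> x t hx ht t0; rewrite ltrN2.
  have E : x + ofR t *: - v + ofR t *: v = x by rewrite scalerN subrK.
  have hE : nm (x + ofR t *: - v + ofR t *: v - p) < r by rewrite E.
  by have := mono _ t ht hE t0; rewrite E.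
- by move=> x hx; rewrite MZ//; split => [->|/eqP]; rewrite ?oppr0// oppr_eq0 => /eqP.
Qed.

(** Moving a fixed distance t along v increases sg; after this move the points close to
    p are close to p + t v, around which a whole ball lies in {sg > 0}. *)
Lemma positive_side M D p v (r : R) (sg : V -> R) : height M p v r sg -> M p ->
  (forall x, nm (x - p) < r -> ~ M x -> D x) ->
  exists s xp, [/\ 0 < s, s <= r & 
    forall z, nm (z - p) < s -> 0 < sg z -> connected_component D z xp].
Proof.
move=> [r0 csg mono MZ] Mp hD.
have D0 x : nm (x - p) < r -> 0 < sg x -> D x.
  by move=> hx sx; apply: hD => // /(MZ x hx) e; rewrite e ltxx in sx.
have pp : nm (p - p) < r by rewrite subrr nm0.
have sp : sg p = 0 by apply/MZ.
have v1 : 0 < nm v + 1 by rewrite ltr_wpDl ?nm_ge0.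
pose t := r / (2 * (nm v + 1)).
have t0 : 0 < t by rewrite divr_gt0// mulr_gt0.
have tv : nm (ofR t *: v) < r / 2.
  rewrite nmZ nm_ofR ger0_norm ?ltW// /t.
  have -> : r / 2 = r / (2 * (nm v + 1)) * (nm v + 1) by field; rewrite gt_eqF.
  by rewrite ltr_pM2l// ltrDl.
pose xp := p + ofR t *: v.
have hxp : nm (xp - p) < r by rewrite /xp addrAC subrr add0r; lra.
have sxp : 0 < sg xp by rewrite -sp; exact: (mono _ _ pp hxp t0).
have [d d0 hd] : exists2 d : R, 0 < d & forall x, nm (x - xp) < d -> 0 < sg x.
  have h := (@cvgrPdist_lt R R _ (nbhs xp) (nbhs_filter xp) _ _).1 (csg xp hxp) _ sxp.
  have [d d0 hd] := (nbhs_nm _ _).1 h; exists d => // x /hd; exact: pos_of_close.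
pose s := Num.min d (r / 2).
have s0 : 0 < s by rewrite lt_min d0 divr_gt0.
have [s1 s2] : s <= d /\ s <= r / 2 by rewrite /s !ge_min !lexx orbT.
clearbody s.
have sr : s < r by lra.
exists s, xp; split; [exact: s0|exact: ltW|move=> z hz sz].
have zr : nm (z - p) < r by exact: lt_trans sr.
have ztr : nm (z + ofR t *: v - p) < r.
  rewrite addrAC; apply: le_lt_trans (nmD _ _) _; rewrite (splitr r).
  exact: ltrD (lt_le_trans hz s2) tv.
have c1 : connected_component D z (z + ofR t *: v).
  apply: segment_component => [|q /andP[q0 qt]]; first exact: ltW.
  have qr : nm (z + ofR q *: v - p) < r.
    by apply: (ball_segment _ t0 zr ztr); rewrite q0.
  apply: (D0 _ qr); move: q0; rewrite le_eqVlt => /predU1P[<-|q0].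
    by rewrite ofR0 scale0r addr0.
  exact: lt_trans sz (mono _ _ zr qr q0).
apply: (connected_component_trans c1).
have E : xp = z + ofR t *: v + ofR 1 *: (p - z).
  by rewrite ofR1 scale1r addrAC [z + _]addrC subrK.
rewrite E; apply: segment_component; [exact: ler01|] => q /andP[q0 q1].
have E2 : z + ofR t *: v + ofR q *: (p - z) - xp = ofR (1 - q) *: (z - p).
  rewrite ofRB scalerBl ofR1 scale1r /xp -[p - z]opprB scalerN.
  by rewrite opprD addrACA [z + _ - _]addrAC addrACA addrN addr0.
have h2 : nm (z + ofR t *: v + ofR q *: (p - z) - xp) < s.
  rewrite E2 nmZ nm_ofR ger0_norm ?subr_ge0//; apply: le_lt_trans hz.
  by rewrite ler_piMl ?nm_ge0// lerBlDr lerDl.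
apply: D0; last by apply: hd; exact: lt_le_trans s1.
apply: le_lt_trans (nm_tri _ xp _) _.
have h3 : nm (xp - p) < r / 2 by rewrite /xp addrAC subrr add0r.
by rewrite (splitr r); exact: ltrD (lt_le_trans h2 s2) h3.
Qed.

End Sides.

(** * The two sides of a real hypersurface *)

Section Conclusion.
Variables (R : realType) (n : nat).
Local Notation C := (Cx R).
Local Notation V := 'rV[C]_n.+1.
Implicit Types (M D A B K L : set V) (p v x z : V).

Lemma height_shrink M p v (r r' : R) (sg : V -> R) : 0 < r' -> r' <= r ->
  height M p v r sg -> height M p v r' sg.
Proof.
move=> r'0 r'r [r0 csg mono MZ].
have le x : nm (x - p) < r' -> nm (x - p) < r by move=> h; exact: lt_le_trans r'r.
split; first exact: r'0.
- by move=> x /le; exact: csg.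
- by move=> x t /le h1 /le h2; exact: mono.
- by move=> x /le; exact: MZ.
Qed.

Lemma component_iff D K z x : is_component D K -> connected_component D z x -> (K z <-> K x).
Proof.
move=> [y _ ->] zx; split => h; first exact: connected_component_trans zx.
exact: connected_component_trans h (connected_component_sym zx).
Qed.

Lemma component_disj D K L z : is_component D K -> is_component D L -> K <> L -> K z -> L z -> False.
Proof.
move=> [x _ ->] [y _ ->] KL hx hy; apply: KL; apply: same_connected_component.
exact: connected_component_trans hx (connected_component_sym hy).
Qed.

Lemma near_closure p K (e : R) : 0 < e -> closure K p -> exists2 z, nm (z - p) < e & K z.
Proof.
move=> e0 cl; have nb : nbhs p [set z | nm (z - p) < e] by apply/nbhs_nm; exists e.
by have [z [Kz hz]] := cl _ nb; exists z.
Qed.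

(** The points with sg > 0 lie in one component and those with sg < 0 in one component;
    as K contains one of the former and L is disjoint from K, L can only contain points
    of the latter kind, and conversely. *)
Lemma component_sides M D K L p v (r s : R) (sg : V -> R) xp xn : height M p v r sg -> s <= r ->
  D `<=` ~` M -> is_component D K -> is_component D L -> K <> L ->
  (forall z, nm (z - p) < s -> 0 < sg z -> connected_component D z xp) ->
  (forall z, nm (z - p) < s -> sg z < 0 -> connected_component D z xn) ->
  (exists z, [/\ nm (z - p) < s, K z & 0 < sg z]) -> (exists2 z, nm (z - p) < s & L z) ->
  forall x, nm (x - p) < s -> (closure K x -> 0 <= sg x) /\ (closure L x -> sg x <= 0).
Proof.
move=> [r0 csg mono MZ] sr DM cK cL KL hp hn [z [zero_list Kz sz]] [z' z's Lz'].
have le x : nm (x - p) < s -> nm (x - p) < r by move=> h; exact: lt_le_trans sr.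
have sub K' x : is_component D K' -> K' x -> D x.
  by move=> [y _ ->]; exact: connected_component_sub.
have n0 K' x : is_component D K' -> nm (x - p) < s -> K' x -> sg x != 0.
  by move=> cK' hx /(sub _ _ cK') Dx; apply/eqP => /(MZ x (le x hx)); exact: DM.
have Kxp : K xp by exact/(component_iff cK (hp z zero_list sz)).
have hL x : nm (x - p) < s -> L x -> sg x < 0.
  move=> hx Lx; rewrite lt_neqAle (n0 L)//= leNgt; apply/negP => sx.
  by apply: (component_disj cK cL KL Kxp); exact/(component_iff cL (hp x hx sx)).
have Lxn : L xn by exact/(component_iff cL (hn z' z's (hL _ z's Lz'))).
have hK x : nm (x - p) < s -> K x -> 0 < sg x.
  move=> hx Kx; rewrite lt_neqAle eq_sym (n0 K)//= leNgt; apply/negP => sx.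
  by apply: (component_disj cK cL KL _ Lxn); exact/(component_iff cK (hn x hx sx)).
have near_sg x (e : R) : nm (x - p) < s -> 0 < e -> exists2 d : R, 0 < d &
    forall y, nm (y - x) < d -> nm (y - p) < s /\ `|sg x - sg y| < e.
  move=> hx e0.
  have h := (@cvgrPdist_lt R R _ (nbhs x) (nbhs_filter x) _ _).1 (csg x (le x hx)) _ e0.
  have [d d0 hd] := (nbhs_nm _ _).1 h; exists (Num.min d (s - nm (x - p))).
    by rewrite lt_min d0 subr_gt0.
  move=> y; rewrite lt_min => /andP[/hd h1 h2]; split; [|exact: h1].
  by apply: le_lt_trans (nm_tri _ x _) _; rewrite -ltrBrDr.
move=> x hx; split=> cl; rewrite leNgt; apply/negP => sx.
- have sx' : 0 < - sg x by rewrite oppr_gt0.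
  have [d d0 hd] := near_sg x _ hx sx'.
  have [y /hd[ys h] Ky] := near_closure d0 cl.
  move: h; rewrite ltr_distlC addrN => /andP[_ h].
  by have := lt_trans h (hK y ys Ky); rewrite ltxx.
- have [d d0 hd] := near_sg x _ hx sx.
  have [y /hd[ys h] Ly] := near_closure d0 cl.
  have := hL y ys Ly; rewrite ltNge => /negP; apply; apply: ltW.
  exact: pos_of_close h.
Qed.

(** Both components meet every neighbourhood of p, and a point of a component near p has
    sg > 0 or sg < 0; the sign at one point of Op decides which of the two alternatives
    holds. *)
Lemma divided_sides M Omega Op Om p v (r : R) (sg : V -> R) : height M p v r sg -> M p ->
  nbhs p Omega -> divides_into M Omega Op Om -> closure Op p -> closure Om p ->
  exists s : R, 0 < s /\ s <= r /\
   ((forall x, nm (x - p) < s -> (closure Op x -> 0 <= sg x) /\ (closure Om x -> sg x <= 0)) \/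
    (forall x, nm (x - p) < s -> (closure Om x -> 0 <= sg x) /\ (closure Op x -> sg x <= 0))).
Proof.
move=> H Mp /nbhs_nm[r1 r10 hO] [cp cm pm OE] clp clm.
pose D := Omega `\` M; rewrite -/D in cp cm OE.
have r0 := ht_pos H.
pose r' := Num.min r r1.
have r'0 : 0 < r' by rewrite lt_min r0.
have [q1 q2] : r' <= r /\ r' <= r1 by rewrite /r' !ge_min !lexx orbT.
clearbody r'.
have H' := height_shrink r'0 q1 H.
have hD x : nm (x - p) < r' -> ~ M x -> D x.
  by move=> hx nM; split => //; apply: hO; exact: lt_le_trans q2.
have [s1 [xp [s10 s1r hp]]] := positive_side H' Mp hD.
have [s2 [xn [s20 s2r hn]]] := positive_side (height_opp H') Mp hD.
pose s := Num.min s1 s2.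
have s0 : 0 < s by rewrite lt_min s10.
have [p1 p2] : s <= s1 /\ s <= s2 by rewrite /s !ge_min !lexx orbT.
clearbody s.
have sr : s <= r' by exact: le_trans s1r.
have hps z : nm (z - p) < s -> 0 < sg z -> connected_component D z xp.
  by move=> hz; apply: hp; exact: lt_le_trans p1.
have hns z : nm (z - p) < s -> sg z < 0 -> connected_component D z xn.
  by move=> hz sz; apply: hn; [exact: lt_le_trans p2|rewrite oppr_gt0].
have DM : D `<=` ~` M by move=> x [].
have [z zero_list Kz] := near_closure s0 clp.
have [z' z's Lz'] := near_closure s0 clm.
exists s; split=> //; split; first exact: le_trans q1.
have nz y K : nm (y - p) < s -> is_component D K -> K y -> sg y != 0.
  move=> hy [w _ ->] /connected_component_sub [_ nM]; apply/eqP => e; apply: nM.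
  by apply/(ht_zero H') => //; exact: lt_le_trans sr.
have [sz|sz] := ltP 0 (sg z).
  left; apply: (component_sides H' sr DM cp cm pm hps hns); first by exists z.
  by exists z'.
right; apply: (component_sides H' sr DM cm cp _ hps hns).
- by move=> e; exact: pm (esym e).
- exists z'; split => //; rewrite ltNge le_eqVlt (negbTE (nz _ _ z's cm Lz')) /=.
  apply/negP => sz'; have sz2 : sg z < 0 by rewrite lt_neqAle (nz _ _ zero_list cp Kz).
  apply: (component_disj cp cm pm (z := xn)).
    exact/(component_iff cp (hns z zero_list sz2)).
  exact/(component_iff cm (hns z' z's sz')).
- by exists z.
Qed.

(** Once A = B near p, both inequalities hold on A, which therefore lies in the zero set
    of sg. *)
Lemma germs_on_sides M A B p v (r s : R) (sg : V -> R) : height M p v r sg -> M p ->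
  complex_hypersurface_germ p A -> complex_hypersurface_germ p B -> 0 < s -> s <= r ->
  (forall x, nm (x - p) < s -> A x -> 0 <= sg x) ->
  (forall x, nm (x - p) < s -> B x -> sg x <= 0) ->
  germ_eq p A B /\ germ_subset p A M.
Proof.
move=> H Mp hA hB s0 sr As Bs.
have Hs := height_shrink s0 sr H.
have pp : nm (p - p) < s by rewrite subrr nm0.
have sp : sg p = 0 by apply/(ht_zero Hs).
have AB := two_sided_coincide s0 hA hB (ht_mono Hs) sp As Bs.
split => //; apply/nbhs_nm; have [d d0 hd] := (nbhs_nm _ _).1 AB.
exists (Num.min d s); first by rewrite lt_min d0.
move=> x; rewrite lt_min => /andP[/hd h hx] Ax.
apply/(ht_zero Hs) => //; apply/eqP; rewrite eq_le.
by rewrite (As x hx Ax) andbT (Bs x hx (h.1 Ax)).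
Qed.

End Conclusion.

Theorem proposition1p1 (R : realType) (n : nat)
    (M : set 'rV[Cx R]_n.+1) (p : 'rV[Cx R]_n.+1)
    (Omega Omega_p Omega_m Ap Am : set 'rV[Cx R]_n.+1)
    (hM : C1_hypersurface M \/ locally_lipschitz_graph M)
    (hp : M p)
    (hOmega : nbhs p Omega)
    (hdiv : divides_into M Omega Omega_p Omega_m)
    (hAp : complex_hypersurface_germ p Ap)
    (hAm : complex_hypersurface_germ p Am)
    (hApO : germ_subset p Ap (closure Omega_p))
    (hAmO : germ_subset p Am (closure Omega_m)) :
  germ_eq p Ap Am /\ germ_subset p Ap M.
Proof.
have [v [r [sg H]]] : exists v r sg, height M p v r sg.
  by case: hM => h; [exact: C1_height|exact: lipschitz_height].
have clp : closure Omega_p p by exact: (nbhs_singleton hApO hAp.1).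
have clm : closure Omega_m p by exact: (nbhs_singleton hAmO hAm.1).
have [s [s0 [sr sides]]] := divided_sides H hp hOmega hdiv clp clm.
have [d1 d10 hd1] := (nbhs_nm _ _).1 hApO.
have [d2 d20 hd2] := (nbhs_nm _ _).1 hAmO.
pose e := Num.min s (Num.min d1 d2).
have e0 : 0 < e by rewrite !lt_min s0 d10.
have [e1 [e2 e3]] : e <= s /\ e <= d1 /\ e <= d2 by rewrite /e !ge_min !lexx !orbT.
clearbody e.
have er := le_trans e1 sr.
case: sides => h.
  apply: (germs_on_sides H hp hAp hAm e0 er) => x hx Ax.
    by apply: (h x (lt_le_trans hx e1)).1; apply: hd1 => //; exact: lt_le_trans e2.
  by apply: (h x (lt_le_trans hx e1)).2; apply: hd2 => //; exact: lt_le_trans e3.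
have [E S] : germ_eq p Am Ap /\ germ_subset p Am M.
  apply: (germs_on_sides H hp hAm hAp e0 er) => x hx Ax.
    by apply: (h x (lt_le_trans hx e1)).1; apply: hd2 => //; exact: lt_le_trans e3.
  by apply: (h x (lt_le_trans hx e1)).2; apply: hd1 => //; exact: lt_le_trans e2.
have [d3 d30 hd3] := (nbhs_nm _ _).1 E.
have [d4 d40 hd4] := (nbhs_nm _ _).1 S.
split; apply/nbhs_nm.
  by exists d3 => // x /hd3[].
exists (Num.min d3 d4); first by rewrite lt_min d30.
by move=> x; rewrite lt_min => /andP[/hd3[_ h3] /hd4 h4] /h3.
Qed.
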